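(* Let $p=6$ and let $\mathcal{G}$ be a periodic graph with no terminal edge which violates assumption (H$_{per}$), where (H$_{per}$) is the condition: for every edge $e\in E(\mathcal{G})$, removing $e$ from $\mathcal{G}$ generates only non-compact connected components. If $\mu_{\mathcal{G}}<\mu_{\mathbb{R}}$, then ground states with mass $\mu$ (that is, functions $u\in H^1_\mu(\mathcal{G})$ such that $E(u,\mathcal{G})=\mathcal{E}_{\mathcal{G}}(\mu)$) exist if and only if $\mu\in[\mu_{\mathcal{G}},\mu_{\mathbb{R}}]$.
   Context: Metric graphs. A connected metric graph $\mathcal{G}=(V(\mathcal{G}),E(\mathcal{G}))$ is a connected space made up of segments (the edges) glued together at some points (the vertices) according to the topology of the graph; multiple edges and self-loops are allowed. Each edge $e$ is identified with an interval $I_e=[0,\ell_e]$, $0<\ell_e<+\infty$, through a coordinate $x_e$. A compact graph is a metric graph with finitely many vertices and edges, all of finite length. A terminal edge is an edge incident to a vertex of degree $1$. Removing an edge means removing its interior, while its endpoints stay in the graph. Periodic graphs. Let $\mathcal{K}$ be a connected compact graph, $D,R\subset V(\mathcal{K})$ two non-empty sets with $D\cap R=\emptyset$, and $\sigma:D\to R$ a bijection. Take copies $\{\mathcal{K}_i\}_{i\in\mathbb{Z}}$ of $\mathcal{K}$, with $D_i,R_i\subset V(\mathcal{K}_i)$ the corresponding copies of $D,R$, and regard $\sigma$ as a map from $D_i$ to $R_{i+1}$ for every $i\in\mathbb{Z}$. On the disjoint union $\mathbb{G}=\bigcup_{i\in\mathbb{Z}}\mathcal{K}_i$ consider the equivalence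 relation $\sim$ that identifies each $v\in D_i$ with $\sigma(v)\in R_{i+1}$, for every $i\in\mathbb{Z}$ (and no other distinct points). The quotient $\mathcal{G}=\mathbb{G}/\!\sim$ is called a periodic graph with periodicity cell $\mathcal{K}$ and pasting rule $\sigma$. It is assumed throughout that a periodic graph has at least one vertex of degree at least $3$. Function spaces. A function $u:\mathcal{G}\to\mathbb{R}$ is a family $\{u_e\}_{e\in E(\mathcal{G})}$ with $u_e:I_e\to\mathbb{R}$. $L^p(\mathcal{G})$ is the space of functions with $u_e\in L^p(I_e)$ for all $e$ and $\|u\|_{L^p(\mathcal{G})}^p=\int_{\mathcal{G}}|u|^p\,dx=\sum_{e}\int_{I_e}|u_e|^p\,dx_e<\infty$. $H^1(\mathcal{G})$ is the space of continuous functions $u:\mathcal{G}\to\mathbb{R}$ with $u_e\in H^1(I_e)$ for all $e$ and $u,u'\in L^2(\mathcal{G})$. All functions are real-valued. For $\mu>0$, $H^1_\mu(\mathcal{G})=\{u\in H^1(\mathcal{G}):\|u\|_{L^2(\mathcal{G})}^2=\mu\}$. Energy and critical mass ($p=6$). $E(u,\mathcal{G})=\frac12\int_{\mathcal{G}}|u'|^2\,dx-\frac16\int_{\mathcal{G}}|u|^6\,dx$ and $\mathcal{E}_{\mathcal{G}}(\mu)=\inf_{u\in H^1_\mu(\mathcal{G})}E(u,\mathcal{G})$ for $\mu>0$. The critical mass is $\mu_{\mathcal{G}}=\sqrt{3/C_{\mathcal{G}}}$, where $C_{\mathcal{G}}$ is the optimal (smallest) constant in the Gagliardo-Nirenberg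 inequality $\|u\|_{L^6(\mathcal{G})}^6\le C_{\mathcal{G}}\|u\|_{L^2(\mathcal{G})}^4\|u'\|_{L^2(\mathcal{G})}^2$ for all $u\in H^1(\mathcal{G})$. For the real line the corresponding value is $\mu_{\mathbb{R}}=\frac{\sqrt3}{2}\pi$. *)

(* Defs.v *)
From HB Require Import structures.
From Stdlib Require Import Relation_Operators.
From mathcomp Require Import all_boot all_order all_algebra generic_quotient.
From mathcomp Require Import all_classical all_reals all_analysis.

Set Implicit Arguments.
Unset Strict Implicit.
Unset Printing Implicit Defensive.

Import Order.TTheory GRing.Theory Num.Theory.
Import numFieldNormedType.Exports.
Local Open Scope classical_set_scope.
Local Open Scope ring_scope.
Local Open Scope quotient_scope.

(* The edge [e] is the interval [0, len e]; its end at coordinate 0 is glued to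
   the vertex [endpoint e false], its end at coordinate [len e] to the vertex
   [endpoint e true].  Multiple edges and self-loops are allowed. *)
Record metric_graph (R : realType) := MetricGraph {
  vtx : choiceType;
  edge : choiceType;
  endpoint : edge -> bool -> vtx;
  len : edge -> R;
  len_gt0 : forall e, 0 < len e
}.
Arguments endpoint {R} _ _ _.
Arguments len {R} _ _.

Section Combinatorics.
Variables (R : realType) (G : metric_graph R).

Definition ends (v : vtx G) : set (edge G * bool) :=
  [set h | endpoint G h.1 h.2 = v].

(* Degrees count edge ends, so that a self-loop contributes 2. *)
Definition degree_eq1 (v : vtx G) : Prop := (ends v #= `I_1)%card.
Definition degree_ge3 (v : vtx G) : Prop := (`I_3 #<= ends v)%card.

Definition terminal_edge (e : edge G) : Prop :=
  exists b, degree_eq1 (endpoint G e b).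

Definition adjacent (A : set (edge G)) (v w : vtx G) : Prop :=
  exists2 e, A e & exists b, endpoint G e b = v /\ endpoint G e (~~ b) = w.

(* [reachable A v w]: [w] can be joined to [v] through edges of [A] only. *)
Definition reachable (A : set (edge G)) : vtx G -> vtx G -> Prop :=
  clos_refl_trans (vtx G) (adjacent A).

Definition connected_graph : Prop := forall v w, reachable setT v w.

Definition compact_graph : Prop :=
  finite_set [set: vtx G] /\ finite_set [set: edge G].

(* Vertices and edges of the connected component of [v] in the subgraph of [G]
   with all the vertices of [G] and with edge set [A]. *)
Definition component_vtx (A : set (edge G)) (v : vtx G) : set (vtx G) :=
  [set w | reachable A v w].
Definition component_edge (A : set (edge G)) (v : vtx G) : set (edge G) :=
  [set e | A e /\ exists b, reachable A v (endpoint G e b)].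

Definition compact_component (A : set (edge G)) (v : vtx G) : Prop :=
  finite_set (component_vtx A v) /\ finite_set (component_edge A v).

(* The endpoints of the removed edge stay in the graph, so every component of
   the remaining graph contains a vertex. *)
Definition H_per : Prop :=
  forall (e : edge G) (v : vtx G), ~ compact_component [set~ e] v.

End Combinatorics.

Record periodicity_data (R : realType) := PeriodicityData {
  cell : metric_graph R;
  cell_compact : compact_graph cell;
  cell_connected : connected_graph cell;
  pasteD : set (vtx cell);
  pasteR : set (vtx cell);
  pasteD_neq0 : pasteD !=set0;
  pasteR_neq0 : pasteR !=set0;
  paste_disj : pasteD `&` pasteR = set0;
  paste : vtx cell -> vtx cell;
  paste_bij : set_bij pasteD pasteR paste
}.

Section PeriodicGraph.
Variables (R : realType) (P : periodicity_data R).
Let K := cell P.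

(* The pair [(i, v)] is the copy of the vertex [v] in the [i]-th cell. *)
Definition paste_step (x y : int * vtx K) : Prop :=
  pasteD x.2 /\ y = (x.1 + 1, paste x.2).

Definition pasted : rel (int * vtx K) :=
  fun x y => `[< clos_refl_sym_trans _ paste_step x y >].

Lemma pasted_refl : reflexive pasted.
Proof. by move=> x; apply/asboolP; apply: rst_refl. Qed.

Lemma pasted_sym : symmetric pasted.
Proof.
by move=> x y; apply/asboolP/asboolP; apply: rst_sym.
Qed.

Lemma pasted_trans : transitive pasted.
Proof.
move=> y x z /asboolP xy /asboolP yz.
by apply/asboolP; apply: rst_trans xy yz.
Qed.

Canonical pasted_equiv := EquivRel pasted pasted_refl pasted_sym pasted_trans.

Definition periodic_vtx : choiceType := {eq_quot pasted_equiv}.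

Definition periodic_endpoint (e : int * edge K) (b : bool) : periodic_vtx :=
  \pi_{eq_quot pasted_equiv} (e.1, endpoint K e.2 b).

Definition periodic_graph : metric_graph R :=
  @MetricGraph R periodic_vtx (int * edge K)%type periodic_endpoint
    (fun e => len K e.2) (fun e => len_gt0 e.2).

End PeriodicGraph.

Section Sobolev.
Variable R : realType.
Local Notation mu := (@lebesgue_measure R).

Definition Lp_itv (p : nat) (l : R) (f : R -> R) : Prop :=
  measurable_fun `[0, l] f /\
  (\int[mu]_(x in `[0%R, l]) (`|f x| ^+ p)%:E < +oo)%E.

(* C^1 functions with compact support in the open interval (0, l); C^oo test
   functions would give the same weak derivatives. *)
Definition test_function (l : R) (phi : R -> R) : Prop :=
  [/\ forall x : R, derivable phi x 1,
      continuous (derive1 phi) &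
      exists a b : R,
        [/\ 0 < a, b < l & forall x : R, ~ (a <= x <= b) -> phi x = 0]].

Definition is_weak_derivative (l : R) (u g : R -> R) : Prop :=
  forall phi, test_function l phi ->
    \int[mu]_(x in `[0, l]) (u x * derive1 phi x) =
    - \int[mu]_(x in `[0, l]) (g x * phi x).

Definition H1_itv (l : R) (u : R -> R) : Prop :=
  Lp_itv 2 l u /\ exists g, Lp_itv 2 l g /\ is_weak_derivative l u g.

(* A representative of the weak derivative, which is unique up to equality
   almost everywhere on [0, l]; meaningful only if [H1_itv l u]. *)
Definition weak_derivative (l : R) (u : R -> R) : R -> R :=
  xget (fun=> 0) [set g | Lp_itv 2 l g /\ is_weak_derivative l u g].

End Sobolev.

Section Energy.
Variables (R : realType) (G : metric_graph R).
Local Notation mu := (@lebesgue_measure R).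

(* A function on [G] is a family [u e] of which only the restrictions to the
   intervals [0, len e] matter: no definition below depends on other values. *)
Definition graph_fun := edge G -> R -> R.

Definition graph_deriv (u : graph_fun) : graph_fun :=
  fun e => weak_derivative (len G e) (u e).

(* The p-th power of the L^p norm on [G]. *)
Definition Lp_normX (p : nat) (u : graph_fun) : \bar R :=
  (\esum_(e in [set: edge G])
     \int[mu]_(x in `[0%R, len G e]) (`|u e x| ^+ p)%:E)%E.

Definition in_Lp (p : nat) (u : graph_fun) : Prop :=
  (forall e, Lp_itv p (len G e) (u e)) /\ (Lp_normX p u < +oo)%E.

Definition end_value (u : graph_fun) (h : edge G * bool) : R :=
  u h.1 (if h.2 then len G h.1 else 0).

Definition graph_continuous (u : graph_fun) : Prop :=
  (forall e, {within `[0, len G e], continuous (u e)}) /\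
  (forall h k, endpoint G h.1 h.2 = endpoint G k.1 k.2 ->
     end_value u h = end_value u k).

Definition in_H1 (u : graph_fun) : Prop :=
  [/\ graph_continuous u,
      forall e, H1_itv (len G e) (u e),
      in_Lp 2 u &
      in_Lp 2 (graph_deriv u)].

Definition in_H1_mass (m : R) (u : graph_fun) : Prop :=
  in_H1 u /\ Lp_normX 2 u = m%:E.

Definition energy (u : graph_fun) : \bar R :=
  ((2^-1)%:E * Lp_normX 2 (graph_deriv u) - (6^-1)%:E * Lp_normX 6 u)%E.

Definition ground_level (m : R) : \bar R :=
  ereal_inf [set energy u | u in in_H1_mass m].

Definition ground_state (m : R) (u : graph_fun) : Prop :=
  in_H1_mass m u /\ energy u = ground_level m.

Definition gagliardo_nirenberg (C : R) : Prop :=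
  forall u, in_H1 u ->
    (Lp_normX 6 u <=
     C%:E * Lp_normX 2 u ^+ 2 * Lp_normX 2 (graph_deriv u))%E.

Definition GN_constant : R := inf [set C | gagliardo_nirenberg C].

Definition critical_mass : R := Num.sqrt (3 / GN_constant).

End Energy.

Definition critical_mass_line (R : realType) : R := Num.sqrt 3 / 2 * pi.

(* Main.v *)
Require Import Defs.
From Stdlib Require Import Relation_Operators.
From mathcomp Require Import all_boot all_order all_algebra.
From mathcomp Require Import all_classical all_reals all_analysis.
From mathcomp Require Import measurable_realfun.
From mathcomp Require Import zify ring lra.

(** Write m, A and B for the integrals of u^2, u'^2 and u^6, so that the energy
    is E = A/2 - B/6, and mu_R = pi sqrt 3 / 2 for the critical mass of the line.

    Everything quantitative comes from one calibration, [arc_ineq].  If w(x) is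
    the mass of u on [a, x], the function - c tan (r w(x) - p) u(x)^4, with
    r = 2 / sqrt 3 and c = 1 / (4 sqrt 3), has a derivative that is at most
    u'^2/2 - u^6/6.  Hence the energy of an interval is controlled by the values
    u^4 at its two ends, weighted by tangents of two angles that add up to
    r times the mass of the interval; the calibration is available as long as
    both angles are below pi/2, and r mu_R = pi.  No rearrangement is used.

    Below mu_R the energy is bounded from below.  Every edge is cut near its
    ends, at points where u^4 is controlled by the square of the mass nearby
    ([goodcut]), and the resulting pieces are grouped around vertices and
    midpoints of edges.  As there is no terminal edge, each piece has a partner
    with the same centre, and a pair of partners is calibrated like one interval
    of the line ([pair_arms]).  If every pair carries at most mu_R - eta, this
    bounds B/6 - A/2 by a constant ([spread_bound]).  If some pair carries more,
    little mass is left elsewhere, and moving the two cuts outwards bounds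
    B/6 - A/2 by a multiple of eta ([concentrated_bound]).  Applied to multiples
    of u close to u, these two estimates show that for masses at most mu_R, mu_R
    included, functions of energy at most - c < 0 have bounded A
    ([bound_critical]).

    On the periodic graph, functions of small A look on each cell like a linear
    function on a segment whose length is the total length of the cell: along
    the chain of cells these segments form a line, and the calibration of that
    line gives B <= 3 kappa A with kappa < 1 when the mass stays below mu_R and
    A is small ([vanishing]).

    Compactness is direct: after translation by cells, a minimizing sequence
    keeps a fixed amount of mass in one cell.  Take pointwise limits along an
    ultrafilter; m and A split asymptotically by the parallelogram identity and
    lower semicontinuity ([split_limit]), B splits as in the Brezis-Lieb lemma
    ([brezis_lieb]).  By scaling, a nonzero function of smaller mass m' has an
    energy strictly above the infimum times m'/m ([excess_bound]); so no mass is
    lost and the limit is a minimizer ([minimizer]).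

    The theorem follows by distinguishing four ranges of the mass m.
    If m < mu_G, the Gagliardo-Nirenberg inequality makes all energies positive,
    while functions spread over many cells have energies tending to 0
    ([spreading]).  If mu_G < m <= mu_R the infimum is negative and finite, and
    minimizing sequences are bounded by [bound_critical].  If m = mu_G < mu_R the
    infimum is 0 and the sequence is taken optimal for the Gagliardo-Nirenberg
    constant: [bound_strict] bounds A from above and [vanishing] bounds it from
    below.  If m > mu_R, truncated solitons on a single edge have energies
    tending to minus infinity ([supercritical]). *)

Set Implicit Arguments.
Unset Strict Implicit.
Unset Printing Implicit Defensive.
Import Order.TTheory GRing.Theory Num.Theory.
Import numFieldNormedType.Exports.
Local Open Scope classical_set_scope.
Local Open Scope ring_scope.
Local Open Scope quotient_scope.

(** * Integrals and primitives on an interval *)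

Section Tools.
Variable R : realType.
Local Notation mu := (@lebesgue_measure R).
Implicit Types (f g h u : R -> R) (a b c d : R).

(** Real valued integrals over closed intervals; all the analysis below is done
    with functions whose values outside the interval are irrelevant. *)
Definition intg a b f : bool := mu.-integrable `[a, b] (EFin \o f).
Definition itg a b f : R := \int[mu]_(x in `[a, b]) f x.

Lemma in_cc a b x : (`[a, b]%classic x) = (a <= x <= b) :> Prop.
Proof. by rewrite /= in_itv. Qed.

Lemma intgD a b f g : intg a b f -> intg a b g -> intg a b (fun x => f x + g x).
Proof. by move=> hf hg; have := @integrableD _ _ _ mu _ (measurable_itv _) _ _ hf hg; apply: eq_integrable. Qed.
Lemma intgZ a b (k : R) f : intg a b f -> intg a b (fun x => k * f x).
Proof. by move=> hf; have := @integrableZl _ _ _ mu _ (measurable_itv _) k _ hf; apply: eq_integrable. Qed.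
Lemma intgN a b f : intg a b f -> intg a b (fun x => - f x).
Proof. by move=> hf; have := integrableN hf; apply: eq_integrable. Qed.
Lemma intgB a b f g : intg a b f -> intg a b g -> intg a b (fun x => f x - g x).
Proof. by move=> hf hg; apply: intgD => //; apply: intgN. Qed.
Lemma intgS a b c d f : a <= c -> d <= b -> intg a b f -> intg c d f.
Proof.
move=> ac db; apply: integrableS => //.
by apply: subset_itv; rewrite bnd_simp.
Qed.
Lemma intg_mfun a b f : intg a b f -> measurable_fun `[a, b] f.
Proof. by move=> /measurable_int /measurable_EFinP. Qed.
Lemma intg_le a b f g : measurable_fun `[a, b] f -> intg a b g ->
  (forall x, a <= x <= b -> `|f x| <= g x) -> intg a b f.
Proof.
move=> mf ig fg; apply: (@le_integrable _ _ _ mu _ (measurable_itv _) _ (EFin \o g)) => //.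
  exact/measurable_EFinP.
move=> x Dx /=; rewrite lee_fin; apply: le_trans (fg _ _) (ler_norm _).
by move: Dx; rewrite /= in_itv.
Qed.
Lemma intg_abs a b f : intg a b f -> intg a b (fun x => `|f x|).
Proof. by move=> hf; have := integrable_norm hf; apply: eq_integrable. Qed.
Lemma intg_cont a b f : {within `[a, b], continuous f} -> intg a b f.
Proof. by move=> cf; apply: continuous_compact_integrable => //; exact: segment_compact. Qed.
Lemma intg_cst a b c : intg a b (fun=> c).
Proof. by apply: intg_cont; apply: continuous_subspaceT => x; exact: cvg_cst. Qed.
Lemma intg_eq a b f g : (forall x, a <= x <= b -> f x = g x) -> intg a b f -> intg a b g.
Proof.
move=> fg; apply: eq_integrable => // x; rewrite inE /= in_itv /= => h.
by rewrite /= fg.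
Qed.

Lemma itg_eq a b f g : (forall x, a <= x <= b -> f x = g x) -> itg a b f = itg a b g.
Proof. by move=> fg; apply: eq_Rintegral => x; rewrite inE /= in_itv /= => h; rewrite fg. Qed.
Lemma itgD a b f g : intg a b f -> intg a b g ->
  itg a b (fun x => f x + g x) = itg a b f + itg a b g.
Proof. by move=> hf hg; rewrite /itg RintegralD. Qed.
Lemma itgB a b f g : intg a b f -> intg a b g ->
  itg a b (fun x => f x - g x) = itg a b f - itg a b g.
Proof. by move=> hf hg; rewrite /itg RintegralB. Qed.
Lemma itgZ a b k f : intg a b f -> itg a b (fun x => k * f x) = k * itg a b f.
Proof. by move=> hf; rewrite /itg RintegralZl. Qed.
Lemma itg_le a b f g : intg a b f -> intg a b g ->
  (forall x, a <= x <= b -> f x <= g x) -> itg a b f <= itg a b g.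
Proof. by move=> hf hg fg; apply: le_Rintegral => // x; rewrite in_cc => /fg. Qed.
Lemma itg_ge0 a b f : (forall x, a <= x <= b -> 0 <= f x) -> 0 <= itg a b f.
Proof. by move=> f0; apply: Rintegral_ge0 => x; rewrite in_cc => /f0. Qed.
Lemma itg_cst a b c : a <= b -> itg a b (fun=> c) = c * (b - a).
Proof.
move=> ab; rewrite /itg Rintegral_cst//= lebesgue_measure_itv/= lte_fin.
by case: ltgtP ab => // ->; rewrite subrr.
Qed.
Lemma itg_abs a b f : intg a b f -> `|itg a b f| <= itg a b (fun x => `|f x|).
Proof. by move=> hf; apply: le_normr_Rintegral. Qed.
Lemma itgxx a f : itg a a f = 0.
Proof. by rewrite /itg set_itv1 Rintegral_set1. Qed.
Lemma itg_cat a b c f : a <= c -> c <= b -> intg a b f ->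
  itg a b f = itg a c f + itg c b f.
Proof.
move=> ac cb hf; have := @Rintegral_itvB _ f (BLeft a) (BRight b) c hf.
rewrite !bnd_simp => /(_ ac cb) h.
have -> : itg c b f = \int[mu]_(x in `]c, b]) f x.
  rewrite /itg -(Rintegral_itv_obnd_cbnd)//.
  apply: (@integrableS _ _ _ mu `[a, b]) => //.
  by apply: subset_itv; rewrite bnd_simp.
by rewrite /itg -h; ring.
Qed.
Lemma itg_sub_le a b c d f : a <= c -> c <= d -> d <= b -> intg a b f ->
  (forall x, a <= x <= b -> 0 <= f x) -> itg c d f <= itg a b f.
Proof.
move=> ac cd db hf f0.
rewrite (@itg_cat a b c)// ?(le_trans cd)// (@itg_cat c b d)//; last exact: intgS hf.
have h1 : 0 <= itg a c f.
  by apply: itg_ge0 => x /andP[h1 h2]; apply: f0; rewrite h1 (le_trans h2)// (le_trans cd).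
have h2 : 0 <= itg d b f.
  by apply: itg_ge0 => x /andP[h3 h4]; apply: f0; rewrite h4 andbT (le_trans ac)// (le_trans cd).
lra.
Qed.
Lemma itg_EFin a b f : intg a b f ->
  (\int[mu]_(x in `[a, b]) (f x)%:E)%E = (itg a b f)%:E.
Proof. by move=> hf; rewrite /itg /Rintegral fineK//; exact: integrable_fin_num. Qed.

(** Continuity on [a, b] with one-sided conditions at the ends, in the form in
    which it is checked by hand. *)
Definition cts a b f := forall x, a <= x <= b -> forall e, 0 < e ->
  exists2 d, 0 < d & forall y, a <= y <= b -> `|x - y| < d -> `|f x - f y| < e.

Lemma ctsP a b f : {within `[a, b], continuous f} <-> cts a b f.
Proof.
split=> [cf x xab e e0|cf].
  have /= := (subspace_continuousP _ _).1 cf x.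
  rewrite in_itv /= => /(_ xab) /cvgrPdist_lt /(_ _ e0) h.
  move: h; rewrite near_withinE => /nbhs_ballP[d /= d0 h].
  exists d => // y yab xy; apply: h => //=.
apply/subspace_continuousP => x; rewrite /= in_itv /= => xab.
apply/cvgrPdist_lt => e e0; rewrite near_withinE.
have [d d0 h] := cf _ xab _ e0.
apply/nbhs_ballP; exists d => //= y xy; rewrite in_itv /= => yab.
exact: h.
Qed.

Lemma cts_bnd a b f : cts a b f -> exists2 M, 0 <= M & forall x, a <= x <= b -> `|f x| <= M.
Proof.
move=> /ctsP cf; have [ab|ba] := leP a b; last first.
  by exists 0 => // x /andP[h1 h2]; move: (le_lt_trans (le_trans h1 h2) ba); rewrite ltxx.
have cn : {within `[a, b], continuous (fun x => `|f x|)}.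
  move=> x; apply: cvg_norm; exact: cf.
have [c _ h] := EVT_max ab cn; by exists `|f c|.
Qed.

Lemma cts_sub a b c d f : a <= c -> d <= b -> cts a b f -> cts c d f.
Proof.
move=> ac db cf x /andP[h1 h2] e e0.
have xab : a <= x <= b by rewrite (le_trans ac h1) (le_trans h2 db).
have [r r0 h] := cf _ xab _ e0; exists r => // y /andP[h3 h4].
by apply: h; rewrite (le_trans ac h3) (le_trans h4 db).
Qed.

Lemma cts_intg a b f : cts a b f -> intg a b f.
Proof. by move=> /ctsP; exact: intg_cont. Qed.
Lemma cts_mfun a b f : cts a b f -> measurable_fun `[a, b] f.
Proof. by move=> /cts_intg /intg_mfun. Qed.
Lemma ctsD a b f g : cts a b f -> cts a b g -> cts a b (fun x => f x + g x).
Proof. by move=> /ctsP cf /ctsP cg; apply/ctsP => x; apply: cvgD; [exact: cf|exact: cg]. Qed.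
Lemma ctsM a b f g : cts a b f -> cts a b g -> cts a b (fun x => f x * g x).
Proof. by move=> /ctsP cf /ctsP cg; apply/ctsP => x; apply: cvgM; [exact: cf|exact: cg]. Qed.
Lemma ctsN a b f : cts a b f -> cts a b (fun x => - f x).
Proof. by move=> /ctsP cf; apply/ctsP => x; apply: cvgN; exact: cf. Qed.
Lemma cts_cst a b c : cts a b (fun=> c).
Proof. by apply/ctsP; apply: continuous_subspaceT => x; exact: cvg_cst. Qed.
Lemma ctsX a b f n : cts a b f -> cts a b (fun x => f x ^+ n).
Proof.
move=> cf; elim: n => [|n ih]; first exact: cts_cst.
have := ctsM cf ih; congr (cts _ _ _); apply/funext => x; by rewrite exprS.
Qed.
Lemma cts_eq a b f g : (forall x, a <= x <= b -> f x = g x) -> cts a b f -> cts a b g.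
Proof.
move=> fg cf x xab e e0; have [d d0 h] := cf _ xab _ e0.
by exists d => // y yab xy; rewrite -!fg//; exact: h.
Qed.
Lemma cts_compl a b (F : R -> R) f : continuous F -> cts a b f -> cts a b (fun x => F (f x)).
Proof. by move=> cF /ctsP cf; apply/ctsP => x; apply: continuous_comp; [exact: cf|exact: cF]. Qed.
Lemma cts_comp a b (F : R -> R) f : (forall x, a <= x <= b -> {for f x, continuous F}) ->
  cts a b f -> cts a b (fun x => F (f x)).
Proof.
move=> cF cf x xab e e0.
have /cvgrPdist_lt /(_ _ e0) /nbhs_ballP[r /= r0 h] := cF x xab.
have [d d0 hd] := cf _ xab _ r0; exists d => // y yab xy.
by apply: h; exact: hd.
Qed.

(** The comparison with a holds up to a largest t, and at that point it could be
    continued.  This replaces a covering argument in [primM]. *)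
Lemma straddle a b (Phi N : R -> R) : a <= b ->
  (forall x, a <= x <= b -> exists2 d, 0 < d & forall s t,
     a <= s -> s <= x -> x <= t -> t <= b -> x - s < d -> t - x < d ->
     Phi t - Phi s <= N t - N s) ->
  Phi b - Phi a <= N b - N a.
Proof.
move=> ab H.
pose S := [set t | a <= t <= b /\ Phi t - Phi a <= N t - N a].
have Sa : S a by rewrite /S /= lexx ab !subrr.
have hS : has_sup S.
  by split; [exists a|exists b => t [/andP[_]]].
set c := sup S.
have ac : a <= c by apply: (sup_upper_bound hS).
have cb : c <= b by apply: ge_sup => [|t [/andP[_]//]]; exists a.
have cab : a <= c <= b by rewrite ac cb.
have [d d0 hd] := H _ cab.
have [s Ss ds] := sup_adherent d0 hS.
have sc : s <= c by apply: (sup_upper_bound hS).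
have [/andP[as_ sb] ps] := Ss.
have Sc : Phi c - Phi a <= N c - N a.
  have := hd s c as_ sc (lexx _) cb.
  rewrite subrr => h; have := h _ d0; rewrite -/c in ds.
  move=> h2; have : Phi c - Phi s <= N c - N s by apply: h2; lra.
  by move: ps; lra.
move: cb; rewrite le_eqVlt => /predU1P[<-//|cb].
pose t := Num.min b (c + d / 2).
have ct : c < t by rewrite /t lt_min cb /=; lra.
have tb : t <= b by rewrite /t ge_min lexx.
have td : t <= c + d / 2 by rewrite /t ge_min lexx orbT.
have : S t.
  split; first by rewrite tb (le_trans ac (ltW ct)).
  have := hd c t ac (lexx _) (ltW ct) tb; rewrite subrr => /(_ d0) h.
  have : Phi t - Phi c <= N t - N c by apply: h; lra.
  by move: Sc; lra.
by move=> /(sup_upper_bound hS); rewrite leNgt ct.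
Qed.

(** Absolute continuity, stated through an integrable density; the density is
    only determined up to a null set. *)
Definition prim a b (P p : R -> R) :=
  intg a b p /\ forall x y, a <= x -> x <= y -> y <= b -> P y - P x = itg x y p.

Lemma prim_intro a b P p : intg a b p ->
  (forall x, a <= x <= b -> P x = P a + itg a x p) -> prim a b P p.
Proof.
move=> ip h; split=> // x y ax xy yb.
have ay := le_trans ax xy; have xb := le_trans xy yb.
rewrite (h y) ?ay// (h x) ?ax// (@itg_cat a y x)//; last exact: intgS ip.
ring.
Qed.
Lemma prim_sub a b c d P p : a <= c -> d <= b -> prim a b P p -> prim c d P p.
Proof.
move=> ac db [ip h]; split; first exact: intgS ip.
by move=> x y cx xy yd; apply: h => //; [exact: le_trans ac cx|exact: le_trans yd db].
Qed.
Lemma prim_cts a b P p : prim a b P p -> cts a b P.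
Proof.
move=> [ip h]; have [ab|ba] := leP a b; last first.
  by move=> x /andP[h1 h2]; move: (le_lt_trans (le_trans h1 h2) ba); rewrite ltxx.
have := parameterized_integral_continuous ab ip => /ctsP c.
have := ctsD c (@cts_cst a b (P a)); apply: cts_eq => x /andP[ax xb].
by have := h a x (lexx _) ax xb; rewrite /itg /parameterized_integral => <-; ring.
Qed.
Lemma prim_eq a b P p Q q : (forall x, a <= x <= b -> P x = Q x) ->
  (forall x, a <= x <= b -> p x = q x) -> prim a b P p -> prim a b Q q.
Proof.
move=> PQ pq [ip h]; split; first exact: intg_eq ip.
move=> x y ax xy yb; rewrite -!PQ ?ax ?yb ?(le_trans ax)// ?(le_trans xy)// h//.
apply: itg_eq => z /andP[xz zy]; apply: pq.
by rewrite (le_trans ax xz) (le_trans zy yb).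
Qed.
Lemma prim_cst a b c : prim a b (fun=> c) (fun=> 0).
Proof.
split; first exact: intg_cst.
by move=> x y _ xy _; rewrite itg_cst// subrr mul0r.
Qed.
Lemma primD a b P p Q q : prim a b P p -> prim a b Q q ->
  prim a b (fun x => P x + Q x) (fun x => p x + q x).
Proof.
move=> [ip hP] [iq hQ]; split; first exact: intgD.
move=> x y ax xy yb; rewrite itgD; try exact: intgS; last 2 first.
- exact: intgS ip.
- exact: intgS iq.
by rewrite -hP// -hQ//; ring.
Qed.
Lemma primZ a b k P p : prim a b P p -> prim a b (fun x => k * P x) (fun x => k * p x).
Proof.
move=> [ip hP]; split; first exact: intgZ.
move=> x y ax xy yb; rewrite itgZ; last exact: intgS ip.
by rewrite -hP//; ring.
Qed.

Lemma intg_mul_cts a b f g : cts a b f -> intg a b g -> intg a b (fun x => f x * g x).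
Proof.
move=> cf ig; have [M M0 hM] := cts_bnd cf.
apply: (@intg_le _ _ _ (fun x => M * `|g x|)).
- apply: measurable_funM; [exact: cts_mfun|exact: intg_mfun].
- by apply: intgZ; apply: intg_abs.
- by move=> x /hM h; rewrite normrM ler_wpM2r.
Qed.

(** On a short interval [s, t] the defect of the product rule is the integral of
    p (Q t - Q) + (P s - P) q, which is small compared with that of |p| + |q|;
    [straddle] adds up these estimates. *)
Lemma primM a b P p Q q : prim a b P p -> prim a b Q q ->
  prim a b (fun x => P x * Q x) (fun x => p x * Q x + P x * q x).
Proof.
move=> hP hQ; have cP := prim_cts hP; have cQ := prim_cts hQ.
have [ip eP] := hP; have [iq eQ] := hQ.
have ipQ : intg a b (fun x => p x * Q x).
  by have := intg_mul_cts cQ ip; apply: intg_eq => x _; rewrite mulrC.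
have iPq : intg a b (fun x => P x * q x) by exact: intg_mul_cts.
have irr : intg a b (fun x => p x * Q x + P x * q x) by exact: intgD.
split=> // x y ax xy yb.
pose Phi z := P z * Q z - itg x z (fun x => p x * Q x + P x * q x).
pose V z := itg x z (fun z => `|p z| + `|q z|).
have iV : intg a b (fun z => `|p z| + `|q z|) by apply: intgD; exact: intg_abs.
suff main : forall e, 0 < e -> `|Phi y - Phi x| <= e * V y.
  have : Phi y - Phi x = 0.
    apply/eqP; rewrite -normr_le0; apply/ler_addgt0Pr => e e0; rewrite add0r.
    have V0 : 0 <= V y by apply: itg_ge0 => z _; rewrite addr_ge0.
    have := main (e / (V y + 1)) (divr_gt0 e0 (ltr_wpDl V0 ltr01)).
    move=> h; apply: (le_trans h).
    rewrite mulrAC ler_pdivrMr ?(ltr_wpDl V0 ltr01)// ler_wpM2l// ?ltW//.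
    by rewrite ltrDl.
  by rewrite /Phi itgxx; lra.
move=> e e0.
have key : forall z, x <= z <= y -> exists2 d, 0 < d & forall s t,
     x <= s -> s <= z -> z <= t -> t <= y -> z - s < d -> t - z < d ->
     `|Phi t - Phi s| <= e * V t - e * V s.
  move=> z /andP[xz zy].
  have zab : a <= z <= b by rewrite (le_trans ax xz) (le_trans zy yb).
  have e20 : 0 < e / 2 by rewrite divr_gt0.
  have [d1 d10 h1] := cP _ zab _ e20.
  have [d2 d20 h2] := cQ _ zab _ e20.
  exists (Num.min d1 d2); first by rewrite lt_min d10.
  move=> s t xs sz zt ty; rewrite !lt_min => /andP[s1 s2] /andP[t1 t2].
  have st := le_trans sz zt.
  have as_ := le_trans ax xs; have tb := le_trans ty yb.
  have near : forall r, s <= r -> r <= t -> `|P z - P r| < e / 2 /\ `|Q z - Q r| < e / 2.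
    move=> r sr rt; have rab : a <= r <= b by rewrite (le_trans as_ sr) (le_trans rt tb).
    by split; [apply: h1|apply: h2] => //; rewrite ltr_norml; apply/andP; clear -s1 s2 t1 t2 sr rt sz zt; split; lra.
  have irr' : intg s t (fun x => p x * Q x + P x * q x) by exact: intgS irr.
  have -> : Phi t - Phi s = itg s t (fun r => p r * (Q t - Q r) + (P s - P r) * q r).
    rewrite /Phi (@itg_cat x t s)//; last by apply: intgS irr.
    have -> : itg s t (fun r => p r * (Q t - Q r) + (P s - P r) * q r) =
              itg s t (fun r => (Q t * p r + P s * q r) - (p r * Q r + P r * q r)).
      by apply: itg_eq => r _; ring.
    have i1 : intg s t (fun r => Q t * p r) by apply: intgZ; exact: intgS ip.
    have i2 : intg s t (fun r => P s * q r) by apply: intgZ; exact: intgS iq.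
    rewrite (itgB (intgD i1 i2) irr') (itgD i1 i2) !itgZ; [|exact: intgS iq|exact: intgS ip].
    by rewrite -eP// -eQ//; ring.
  have -> : e * V t - e * V s = itg s t (fun r => e * (`|p r| + `|q r|)).
    rewrite itgZ; last exact: intgS iV.
    rewrite /V (@itg_cat x t s)//; last by apply: intgS iV.
    by ring.
  have i3 : intg s t (fun r => p r * (Q t - Q r) + (P s - P r) * q r).
    have : intg s t (fun r => (Q t * p r + P s * q r) - (p r * Q r + P r * q r)).
      apply: intgB => //; apply: intgD; apply: intgZ; [exact: intgS ip|exact: intgS iq].
    by apply: intg_eq => r _; ring.
  apply: le_trans (itg_abs i3) _.
  apply: itg_le; [exact: intg_abs| by apply: intgZ; exact: intgS iV|].
  move=> r /andP[sr rt].
  apply: le_trans (ler_normD _ _) _; rewrite !normrM mulrDr.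
  have [n1 n2] := near r sr rt; have [n3 n4] := near s (lexx _) st.
  have [n5 n6] := near t st (lexx _).
  have : `|Q t - Q r| <= e.
    have -> : Q t - Q r = (Q z - Q r) - (Q z - Q t) by ring.
    by apply: le_trans (ler_normB _ _) _; lra.
  have : `|P s - P r| <= e.
    have -> : P s - P r = (P z - P r) - (P z - P s) by ring.
    by apply: le_trans (ler_normB _ _) _; lra.
  move=> h3 h4; apply: lerD; last by rewrite ler_wpM2r.
  by rewrite mulrC ler_wpM2r.
have V0 : V x = 0 by rewrite /V itgxx.
rewrite ler_norml; apply/andP; split.
- have := @straddle x y (fun z => - Phi z) (fun z => e * V z) xy.
  rewrite V0 mulr0 subr0 => h.
  rewrite -[_ - Phi x]opprK lerN2 opprD; apply: h => z zxy.
  have [d d0 hd] := key z zxy; exists d => // s t h1 h2 h3 h4 h5 h6.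
  apply: le_trans (hd s t h1 h2 h3 h4 h5 h6).
  by rewrite -opprD; apply: le_trans (ler_norm _) _; rewrite normrN.
- have := @straddle x y Phi (fun z => e * V z) xy.
  rewrite V0 mulr0 subr0; apply => z zxy.
  have [d d0 hd] := key z zxy; exists d => // s t h1 h2 h3 h4 h5 h6.
  by apply: le_trans (hd s t h1 h2 h3 h4 h5 h6); exact: ler_norm.
Qed.

(** The fundamental theorem of calculus, with differentiability only inside. *)
Lemma prim_C1 a b (F f : R -> R) : cts a b F -> cts a b f ->
  (forall x, a < x < b -> is_derive x 1 F (f x)) -> prim a b F f.
Proof.
move=> cF cf dF; split; first exact: cts_intg.
move=> x y ax xy yb; move: xy; rewrite le_eqVlt => /predU1P[->|xy].
  by rewrite itgxx subrr.
have d z : x < z < y -> is_derive z 1 F (f z).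
  by move=> /andP[h1 h2]; apply: dF; rewrite (le_lt_trans ax h1) (lt_le_trans h2 yb).
have cF' : {within `[x, y], continuous F} by apply/ctsP; exact: cts_sub cF.
have cf' : {within `[x, y], continuous f} by apply/ctsP; exact: cts_sub cf.
have [h1 h2 h3] := (continuous_within_itvP F xy).1 cF'.
rewrite /itg /Rintegral (@continuous_FTC2 _ f F x y)//.
- by split=> // z; rewrite in_itv /= => /d h; apply: ex_derive.
- by move=> z; rewrite in_itv /= => /d h; rewrite derive1E; apply: derive_val.
Qed.

Lemma itg_deriv a b f : cts a b f -> forall x, a < x < b ->
  is_derive x 1 (fun x => itg a x f) (f x).
Proof.
move=> cf x /andP[ax xb]; rewrite /itg.
have := @continuous_FTC1_closed _ f a x b xb (cts_intg cf) ax.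
have cx : {for x, continuous f}.
  move/ctsP: cf => cf; apply: (within_continuous_continuous (lt_trans ax xb) cf).
  by rewrite in_itv /= ax xb.
move=> /(_ cx) [h1 h2]; split; first exact: h1.
by rewrite -derive1E h2.
Qed.
Lemma prim_itg a b f : intg a b f -> prim a b (fun x => itg a x f) f.
Proof. by move=> hf; apply: prim_intro => // x _; rewrite itgxx add0r. Qed.
End Tools.

(** * The calibration on an interval *)

Section Arc.
Variable R : realType.
Local Notation mu := (@lebesgue_measure R).
Implicit Types (f g h u : R -> R) (a b c d : R).

(** The rate at which the calibration angle grows with the mass. *)
Definition arc_rate : R := 2 / Num.sqrt 3.

(** Chosen so that [arc_weight_rate] and [arc_weight_sq] hold, which complete the
    square in [arc_eq]. *)
Definition arc_weight : R := (4 * Num.sqrt 3)^-1.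
Local Notation b0 := arc_rate.
Local Notation a0 := arc_weight.

Lemma sqrt3_gt0 : 0 < Num.sqrt 3 :> R. Proof. by rewrite sqrtr_gt0. Qed.
Lemma sqrt3_sqr : Num.sqrt 3 ^+ 2 = 3 :> R. Proof. by rewrite sqr_sqrtr. Qed.
Lemma arc_rate_gt0 : 0 < b0. Proof. by rewrite divr_gt0// sqrt3_gt0. Qed.
Lemma arc_weight_gt0 : 0 < a0. Proof. by rewrite invr_gt0 mulr_gt0// sqrt3_gt0. Qed.
Lemma arc_weight_rate : a0 * b0 = 6^-1.
Proof.
have h := sqrt3_sqr; have h0 := lt0r_neq0 sqrt3_gt0.
rewrite /arc_weight /arc_rate; have -> : (4 * Num.sqrt 3)^-1 * (2 / Num.sqrt 3) = (2 * (Num.sqrt 3)^+2)^-1 :> R by field.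
by rewrite h; congr (_^-1); ring.
Qed.
Lemma arc_weight_sq : 8 * a0 ^+ 2 = 6^-1.
Proof.
have h := sqrt3_sqr; have h0 := lt0r_neq0 sqrt3_gt0.
rewrite /arc_weight; have -> : 8 * (4 * Num.sqrt 3)^-1 ^+ 2 = (2 * (Num.sqrt 3)^+2)^-1 :> R by field.
by rewrite h; congr (_^-1); ring.
Qed.

(** Two angles below pi/2 thus cover exactly the masses below the critical one. *)
Lemma arc_rate_line : b0 * critical_mass_line R = pi.
Proof.
have h0 := lt0r_neq0 sqrt3_gt0.
by rewrite /arc_rate /critical_mass_line; field.
Qed.

Lemma critical_mass_line_sq : critical_mass_line R ^+ 2 = 3 / 4 * pi ^+ 2.
Proof. by rewrite /critical_mass_line exprMn exprMn sqr_sqrtr//; field. Qed.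

Lemma cos_neq0 (x : R) : - (pi / 2) < x -> x < pi / 2 -> cos x != 0.
Proof.
by move=> h1 h2; rewrite lt0r_neq0// cos_gt0_pihalf// h1 h2.
Qed.
Lemma cosV2 (x : R) : cos x != 0 -> (cos x) ^- 2 = 1 + tan x ^+ 2.
Proof.
move=> c0; rewrite /tan; have := cos2Dsin2 x => h.
have : (1 + (sin x / cos x) ^+ 2) = (cos x ^+ 2 + sin x ^+ 2) / cos x ^+ 2 by field.
by rewrite h => ->; rewrite mul1r.
Qed.
Lemma tan_le (x y : R) : - (pi / 2) < x -> x <= y -> y < pi / 2 -> tan x <= tan y.
Proof.
move=> h1; rewrite le_eqVlt => /predU1P[->//|xy] h2; apply/ltW.
have cxy : cos x != 0 by apply: cos_neq0 => //; exact: lt_trans xy h2.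
have d z : z \in `]x, y[%R -> is_derive z 1 tan ((cos z)^-2).
  rewrite in_itv /= => /andP[xz zy]; apply: is_derive_tan; apply: cos_neq0; lra.
have [|c cxy' e] := @MVT _ (@tan R) (fun z => (cos z)^-2) x y xy d.
  apply: continuous_in_subspaceT => z; rewrite inE /= in_itv /= => /andP[xz zy].
  apply: continuous_tan; apply: cos_neq0; lra.
rewrite -subr_gt0 e mulr_gt0 ?subr_gt0// invr_gt0 exprn_even_gt0//=.
by apply: cos_neq0; move: cxy'; rewrite in_itv /= => /andP[]; lra.
Qed.

Lemma is_derive_fcomp (F f : R -> R) (x dF df : R) :
  is_derive (f x) 1 F dF -> is_derive x 1 f df -> is_derive x 1 (fun x => F (f x)) (df * dF).
Proof. by move=> h1 h2; have := @is_derive1_comp _ F f x _ _ h1 h2; rewrite mulrC. Qed.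
Lemma is_derive_fadd (F f : R -> R) (x dF df : R) :
  is_derive x 1 F dF -> is_derive x 1 f df -> is_derive x 1 (fun x => F x + f x) (dF + df).
Proof. by move=> h1 h2; exact: is_deriveD. Qed.
Lemma is_derive_fscale (f : R -> R) (k x df : R) :
  is_derive x 1 f df -> is_derive x 1 (fun x => k * f x) (k * df).
Proof. by move=> h1; exact: is_deriveZ. Qed.
Lemma is_derive_fcst (k x : R) : is_derive x 1 (fun _ : R => k) 0.
Proof. exact: is_derive_cst. Qed.
Lemma is_derive_fmul (F f : R -> R) (x dF df : R) :
  is_derive x 1 F dF -> is_derive x 1 f df -> is_derive x 1 (fun x => F x * f x) (dF * f x + F x * df).
Proof.
move=> h1 h2; have := is_deriveM h1 h2; rewrite /GRing.scale /= => h.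
by apply: (is_derive_eq h); ring.
Qed.

(** The calibration.  For k = - c tan (r w - p), where w is the mass to the left,
    u'^2/2 - u^6/6 - (u^4 k)' is half the square of u' + 4 c u^3 tan (r w - p). *)
Lemma arc_eq a b u g (pa : R) : a <= b -> prim a b u g -> intg a b (fun x => g x ^+ 2) ->
  let pb := b0 * itg a b (fun x => u x ^+ 2) - pa in
  - (pi / 2) < pa < pi / 2 -> - (pi / 2) < pb < pi / 2 ->
  itg a b (fun x => u x ^+ 6) / 6 <=
  itg a b (fun x => g x ^+ 2) / 2 + a0 * (tan pa * u a ^+ 4 + tan pb * u b ^+ 4).
Proof.
move=> ab pu ig2 pb /andP[pa1 pa2] /andP[pb1 pb2].
have cu := prim_cts pu.
have cu2 : cts a b (fun x => u x ^+ 2) by exact: ctsX.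
have iu2 := cts_intg cu2.
pose w x := itg a x (fun x => u x ^+ 2).
pose th x := b0 * w x - pa.
pose k x := - a0 * tan (th x).
pose k' x := - (6^-1) * ((1 + tan (th x) ^+ 2) * u x ^+ 2).
have pw : prim a b w (fun x => u x ^+ 2) by exact: prim_itg.
have cw := prim_cts pw.
have thr x : a <= x <= b -> - (pi / 2) < th x < pi / 2.
  move=> /andP[ax xb]; have w0 : 0 <= w x by apply: itg_ge0 => z _; rewrite sqr_ge0.
  have w1 : w x <= itg a b (fun x => u x ^+ 2).
    by apply: itg_sub_le => // z _; rewrite sqr_ge0.
  have h1 : 0 <= b0 * w x by rewrite mulr_ge0// ltW// arc_rate_gt0.
  have h2 : b0 * w x <= b0 * itg a b (fun x => u x ^+ 2) by rewrite ler_wpM2l// ltW// arc_rate_gt0.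
  apply/andP; rewrite /th; move: pb2; rewrite /pb; split; lra.
have cosn x : a <= x <= b -> cos (th x) != 0.
  by move=> /thr /andP[]; exact: cos_neq0.
have cth : cts a b th.
  by apply: ctsD; [apply: ctsM => //; exact: cts_cst|exact: cts_cst].
have ctan : cts a b (fun x => tan (th x)).
  by apply: cts_comp => // x xab; apply: continuous_tan; exact: cosn.
have ck : cts a b k by apply: ctsM => //; exact: cts_cst.
have ck' : cts a b k'.
  apply: ctsM; first exact: cts_cst.
  by apply: ctsM => //; apply: ctsD; [exact: cts_cst|exact: ctsX].
have pk : prim a b k k'.
  apply: (@prim_C1 _ a b k k' ck ck') => x xab.
  have xab' : a <= x <= b by move/andP : xab => [h1 h2]; rewrite !ltW.
  have dw : is_derive x 1 w (u x ^+ 2) by exact: (itg_deriv cu2).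
  have dth : is_derive x 1 th (b0 * u x ^+ 2).
    have := is_derive_fadd (is_derive_fscale b0 dw) (is_derive_fcst (- pa) x).
    by rewrite addr0.
  have dtan : is_derive x 1 (fun x => tan (th x)) ((b0 * u x ^+ 2) * (cos (th x)) ^- 2).
    by apply: is_derive_fcomp => //; apply: is_derive_tan; exact: cosn.
  have := is_derive_fscale (- a0) dtan.
  rewrite cosV2; last exact: cosn.
  suff -> : (- a0) * (b0 * u x ^+ 2 * (1 + tan (th x) ^+ 2)) = k' x by [].
  by rewrite /k' -arc_weight_rate; ring.
have p4 := primM (primM (primM pu pu) (primM pu pu)) pk.
have [i4 /(_ a b (lexx _) ab (lexx _)) e4] := p4.
have kb : k b = - a0 * tan pb by [].
have ka : k a = a0 * tan pa.
  by rewrite /k /th /w itgxx mulr0 sub0r tanN; ring.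
have i6 : intg a b (fun x => u x ^+ 6) by apply: cts_intg; exact: ctsX.
have : itg a b (fun x => (((g x * u x + u x * g x) * (u x * u x) +
    u x * u x * (g x * u x + u x * g x)) * k x + u x * u x * (u x * u x) * k' x)) <=
  itg a b (fun x => 2^-1 * g x ^+ 2 - 6^-1 * u x ^+ 6).
  apply: itg_le => //; first by apply: intgB; apply: intgZ.
  move=> x xab; rewrite /k' /k -subr_ge0.
  have -> : 2^-1 * g x ^+ 2 - 6^-1 * u x ^+ 6 -
   (((g x * u x + u x * g x) * (u x * u x) + u x * u x * (g x * u x + u x * g x)) *
    (- a0 * tan (th x)) + u x * u x * (u x * u x) * (- 6^-1 * ((1 + tan (th x) ^+ 2) * u x ^+ 2))) =
    2^-1 * (g x + 4 * u x ^+ 3 * (a0 * tan (th x))) ^+ 2 +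
    (6^-1 - 8 * a0 ^+ 2) * (u x ^+ 6 * tan (th x) ^+ 2) by field.
  by rewrite arc_weight_sq subrr mul0r addr0 mulr_ge0// sqr_ge0.
rewrite -e4 itgB; try exact: intgZ.
rewrite !itgZ// ka kb => h.
have -> : a0 * (tan pa * u a ^+ 4 + tan pb * u b ^+ 4) =
  u a * u a * (u a * u a) * (a0 * tan pa) - u b * u b * (u b * u b) * (- a0 * tan pb) by ring.
lra.
Qed.

(** The form used below: a surplus of angle only increases the boundary term at b,
    because the tangent increases. *)
Lemma arc_ineq a b u g (pa pb : R) : a <= b -> prim a b u g -> intg a b (fun x => g x ^+ 2) ->
  - (pi / 2) < pa < pi / 2 -> pb < pi / 2 -> b0 * itg a b (fun x => u x ^+ 2) <= pa + pb ->
  itg a b (fun x => u x ^+ 6) / 6 <=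
  itg a b (fun x => g x ^+ 2) / 2 + a0 * (tan pa * u a ^+ 4 + tan pb * u b ^+ 4).
Proof.
move=> ab pu ig hpa hpb hm.
pose pb' := b0 * itg a b (fun x => u x ^+ 2) - pa.
have m0 : 0 <= b0 * itg a b (fun x => u x ^+ 2).
  by rewrite mulr_ge0 ?(ltW arc_rate_gt0)// itg_ge0// => x _; exact: sqr_ge0.
have l1 : - (pi / 2) < pb' by move/andP : hpa; rewrite /pb' => -[_ h]; lra.
have l2 : pb' <= pb by rewrite /pb'; lra.
apply: le_trans (arc_eq ab pu ig hpa _) _; first by apply/andP; split => //; exact: le_lt_trans l2 hpb.
rewrite lerD2l ler_wpM2l ?(ltW arc_weight_gt0)// lerD2l -/pb' ler_wpM2r ?exprn_even_ge0//.
exact: tan_le.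
Qed.

Lemma mean_point a b u : a < b -> cts a b u ->
  exists2 x, a <= x <= b & u x ^+ 2 * (b - a) <= itg a b (fun x => u x ^+ 2).
Proof.
move=> ab cu; have cu2 : cts a b (fun x => u x ^+ 2) by exact: ctsX.
have [c cab hc] := EVT_min (ltW ab) ((ctsP _ _ _).2 cu2).
exists c; first by move: cab; rewrite in_itv.
rewrite -(@itg_cst _ a b)//; last exact: ltW.
apply: itg_le; [exact: intg_cst|exact: cts_intg|].
by move=> x xab; apply: hc; rewrite in_itv.
Qed.

(** The mean value theorem for sqrt G, squared so that no square root remains on
    the side of the intermediate point. *)
Lemma sqrt_mean_value p q (G dG : R -> R) : p < q -> cts p q G ->
  (forall y, p < y < q -> 0 < G y) -> (forall y, p < y < q -> is_derive y 1 G (dG y)) ->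
  exists2 y, p < y < q &
    dG y ^+ 2 * (q - p) ^+ 2 = 4 * G y * (Num.sqrt (G q) - Num.sqrt (G p)) ^+ 2.
Proof.
move=> pq cG G0 dGy.
have cs : cts p q (fun y => Num.sqrt (G y)) by apply: cts_compl => //; exact: sqrt_continuous.
have ds y : y \in `]p, q[%R -> is_derive y 1 (fun y => Num.sqrt (G y))
   (dG y * (2 * Num.sqrt (G y))^-1).
  rewrite in_itv /= => ypq; apply: is_derive_fcomp; last exact: dGy.
  by apply: is_derive1_sqrt; exact: G0.
have [xi xipq e] := MVT pq ds ((ctsP _ _ _).2 cs).
move: xipq; rewrite in_itv /= => xipq; exists xi => //.
have s1 : 0 < Num.sqrt (G xi) by rewrite sqrtr_gt0; exact: G0.
have s2 := sqr_sqrtr (ltW (G0 _ xipq)).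
by rewrite e -{1}s2; field; rewrite gt_eqF.
Qed.

Lemma mass_pos a b u c : a < b -> cts a b u -> (forall x, a <= x <= b -> 0 < u x ^+ 2) ->
  c = itg a b (fun x => u x ^+ 2) -> 0 < c.
Proof.
move=> ab cu up ->; have cu2 : cts a b (fun x => u x ^+ 2) by exact: ctsX.
have [y yab hy] := EVT_min (ltW ab) ((ctsP _ _ _).2 cu2).
rewrite in_itv /= in yab.
apply: (@lt_le_trans _ _ (u y ^+ 2 * (b - a))); first by rewrite mulr_gt0 ?up// subr_gt0.
rewrite -itg_cst; last exact: ltW.
apply: itg_le; [exact: intg_cst|exact: cts_intg|].
by move=> x xab; apply: hy; rewrite in_itv.
Qed.

(** Let G(y) be the mass on [y, q].  If the inequality failed everywhere, then
    sqrt G would decrease too fast to be still nonnegative at q.  The bound is by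
    the product of the whole mass and of the mass beyond y, which is what makes it
    useful when nearly all the mass lies on one side of y. *)
Lemma tail_point_r p q u : p < q -> cts p q u ->
  exists2 y, p <= y <= q & u y ^+ 4 * (q - p) ^+ 2 <=
    4 * itg p q (fun x => u x ^+ 2) * itg y q (fun x => u x ^+ 2).
Proof.
move=> pq cu; apply: contrapT => hn.
have m0 y z : 0 <= itg y z (fun x => u x ^+ 2) by apply: itg_ge0 => x _; exact: sqr_ge0.
have H y : p <= y <= q -> 4 * itg p q (fun x => u x ^+ 2) * itg y q (fun x => u x ^+ 2) <
    u y ^+ 4 * (q - p) ^+ 2.
  by move=> ypq; rewrite ltNge; apply/negP => h; apply: hn; exists y.
have cu2 : cts p q (fun x => u x ^+ 2) by exact: ctsX.
have iu2 := cts_intg cu2.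
have up y : p <= y <= q -> 0 < u y ^+ 2.
  move=> ypq; rewrite lt_neqAle sqr_ge0 andbT eq_sym; apply/negP => /eqP h.
  have := H y ypq; rewrite (_ : u y ^+ 4 = (u y ^+ 2) ^+ 2); last by ring.
  by rewrite h expr0n /= mul0r ltNge !mulr_ge0.
pose G y := itg y q (fun x => u x ^+ 2).
have GE y : p <= y <= q -> G y = itg p q (fun x => u x ^+ 2) - itg p y (fun x => u x ^+ 2).
  by move=> /andP[py yq]; rewrite /G (@itg_cat _ p q y)//; ring.
have cG : cts p q G.
  have h := ctsD (@cts_cst _ p q (itg p q (fun x => u x ^+ 2)))
    (ctsN (prim_cts (prim_itg iu2))).
  by apply: cts_eq h => y ypq; rewrite GE.
have dG y : p < y < q -> is_derive y 1 G (- (u y ^+ 2)).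
  move=> ypq; have h := itg_deriv cu2 ypq.
  have h2 := is_derive_fadd (is_derive_fcst (itg p q (fun x => u x ^+ 2)) y) (is_derive_fscale (-1) h).
  rewrite add0r mulN1r in h2; apply: near_eq_is_derive h2.
  have /andP[py yq] := ypq.
  near=> z; rewrite /= mulN1r GE//; apply/andP; split; apply/ltW; near: z.
    exact: lt_nbhsr.
  exact: lt_nbhsl.
have Gpos y : p < y < q -> 0 < G y.
  move=> /andP[py yq]; apply: (@mass_pos y q u) => //; first by apply: cts_sub cu => //; exact: ltW.
  by move=> x /andP[yx xq]; apply: up; rewrite xq (le_trans (ltW py)).
have [y /andP[py yq]] := sqrt_mean_value pq cG Gpos dG.
have -> : G q = 0 by rewrite /G itgxx.
rewrite sqrtr0 sub0r sqrrN sqrrN sqr_sqrtr; last exact: m0.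
have := H y; rewrite !ltW// => /(_ isT); rewrite -/(G y) -/(G p) => h e.
by move: h; rewrite (_ : u y ^+ 4 = (u y ^+ 2) ^+ 2) 1?e; last ring; rewrite mulrAC ltxx.
Unshelve. all: by end_near. Qed.

Lemma tail_point_l p q u : p < q -> cts p q u ->
  exists2 y, p <= y <= q & u y ^+ 4 * (q - p) ^+ 2 <=
    4 * itg p q (fun x => u x ^+ 2) * itg p y (fun x => u x ^+ 2).
Proof.
move=> pq cu; apply: contrapT => hn.
have m0 y z : 0 <= itg y z (fun x => u x ^+ 2) by apply: itg_ge0 => x _; exact: sqr_ge0.
have H y : p <= y <= q -> 4 * itg p q (fun x => u x ^+ 2) * itg p y (fun x => u x ^+ 2) <
    u y ^+ 4 * (q - p) ^+ 2.
  by move=> ypq; rewrite ltNge; apply/negP => h; apply: hn; exists y.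
have cu2 : cts p q (fun x => u x ^+ 2) by exact: ctsX.
have iu2 := cts_intg cu2.
have up y : p <= y <= q -> 0 < u y ^+ 2.
  move=> ypq; rewrite lt_neqAle sqr_ge0 andbT eq_sym; apply/negP => /eqP h.
  have := H y ypq; rewrite (_ : u y ^+ 4 = (u y ^+ 2) ^+ 2); last by ring.
  by rewrite h expr0n /= mul0r ltNge !mulr_ge0.
pose G y := itg p y (fun x => u x ^+ 2).
have cG : cts p q G := prim_cts (prim_itg iu2).
have dG y : p < y < q -> is_derive y 1 G (u y ^+ 2) := itg_deriv cu2 (x:=y).
have Gpos y : p < y < q -> 0 < G y.
  move=> /andP[py yq]; apply: (@mass_pos p y u) => //; first by apply: cts_sub cu => //; exact: ltW.
  by move=> x /andP[px xy]; apply: up; rewrite px (le_trans xy (ltW yq)).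
have [y /andP[py yq]] := sqrt_mean_value pq cG Gpos dG.
have -> : G p = 0 by rewrite /G itgxx.
rewrite sqrtr0 subr0 sqr_sqrtr; last exact: m0.
have := H y; rewrite !ltW// => /(_ isT); rewrite -/(G y) -/(G q) => h e.
by move: h; rewrite (_ : u y ^+ 4 = (u y ^+ 2) ^+ 2) 1?e; last ring; rewrite mulrAC ltxx.
Qed.

(** Cauchy-Schwarz, read off from the variance of the density. *)
Lemma cauchy_increment a b u g : a <= b -> prim a b u g -> intg a b (fun x => g x ^+ 2) ->
  (u b - u a) ^+ 2 <= (b - a) * itg a b (fun x => g x ^+ 2).
Proof.
rewrite le_eqVlt => /predU1P[->|ab] [ig hu] ig2; first by rewrite !subrr mul0r expr0n.
rewrite (hu a b (lexx _) (ltW ab) (lexx _)).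
set D := itg a b g; have ba : 0 < b - a by rewrite subr_gt0.
pose t := D / (b - a).
have : 0 <= itg a b (fun x => (g x - t) ^+ 2) by apply: itg_ge0 => x _; exact: sqr_ge0.
have -> : itg a b (fun x => (g x - t) ^+ 2) =
   itg a b (fun x => (g x ^+ 2 - (2 * t) * g x) + t ^+ 2).
  by apply: itg_eq => x _; ring.
have i2 : intg a b (fun x => (2 * t) * g x) by exact: intgZ.
have i1 := intgB ig2 i2.
rewrite (itgD i1 (intg_cst _ _ _)) (itgB ig2 i2) itgZ// itg_cst ?(ltW ab)// -/D.
have -> : itg a b (fun x => g x ^+ 2) - 2 * t * D + t ^+ 2 * (b - a) =
  itg a b (fun x => g x ^+ 2) - D ^+ 2 / (b - a) by rewrite /t; field; rewrite gt_eqF.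
by rewrite subr_ge0 ler_pdivrMr// mulrC.
Qed.
End Arc.

(** * Weak derivatives and absolutely continuous functions *)

Section Sob.
Variable R : realType.
Local Notation mu := (@lebesgue_measure R).
Implicit Types (f g h u : R -> R) (a b c d l x y : R).

Lemma Lp2_intgP l g : Lp_itv 2 l g <-> measurable_fun `[0, l] g /\ intg 0 l (fun x => g x ^+ 2).
Proof.
split=> -[mg h]; split=> //.
- apply/integrableP; split.
    by apply/measurable_EFinP; apply: measurable_funX.
  apply: le_lt_trans h; apply: ge0_le_integral => //=.
  + by do 2 apply: measurableT_comp => //; apply: measurable_funX.
  + by apply/measurable_EFinP; apply: measurable_funX; apply: measurableT_comp.
  + by move=> x _; rewrite lee_fin normrX.
- move/integrableP : h => [_]; apply: le_lt_trans; apply: ge0_le_integral => //=.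
  + by apply/measurable_EFinP; apply: measurable_funX; apply: measurableT_comp.
  + by do 2 apply: measurableT_comp => //; apply: measurable_funX.
  + by move=> x _; rewrite lee_fin normrX.
Qed.

Lemma intg_sq a b g : measurable_fun `[a, b] g -> intg a b (fun x => g x ^+ 2) -> intg a b g.
Proof.
move=> mg ig; apply: (@intg_le _ _ _ _ (fun x => 1 + g x ^+ 2)) => //.
  by apply: intgD => //; exact: intg_cst.
move=> x _; have := sqr_ge0 (`|g x| - 1); rewrite -(real_normK (num_real (g x))) => h.
have := normr_ge0 (g x); nra.
Qed.
Lemma intg_mul2 a b f g : measurable_fun `[a, b] f -> measurable_fun `[a, b] g ->
  intg a b (fun x => f x ^+ 2) -> intg a b (fun x => g x ^+ 2) -> intg a b (fun x => f x * g x).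
Proof.
move=> mf mg hf hg; apply: (@intg_le _ _ _ _ (fun x => f x ^+ 2 + g x ^+ 2)).
- exact: measurable_funM.
- exact: intgD.
- move=> x _; rewrite normrM -(real_normK (num_real (f x))) -(real_normK (num_real (g x))).
  have := sqr_ge0 (`|f x| - `|g x|); have := normr_ge0 (g x); have := normr_ge0 (f x).
  nra.
Qed.

(** H^1 functions on [0, l], represented together with a density. *)
Definition abscont l u g := prim 0 l u g /\ intg 0 l (fun x => g x ^+ 2).

Lemma abscont_mfun l u g : abscont l u g -> measurable_fun `[0, l] g.
Proof. by move=> [[/intg_mfun]]. Qed.

(** Product rule for the density and a test function vanishing at both ends. *)
Lemma abscont_weak l u g : abscont l u g -> is_weak_derivative l u g.
Proof.
move=> [pu _] phi [dphi cphi [a [b [a_gt0 bl supp]]]].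
have pphi : prim 0 l phi (derive1 phi).
  apply: prim_C1.
  - apply/ctsP; apply: continuous_subspaceT => x.
    by apply: differentiable_continuous; apply/derivable1_diffP.
  - by apply/ctsP; apply: continuous_subspaceT.
  - by move=> x _; rewrite derive1E; apply: derivableP.
have [l0|l0] := leP 0 l; last first.
  by rewrite set_itv_ge ?bnd_simp -?ltNge// !Rintegral_set0 oppr0.
have [ip /(_ 0 l (lexx _) l0 (lexx _))] := primM pu pphi.
have -> : phi 0 = 0 by apply: supp => /andP[h1 h2]; move: (lt_le_trans a_gt0 h1); rewrite ltxx.
have -> : phi l = 0 by apply: supp => /andP[h1 h2]; move: (le_lt_trans h2 bl); rewrite ltxx.
have i1 : intg 0 l (fun x => g x * phi x).
  have := intg_mul_cts (prim_cts pphi) pu.1; apply: intg_eq => x _; by rewrite mulrC.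
have i2 := intg_mul_cts (prim_cts pu) pphi.1.
rewrite (itgD i1 i2) !mulr0 subrr => /eqP; rewrite eq_sym addrC addr_eq0 => /eqP h.
by rewrite /itg in h; rewrite h.
Qed.

Definition sqs (t : R) := t * `|t|.
Lemma is_derive_sqs (t : R) : is_derive t 1 sqs (2 * `|t|).
Proof.
have [t0|t0|->] := ltgtP t 0.
- have h : is_derive t 1 (fun s : R => - (s * s)) (2 * `|t|).
    have := is_derive_fscale (-1) (is_derive_fmul (is_derive_id t 1) (is_derive_id t 1)).
    rewrite ltr0_norm// => h; have -> : 2 * - t = -1 * (1 * t + t * 1) by ring.
    by move: h; under eq_fun do rewrite mulN1r.
  apply: near_eq_is_derive h; near=> s; rewrite /sqs ltr0_norm ?mulrN//.
  by near: s; exact: lt_nbhsl.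
- have h : is_derive t 1 (fun s : R => (s * s)) (2 * `|t|).
    have := (is_derive_fmul (is_derive_id t 1) (is_derive_id t 1)).
    by rewrite gtr0_norm// => h; have -> : 2 * t = (1 * t + t * 1) by ring.
  apply: near_eq_is_derive h; near=> s; rewrite /sqs gtr0_norm//.
  by near: s; exact: lt_nbhsr.
- apply/is_derive1_caratheodory; exists (fun s => `|s|); split.
  + by move=> z; rewrite /sqs mul0r !subr0 mulrC.
  + exact: norm_continuous.
  + by rewrite normr0 mulr0.
Unshelve. all: by end_near. Qed.

(** The second difference of t |t| is constant outside [-e, e]: a step of class C^1,
    whose derivative is a bump that averages near 0. *)
Definition stp (e t : R) := sqs (t + e) - 2 * sqs t + sqs (t - e).
Definition stp' (e t : R) := 2 * (`|t + e| - 2 * `|t| + `|t - e|).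
Lemma is_derive_stp (e x t : R) : is_derive t 1 (fun t => stp e (t - x)) (stp' e (t - x)).
Proof.
have sh (c : R) : is_derive t 1 (fun t => sqs (t + c)) (2 * `|t + c|).
  have h := is_derive_fadd (is_derive_id t 1) (is_derive_fcst c t).
  by have := @is_derive_fcomp _ sqs (fun t => t + c) t _ _ (is_derive_sqs (t + c)) h; rewrite addr0 mul1r.
have h := is_derive_fadd (is_derive_fadd (sh (- x + e)) (is_derive_fscale (-2) (sh (- x)))) (sh (- x - e)).
have -> : stp' e (t - x) = 2 * `|t + (- x + e)| + -2 * (2 * `|t + - x|) + 2 * `|t + (- x - e)|.
  by rewrite /stp' !addrA; ring.
move: h; congr is_derive; apply/funext => s; rewrite /stp !addrA; ring.
Qed.
Lemma stp_right (e t : R) : 0 < e -> e <= t -> stp e t = 2 * e ^+ 2.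
Proof. by move=> e0 et; rewrite /stp /sqs !ger0_norm; [ring|lra..]. Qed.
Lemma stp_left (e t : R) : 0 < e -> t <= - e -> stp e t = - (2 * e ^+ 2).
Proof. by move=> e0 et; rewrite /stp /sqs !ler0_norm; [ring|lra..]. Qed.
Lemma stp'_ge0 (e t : R) : 0 <= stp' e t.
Proof.
rewrite /stp' mulr_ge0// addrAC subr_ge0.
have -> : 2 * `|t| = `|(t + e) + (t - e)|.
  by rewrite -[2 * _](ger0_norm (mulr_ge0 _ _))// normrM normr_id -normrM; congr `|_|; ring.
exact: ler_normD.
Qed.
Lemma stp'_out (e t : R) : 0 < e -> e <= `|t| -> stp' e t = 0.
Proof.
move=> e0; rewrite /stp' ler_normr => /orP[h|h].
- by rewrite !ger0_norm; [ring|lra..].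
- by rewrite !ler0_norm; [ring|lra..].
Qed.
Lemma stp'_cont (e x : R) : continuous (fun t => stp' e (t - x)).
Proof.
have sh (c : R) : continuous (fun t : R => `|t + c|).
  move=> t; apply: (@continuous_comp _ _ _ (fun t : R => t + c) (fun s : R => `|s|)); last exact: norm_continuous.
  by apply: cvgD; [exact: cvg_id|exact: cvg_cst].
move=> t; apply: cvgM; first exact: cvg_cst.
apply: cvgD; last first.
  have := sh (- x - e) t; by under eq_fun do rewrite addrA.
apply: cvgB.
  have := sh (- x + e) t; by under eq_fun do rewrite addrA.
by apply: cvgM; [exact: cvg_cst|exact: sh].
Qed.

Lemma stp_average l (v : R -> R) (e x eta : R) : cts 0 l v -> 0 < e -> e <= x -> x <= l - e ->
  (forall t, 0 <= t <= l -> `|t - x| <= e -> `|v t - v x| <= eta) ->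
  `|itg 0 l (fun t => v t * stp' e (t - x)) - 4 * e ^+ 2 * v x| <= eta * (4 * e ^+ 2).
Proof.
move=> cv e0 ex xl hv.
have l0 : 0 <= l by lra.
have cs : cts 0 l (fun t => stp' e (t - x)).
  by apply/ctsP; apply: continuous_subspaceT; exact: stp'_cont.
have I : itg 0 l (fun t => stp' e (t - x)) = 4 * e ^+ 2.
  have p : prim 0 l (fun t => stp e (t - x)) (fun t => stp' e (t - x)).
    apply: prim_C1; [|exact: cs|by move=> t _; exact: (is_derive_stp e x t)].
    apply/ctsP; apply: continuous_subspaceT => t.
    apply: differentiable_continuous; apply/derivable1_diffP.
    by have [] := is_derive_stp e x t.
  rewrite -p.2// stp_right//; last by lra.
  by rewrite stp_left//; [ring|lra].
have i1 : intg 0 l (fun t => v t * stp' e (t - x)) by apply: cts_intg; exact: ctsM.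
have i2 : intg 0 l (fun t => v x * stp' e (t - x)) by apply: intgZ; exact: cts_intg.
have -> : itg 0 l (fun t => v t * stp' e (t - x)) - 4 * e ^+ 2 * v x =
   itg 0 l (fun t => v t * stp' e (t - x) - v x * stp' e (t - x)).
  rewrite (itgB i1 i2) itgZ ?I; last exact: cts_intg.
  by ring.
apply: le_trans (itg_abs (intgB i1 i2)) _.
rewrite -I -itgZ; last exact: cts_intg.
apply: itg_le; [by apply: intg_abs; exact: intgB|by apply: intgZ; exact: cts_intg|].
move=> t tl; rewrite -mulrBl normrM (ger0_norm (stp'_ge0 _ _)).
have [h|h] := leP `|t - x| e; first by rewrite ler_wpM2r ?stp'_ge0// hv.
by rewrite stp'_out ?mulr0// ltW.
Qed.

(** Testing against the difference of two steps compares averages of v near two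
    points; letting the windows shrink gives equality of the values. *)
Lemma du_bois_reymond l v : cts 0 l v ->
  (forall phi, test_function l phi -> itg 0 l (fun x => v x * derive1 phi x) = 0) ->
  forall x y, 0 < x -> x <= y -> y < l -> v x = v y.
Proof.
move=> cv H x y x0 xy yl; apply/eqP; rewrite -subr_eq0 -normr_le0.
apply/ler_addgt0Pr => eta eta0; rewrite add0r.
have l0 : 0 < l by lra.
have xl : 0 <= x <= l by lra.
have yl' : 0 <= y <= l by lra.
have eta20 : 0 < eta / 2 by rewrite divr_gt0.
have [d1 d10 h1] := cv _ xl _ eta20.
have [d2 d20 h2] := cv _ yl' _ eta20.
pose e := Num.min (Num.min (d1 / 2) (d2 / 2)) (Num.min (x / 2) ((l - y) / 2)).
have e0 : 0 < e by rewrite /e !lt_min !divr_gt0//; lra.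
have ed1 : e <= d1 / 2 by rewrite /e !ge_min lexx.
have ed2 : e <= d2 / 2 by rewrite /e !ge_min lexx !orbT.
have ex : e <= x / 2 by rewrite /e !ge_min lexx !orbT.
have ey : e <= (l - y) / 2 by rewrite /e !ge_min lexx !orbT.
pose phi t := stp e (t - x) - stp e (t - y).
have dphi (t : R) : is_derive t 1 phi (stp' e (t - x) - stp' e (t - y)).
  have h := is_derive_fadd (is_derive_stp e x t) (is_derive_fscale (-1) (is_derive_stp e y t)).
  have -> : stp' e (t - x) - stp' e (t - y) = stp' e (t - x) + (-1) * stp' e (t - y) by ring.
  by move: h; congr is_derive; apply/funext => s; rewrite /phi; ring.
have Dphi : derive1 phi = fun t => stp' e (t - x) - stp' e (t - y).
  by apply/funext => t; rewrite derive1E; apply: derive_val.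
have tphi : test_function l phi.
  split; first by move=> t; apply: ex_derive.
  - by rewrite Dphi => t; apply: cvgB; exact: stp'_cont.
  - exists (x - e), (y + e); split; [lra|lra|].
    move=> t /negP; rewrite negb_and -!ltNge => /orP[h|h]; rewrite /phi.
    + by rewrite !stp_left ?subrr//; lra.
    + by rewrite !stp_right ?subrr//; lra.
have := H _ tphi; rewrite Dphi.
have cs (z : R) : intg 0 l (fun t => v t * stp' e (t - z)).
  by apply: cts_intg; apply: ctsM => //; apply/ctsP; apply: continuous_subspaceT; exact: stp'_cont.
have -> : itg 0 l (fun t => v t * (stp' e (t - x) - stp' e (t - y))) =
   itg 0 l (fun t => v t * stp' e (t - x)) - itg 0 l (fun t => v t * stp' e (t - y)).
  by rewrite -itgB//; apply: itg_eq => t _; rewrite mulrBr.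
move=> /eqP; rewrite subr_eq0 => /eqP E.
have e1 : e <= x by lra.
have e2 : x <= l - e by lra.
have e3 : e <= y by lra.
have e4 : y <= l - e by lra.
have A1 := @stp_average l v e x (eta / 2) cv e0 e1 e2.
have A2 := @stp_average l v e y (eta / 2) cv e0 e3 e4.
have {}A1 : `|itg 0 l (fun t => v t * stp' e (t - x)) - 4 * e ^+ 2 * v x| <= eta / 2 * (4 * e ^+ 2).
  by apply: A1 => t tl tx; rewrite distrC; apply/ltW/h1 => //; rewrite distrC; lra.
have {}A2 : `|itg 0 l (fun t => v t * stp' e (t - y)) - 4 * e ^+ 2 * v y| <= eta / 2 * (4 * e ^+ 2).
  by apply: A2 => t tl tx; rewrite distrC; apply/ltW/h2 => //; rewrite distrC; lra.
have ee : 0 < 4 * e ^+ 2 by rewrite mulr_gt0// exprn_gt0.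
rewrite -(ler_pM2l ee) -[in X in X * `|_|](gtr0_norm ee) -normrM.
have -> : 4 * e ^+ 2 * (v x - v y) = (itg 0 l (fun t => v t * stp' e (t - y)) - 4 * e ^+ 2 * v y) -
   (itg 0 l (fun t => v t * stp' e (t - x)) - 4 * e ^+ 2 * v x) by rewrite E; ring.
apply: le_trans (ler_normB _ _) _; lra.
Qed.

Lemma cts_const_oo l v : 0 < l -> cts 0 l v ->
  (forall x y, 0 < x -> x <= y -> y < l -> v x = v y) ->
  forall x, 0 <= x <= l -> v x = v (l / 2).
Proof.
move=> l0 cv H x xl.
have H' z : 0 < z < l -> v z = v (l / 2).
  move=> /andP[z0 zl]; have [h|/ltW h] := leP z (l / 2); first by apply: H => //; lra.
  by apply/esym/H => //; lra.
apply/eqP; rewrite -subr_eq0 -normr_le0; apply/ler_addgt0Pr => e e0; rewrite add0r.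
have [d d0 hd] := cv _ xl _ e0.
pose s := Num.min (d / 2) (l / 4).
have s0 : 0 < s by rewrite lt_min !divr_gt0.
have sd : s <= d / 2 by rewrite ge_min lexx.
have sl : s <= l / 4 by rewrite ge_min lexx orbT.
have [h|h] := leP x (l / 2).
- rewrite -(H' (x + s)); last by lra.
  by apply/ltW/hd; [lra|rewrite opprD addNKr normrN gtr0_norm//; lra].
- rewrite -(H' (x - s)); last by lra.
  apply/ltW/hd; [lra|]. by rewrite opprB addrCA subrr addr0 gtr0_norm//; lra.
Qed.

(** u minus the primitive of its weak derivative has zero weak derivative, hence
    is constant. *)
Lemma weak_abscont l u g : 0 < l -> cts 0 l u -> Lp_itv 2 l g -> is_weak_derivative l u g -> abscont l u g.
Proof.
move=> l0 cu /Lp2_intgP[mg ig2] wd.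
have ig : intg 0 l g by exact: intg_sq.
split=> //; have pg := prim_itg ig.
have cv : cts 0 l (fun x => u x - itg 0 x g) by apply: ctsD => //; apply: ctsN; exact: prim_cts pg.
have H := du_bois_reymond cv.
have {}H : forall x y, 0 < x -> x <= y -> y < l -> u x - itg 0 x g = u y - itg 0 y g.
  apply: H => phi tphi.
  have wg := @abscont_weak l (fun x => itg 0 x g) g (conj pg ig2) phi tphi.
  have wu := wd phi tphi.
  have [_ cphi _] := tphi.
  have c' : cts 0 l (derive1 phi) by apply/ctsP; exact: continuous_subspaceT.
  rewrite (itg_eq (g := fun x => u x * derive1 phi x - itg 0 x g * derive1 phi x)); last first.
    by move=> x _; rewrite mulrBl.
  rewrite itgB; first by rewrite {1 2}/itg wu wg subrr.
    by apply: cts_intg; exact: ctsM.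
  by apply: cts_intg; apply: ctsM => //; exact: prim_cts pg.
have K := cts_const_oo l0 cv H.
apply: prim_intro => // x xl.
have := K x xl; have := K 0; rewrite lexx ltW// => /(_ isT); rewrite itgxx; lra.
Qed.

Lemma prim_ae0 l (d : R -> R) : intg 0 l d -> (forall x, 0 <= x <= l -> itg 0 x d = 0) ->
  {ae mu, forall x, `[0, l]%classic x -> d x = 0}.
Proof.
move=> id H; pose f := d \_ `[0, l].
have if_ : mu.-integrable setT (EFin \o f).
  have := (@integrable_mkcond _ _ _ mu _ (EFin \o d) (measurable_itv `[0, l])).1 id.
  by rewrite restrict_EFin.
have F0 x : \int[mu]_(t in `]-oo, x]) f t = 0.
  rewrite /f -Rintegral_mkcondr.
  have -> : (`]-oo, x] `&` `[0, l] = `[0, Num.min x l])%classic.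
    apply/seteqP; split=> z /=; rewrite !in_itv /= le_min.
      by move=> [-> /andP[-> ->]].
    by move=> /and3P[-> -> ->].
  have [h|h] := leP 0 (Num.min x l); last first.
    by rewrite set_itv_ge ?bnd_simp -?ltNge// Rintegral_set0.
  by apply: H; rewrite h ge_min lexx orbT.
have : {ae mu, forall x, derivable (fun x => \int[mu]_(t in `]-oo, x]) f t) x 1 /\
    derive1 (fun x => \int[mu]_(t in `]-oo, x]) f t) x = f x}.
  apply: FTC1Ny; first by move=> y; apply: integrableS if_.
  by apply: integrable_locally id.
apply: filterS; first exact: (ae_filter_ringOfSetsType mu).
move=> x [_]; have -> : (fun x => \int[mu]_(t in `]-oo, x]) f t) = cst 0.
  by apply/funext => z; rewrite F0.
rewrite derive1_cst /f => h xl; rewrite h patchE.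
by rewrite mem_set.
Qed.

(** Two densities of the same function have the same primitive, hence agree
    almost everywhere. *)
Lemma abscont_uniq l u g1 g2 : 0 <= l -> abscont l u g1 -> abscont l u g2 ->
  itg 0 l (fun x => g1 x ^+ 2) = itg 0 l (fun x => g2 x ^+ 2).
Proof.
move=> l0 [[i1 p1] s1] [[i2 p2] s2].
have id : intg 0 l (fun x => g1 x - g2 x) by exact: intgB.
have H x : 0 <= x <= l -> itg 0 x (fun x => g1 x - g2 x) = 0.
  move=> /andP[x0 xl]; rewrite itgB; [|exact: intgS i1|exact: intgS i2].
  by rewrite -p1// -p2// subrr.
have ae := prim_ae0 id H.
rewrite /itg /Rintegral; congr fine; apply: ae_eq_integral => //.
- by apply/measurable_EFinP; exact: intg_mfun.
- by apply/measurable_EFinP; exact: intg_mfun.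
- move: ae; apply: filterS; first exact: (ae_filter_ringOfSetsType mu).
  by move=> x h /h /eqP; rewrite subr_eq0 => /eqP ->.
Qed.
End Sob.

(** * Limits of square integrable densities *)

Section Riesz.
Variable R : realType.
Local Notation mu := (@lebesgue_measure R).
Implicit Types (f g h u : R -> R) (a b c d x y : R).

Lemma ae_imp (P Q : R -> Prop) : {ae mu, forall x, P x} -> (forall x, P x -> Q x) ->
  {ae mu, forall x, Q x}.
Proof.
move=> h PQ; move: h; apply: filterS; first exact: (ae_filter_ringOfSetsType mu).
exact: PQ.
Qed.

(** Fast convergence in the mean implies convergence almost everywhere, dominated
    by the integrable sum of all the increments. *)
Lemma intg_ae_cvg (l c : R) (f : nat -> R -> R) : 0 <= c ->
  (forall k, intg 0 l (f k)) ->
  (forall k, itg 0 l (fun x => `|f k.+1 x - f k x|) <= c / 2 ^+ k.+1) ->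
  exists g H : R -> \bar R, [/\ measurable_fun `[0, l] g, mu.-integrable `[0, l] H,
    {ae mu, forall x, `[0, l]%classic x -> ((f k x)%:E @[k --> \oo] --> g x)%E} &
    {ae mu, forall x, `[0, l]%classic x -> forall k, (`|(f k x)%:E| <= H x)%E}].
Proof.
move=> c0 If hf.
pose d k x := f k.+1 x - f k x.
have Id k : intg 0 l (d k) by exact: intgB.
pose h x := (\sum_(k <oo) (`|d k x|)%:E)%E.
have md k : measurable_fun `[0, l] (fun x => (`|d k x|)%:E).
  by apply/measurable_EFinP; apply: measurableT_comp => //; exact: intg_mfun.
have mh : measurable_fun `[0, l] h.
  have := @ge0_emeasurable_sum _ _ R `[0, l] (fun k x => (`|d k x|)%:E) xpredT.
  apply.
  - by move=> k x _ _; rewrite lee_fin.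
  - by move=> k _; exact: md.
have ih : mu.-integrable `[0, l] h.
  apply/integrableP; split => //.
  have -> : (\int[mu]_(x in `[0%R, l]) `|h x| = \int[mu]_(x in `[0%R, l]) h x)%E.
    apply: eq_integral => x _; rewrite gee0_abs//.
    by apply: nneseries_ge0 => k _ _; rewrite lee_fin.
  rewrite /h integral_nneseries//.
  apply: (@le_lt_trans _ _ c%:E); last by rewrite ltry.
  apply: le_trans (@epsilon_trick0 R c xpredT c0).
  apply: lee_nneseries.
    by move=> k _ _; apply: integral_ge0 => x _; rewrite lee_fin.
  move=> k _; rewrite itg_EFin; last exact: intg_abs.
  by rewrite lee_fin natrX; exact: hf.
pose g x := limn_esup (fun k => (f k x)%:E).
pose H x := ((`|f 0%N x|)%:E + h x)%E.
have if0 : mu.-integrable `[0, l] (fun x => (`|f 0%N x|)%:E).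
  by have := intg_abs (If 0%N).
have part x k : f k x = f 0%N x + \sum_(0 <= i < k) d i x.
  elim: k => [|k ih']; first by rewrite big_nil addr0.
  by rewrite big_nat_recr//= addrA -ih' /d addrC subrK.
exists g, H; split.
- apply: measurable_fun_limn_esup => k; apply/measurable_EFinP; exact: intg_mfun.
- exact: integrableD.
- apply: (ae_imp (@integrable_ae _ _ R mu _ (measurable_itv `[0, l]) _ ih)).
  move=> x hx xl; have {}hx := hx xl.
  have hs k : \sum_(0 <= i < k) `|d i x| <= fine (h x).
    rewrite -lee_fin fineK// -sumEFin.
    by apply: nneseries_lim_ge => i _; rewrite lee_fin.
  have cs : cvgn (series (fun k => d k x)).
    apply: normed_cvg; apply: nondecreasing_is_cvgn.
      by apply: nondecreasing_series => k _ _; exact: normr_ge0.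
    by exists (fine (h x)) => _ [k _ <-]; exact: hs.
  have cf : (f k x)%:E @[k --> \oo] --> (f 0%N x + limn (series (fun k => d k x)))%:E.
    apply/cvg_EFin; first by near=> k.
    have -> : fine \o (fun k => (f k x)%:E) = fun k => f 0%N x + series (fun k => d k x) k.
      by apply/funext => k /=; rewrite part.
    by apply: cvgD => //; exact: cvg_cst.
  rewrite /g; have [_ ->] := cvg_limn_einf_sup cf.
  exact: cf.
- apply: aeW => x xl k; rewrite /H /= part.
  apply: (@le_trans _ _ (`|f 0%N x| + \sum_(0 <= i < k) `|d i x|)%:E).
    by rewrite lee_fin; apply: le_trans (ler_normD _ _) _; rewrite lerD2l ler_norm_sum.
  rewrite EFinD leeD2l// -sumEFin.
  by apply: nneseries_lim_ge => i _; rewrite lee_fin.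
Unshelve. all: by end_near. Qed.

(** The limit density inherits the bound of the squares by Fatou's lemma, and the
    primitives converge by dominated convergence. *)
Lemma L2_limit (l c A : R) (f : nat -> R -> R) : 0 <= c ->
  (forall k, intg 0 l (f k)) -> (forall k, intg 0 l (fun x => f k x ^+ 2)) ->
  (forall k, itg 0 l (fun x => `|f k.+1 x - f k x|) <= c / 2 ^+ k.+1) ->
  itg 0 l (fun x => f k x ^+ 2) @[k --> \oo] --> A ->
  exists g : R -> R, [/\ intg 0 l g, intg 0 l (fun x => g x ^+ 2),
    (forall x, 0 <= x <= l -> itg 0 x (f k) @[k --> \oo] --> itg 0 x g) &
    itg 0 l (fun x => g x ^+ 2) <= A].
Proof.
move=> c0 If If2 hf hA.
have [g [H [mg iH ae1 ae2]]] := intg_ae_cvg c0 If hf.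
have ae2' : {ae mu, forall x k, `[0, l]%classic x -> (`|(f k x)%:E| <= H x)%E}.
  apply: (ae_imp ae2).
  by move=> x h k xl; exact: h.
have mf k : measurable_fun `[0, l] (EFin \o f k) by apply/measurable_EFinP; exact: intg_mfun.
have [ig _ _] := @dominated_convergence _ _ R mu _ (measurable_itv `[0, l]) (fun k => EFin \o f k) g H mf mg ae1 iH ae2'.
have aefin := @integrable_ae _ _ R mu _ (measurable_itv `[0, l]) _ ig.
pose g' x := fine (g x).
have mg' : measurable_fun `[0, l] g' by apply: measurableT_comp.
have gg' : ae_eq mu `[0, l]%classic g (EFin \o g').
  apply: (ae_imp aefin).
  by move=> x h xl; rewrite /= fineK//; exact: h.
have ig' : intg 0 l g'.
  apply/integrableP; split; first exact/measurable_EFinP.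
  move/integrableP : ig => [_]; rewrite (_ : (\int[mu]_(x in `[0%R, l]) `|g x|)%E =
     (\int[mu]_(x in `[0%R, l]) `|(EFin \o g') x|)%E)//.
  have gg2 : ae_eq mu `[0, l]%classic (fun x => `|g x|)%E (fun x => `|(EFin \o g') x|)%E.
    by apply: (ae_imp gg') => x h xl; rewrite h.
  apply: (@ae_eq_integral _ _ R mu `[0, l]%classic) gg2 => //; first exact: measurableT_comp.
  by do 2 apply: measurableT_comp => //.
have fat : (\int[mu]_(x in `[0%R, l]) (g' x ^+ 2)%:E <= A%:E)%E.
  have mf2 k : measurable_fun `[0, l] (fun x => (f k x ^+ 2)%:E).
    by apply/measurable_EFinP; apply: measurable_funX; exact: intg_mfun.
  have := @fatou _ _ R mu `[0, l] (measurable_itv _) (fun k x => (f k x ^+ 2)%:E) mf2.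
  have h0 : forall n x, `[0, l]%classic x -> (0%R <= (f n x ^+ 2)%:E)%E.
    by move=> n x _; rewrite lee_fin sqr_ge0.
  move=> /(_ h0).
  have -> : limn_einf (fun n => \int[mu]_(x in `[0%R, l]) (f n x ^+ 2)%:E)%E = A%:E.
    have hA' : (\int[mu]_(x in `[0%R, l]) (f n x ^+ 2)%:E)%E @[n --> \oo] --> A%:E.
      under eq_fun do rewrite itg_EFin//.
      by apply/cvg_EFin => //; near=> k.
    by have [-> _] := cvg_limn_einf_sup hA'.
  apply: le_trans; rewrite le_eqVlt; apply/orP; left; apply/eqP.
  apply: ae_eq_integral => //.
  - by apply/measurable_EFinP; apply: measurable_funX.
  - apply: (@emeasurable_fun_cvg _ _ R _ (fun k x => einfs (fun n => (f n x ^+ 2)%:E) k)).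
      by move=> k; exact: measurable_fun_einfs.
    by move=> x _; rewrite limn_einf_lim; exact: is_cvg_einfs.
  - apply: (ae_imp (@filterI _ _ (ae_filter_ringOfSetsType mu) _ _ ae1 gg')).
    move=> x [h1 h2] xl; have {}h1 := h1 xl; have {}h2 := h2 xl.
    rewrite h2 /= in h1.
    have h3 : (f k x ^+ 2)%:E @[k --> \oo] --> (g' x ^+ 2)%:E.
      apply/cvg_EFin; first by near=> k.
      have [_ h4] := (fine_cvgP _ _).1 h1.
      exact: (cvgM h4 h4).
    by have [-> _] := cvg_limn_einf_sup h3.
have ig2 : intg 0 l (fun x => g' x ^+ 2).
  apply/integrableP; split; first by apply/measurable_EFinP; apply: measurable_funX.
  apply: le_lt_trans (ltry A); apply: le_trans fat.
  rewrite le_eqVlt; apply/orP; left; apply/eqP; apply: eq_integral => x _.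
  by rewrite /= ger0_norm// sqr_ge0.
exists g'; split=> //; last by rewrite -lee_fin -itg_EFin.
move=> x /andP[x0 xl].
have sub : `[0, x]%classic `<=` `[0, l]%classic by apply: subset_itvl; rewrite bnd_simp.
have mf' k : measurable_fun `[0, x] (EFin \o f k) by apply: measurable_funS (mf k).
have mg'' : measurable_fun `[0, x] g by apply: measurable_funS mg.
have iH' : mu.-integrable `[0, x] H by apply: integrableS iH.
have ae1' : {ae mu, forall y, `[0, x]%classic y -> ((f k y)%:E @[k --> \oo] --> g y)%E}.
  apply: (ae_imp ae1).
  by move=> y h yx; exact/h/sub.
have ae2'' : {ae mu, forall y k, `[0, x]%classic y -> (`|(f k y)%:E| <= H y)%E}.
  apply: (ae_imp ae2').
  by move=> y h k yx; exact/h/sub.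
have [_ _] := @dominated_convergence _ _ R mu _ (measurable_itv `[0, x]) (fun k => EFin \o f k) g H mf' mg'' ae1' iH' ae2''.
have -> : (\int[mu]_(y in `[0%R, x]) g y = (itg 0 x g')%:E)%E.
  rewrite -itg_EFin; last exact: intgS ig'.
  apply: ae_eq_integral => //.
    by apply/measurable_EFinP; apply: measurable_funS mg'.
  apply: (ae_imp gg').
  by move=> y h yx; exact/h/sub.
move=> h; have [_ h2] := (fine_cvgP _ _).1 h.
exact: h2.
Unshelve. all: by end_near. Qed.
End Riesz.

(** * Dyadic differences and square integrable derivatives *)

Section Dyadic.
Variable R : realType.
Local Notation mu := (@lebesgue_measure R).
Implicit Types (f g h u : R -> R) (a b c d x y : R).

Lemma itg_eq_co a b f g : intg a b f -> intg a b g ->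
  (forall x, a <= x -> x < b -> f x = g x) -> itg a b f = itg a b g.
Proof.
move=> hf hg fg; rewrite /itg.
have sub : `[a, b[%classic `<=` `[a, b]%classic by apply: subset_itvl; rewrite bnd_simp.
rewrite -Rintegral_itv_bndo_bndc; last by apply: integrableS hf.
rewrite -[RHS]Rintegral_itv_bndo_bndc; last by apply: integrableS hg.
by apply: eq_Rintegral => x; rewrite inE /= in_itv /= => /andP[]; exact: fg.
Qed.

Lemma intg_sum a b n (F : nat -> R -> R) : (forall i, intg a b (F i)) ->
  intg a b (fun x => \sum_(i < n) F i x).
Proof.
move=> hF; elim: n => [|n ih].
  by apply: intg_eq (intg_cst a b 0) => x _; rewrite big_ord0.
by apply: intg_eq (intgD ih (hF n)) => x _; rewrite big_ord_recr.
Qed.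

Variables (l : R) (l0 : 0 < l) (u : R -> R).

Definition node n i : R := l * i%:R / 2 ^+ n.
Definition slope n i : R := (u (node n i.+1) - u (node n i)) * 2 ^+ n / l.
Definition stepf n x : R := \sum_(i < 2 ^ n) slope n i * \1_(`[node n i, node n i.+1[) x.

(** The Dirichlet energy of the piecewise linear interpolant on 2^n intervals; it
    depends on finitely many values of u, so it passes to pointwise limits. *)
Definition dyadic n : R := \sum_(i < 2 ^ n) (u (node n i.+1) - u (node n i)) ^+ 2 * 2 ^+ n / l.

Let p2 n : 0 < 2 ^+ n :> R. Proof. by rewrite exprn_gt0. Qed.

Lemma node_le n i j : (i <= j)%N -> node n i <= node n j.
Proof. by move=> ij; rewrite /node ler_pM2r ?invr_gt0// ler_pM2l// ler_nat. Qed.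
Lemma node0 n : node n 0 = 0. Proof. by rewrite /node mulr0 mul0r. Qed.
Lemma node_max n : node n (2 ^ n) = l.
Proof. by rewrite /node natrX mulfK// gt_eqF. Qed.
Lemma nodeS n i : node n i.+1 - node n i = l / 2 ^+ n.
Proof. by rewrite /node -natr1; ring. Qed.
Lemma node_refine n k i : node n i = node (n + k) (i * 2 ^ k).
Proof.
rewrite /node exprD natrM natrX; field.
by rewrite !gt_eqF.
Qed.
Lemma node_bnd n i : (i <= 2 ^ n)%N -> 0 <= node n i <= l.
Proof. by move=> h; rewrite -{1}(node0 n) -(node_max n) !node_le. Qed.

Lemma stepf_val n i x : (i < 2 ^ n)%N -> node n i <= x -> x < node n i.+1 -> stepf n x = slope n i.
Proof.
move=> hi h1 h2; rewrite /stepf (bigD1 (Ordinal hi))//= big1 ?addr0.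
  by rewrite indicE mem_set ?mulr1//= in_itv /= h1.
move=> j ji; rewrite indicE memNset ?mulr0//= in_itv /= => /andP[h3 h4].
have [lt|gt|e] := ltngtP j i.
- by move: (le_lt_trans (le_trans (node_le n lt) h1) h4); rewrite ltxx.
- by move: (le_lt_trans (le_trans (node_le n gt) h3) h2); rewrite ltxx.
- by move/eqP : ji; apply; apply: val_inj.
Qed.

Lemma intg_stepf n a b : intg a b (stepf n).
Proof.
apply: (@intg_sum a b (2 ^ n) (fun i x => slope n i * \1_(`[node n i, node n i.+1[) x)) => i.
apply: intgZ; apply: (@intg_le _ a b _ (fun=> 1)); last 2 first.
- exact: intg_cst.
- by move=> x _; rewrite indicE; case: (_ \in _); rewrite ?normr1 ?normr0.
- by apply: measurable_funTS; apply: measurable_indic.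
Qed.

Lemma intg_stepf_mul n a b f : intg a b f -> intg a b (fun x => stepf n x * f x).
Proof.
move=> hf; apply: (@intg_eq _ a b (fun x => \sum_(i < 2 ^ n) (slope n i * (\1_(`[node n i, node n i.+1[) x * f x)))).
  by move=> x _; rewrite mulr_suml; apply: eq_bigr => i _; rewrite mulrA.
apply: (@intg_sum a b (2 ^ n) (fun i x => slope n i * (\1_(`[node n i, node n i.+1[) x * f x))) => i.
apply: intgZ; apply: (@intg_le _ a b _ (fun x => `|f x|)); last 2 first.
- exact: intg_abs.
- by move=> x _; rewrite indicE; case: (_ \in _); rewrite ?mul1r ?mul0r ?normr0.
- by apply: measurable_funM; [apply: measurable_funTS; apply: measurable_indic|exact: intg_mfun].
Qed.

Lemma itg_nodes n f k : (k <= 2 ^ n)%N -> intg 0 l f ->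
  itg 0 (node n k) f = \sum_(i < k) itg (node n i) (node n i.+1) f.
Proof.
move=> hk hf; elim: k hk => [|k ih] hk; first by rewrite node0 itgxx big_ord0.
have /andP[h1 h2] := node_bnd (ltnW hk); have /andP[h3 h4] := node_bnd hk.
rewrite big_ord_recr /= -ih 1?ltnW// (@itg_cat _ 0 _ (node n k))//; first exact: node_le.
exact: intgS hf.
Qed.

Lemma itg_stepf1 n i : (i < 2 ^ n)%N ->
  itg (node n i) (node n i.+1) (stepf n) = u (node n i.+1) - u (node n i).
Proof.
move=> hi; rewrite (@itg_eq_co _ _ (stepf n) (fun=> slope n i)); last 3 first.
- exact: intg_stepf.
- exact: intg_cst.
- by move=> x; exact: stepf_val.
rewrite itg_cst; last exact: node_le.
by rewrite nodeS /slope; field; rewrite !gt_eqF.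
Qed.

Lemma itg_stepf n k : (k <= 2 ^ n)%N -> itg 0 (node n k) (stepf n) = u (node n k) - u 0.
Proof.
move=> hk; rewrite itg_nodes//; last exact: intg_stepf.
elim: k hk => [|k ih] hk; first by rewrite big_ord0 node0 subrr.
by rewrite big_ord_recr /= ih 1?ltnW// itg_stepf1//; ring.
Qed.

Lemma itg_stepf_refine n m k : (n <= m)%N -> (k <= 2 ^ n)%N ->
  itg 0 (node n k) (stepf m) = u (node n k) - u 0.
Proof.
move=> /subnKC <- hk; rewrite (node_refine n (m - n)) itg_stepf//.
by rewrite expnD leq_mul2r hk orbT.
Qed.

(** The slopes at level n are averages of the slopes at a finer level, so that
    stepf n is an orthogonal projection of stepf m. *)
Lemma itg_stepf_mul n m : (n <= m)%N ->
  itg 0 l (fun x => stepf n x * stepf m x) = dyadic n.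
Proof.
move=> nm; rewrite -[in LHS](node_max n) itg_nodes//; last by apply: intg_stepf_mul; exact: intg_stepf.
rewrite /dyadic; apply: eq_bigr => i _.
have hi := ltn_ord i.
rewrite (@itg_eq_co _ _ _ (fun x => slope n i * stepf m x)); last 3 first.
- by apply: intg_stepf_mul; exact: intg_stepf.
- by apply: intgZ; exact: intg_stepf.
- by move=> x h1 h2; rewrite (stepf_val hi).
rewrite itgZ; last exact: intg_stepf.
have /andP[h1 h2] := node_bnd (ltnW hi).
have -> : itg (node n i) (node n i.+1) (stepf m) = u (node n i.+1) - u (node n i).
  have := itg_stepf_refine nm hi; have := itg_stepf_refine nm (ltnW hi).
  rewrite (@itg_cat _ 0 (node n i.+1) (node n i))//; [lra|exact: node_le|exact: intg_stepf].
by rewrite /slope; ring.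
Qed.

Lemma itg_stepf_diff n m : (n <= m)%N ->
  itg 0 l (fun x => (stepf m x - stepf n x) ^+ 2) = dyadic m - dyadic n.
Proof.
move=> nm.
have i1 : intg 0 l (fun x => stepf m x * stepf m x) by apply: intg_stepf_mul; exact: intg_stepf.
have i2 : intg 0 l (fun x => 2 * (stepf n x * stepf m x)).
  by apply: intgZ; apply: intg_stepf_mul; exact: intg_stepf.
have i3 : intg 0 l (fun x => stepf n x * stepf n x) by apply: intg_stepf_mul; exact: intg_stepf.
rewrite (@itg_eq _ _ _ _ (fun x => (stepf m x * stepf m x - 2 * (stepf n x * stepf m x)) + stepf n x * stepf n x)).
  rewrite (itgD (intgB i1 i2) i3) (itgB i1 i2) itgZ ?itg_stepf_mul//; first by ring.
  by apply: intg_stepf_mul; exact: intg_stepf.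
by move=> x _; ring.
Qed.

(** The interpolants' slopes form a martingale bounded in L^2: by orthogonality
    [itg_stepf_diff] they are Cauchy as the energies increase to a limit. *)
Lemma riesz A : cts 0 l u -> (forall n, dyadic n <= A) ->
  exists g, abscont l u g /\ itg 0 l (fun x => g x ^+ 2) <= A.
Proof.
move=> cu hA.
pose S := range dyadic.
have hS : has_sup S by split; [exists (dyadic 0), 0%N|exists A => _ [n _ <-]].
set L := sup S.
have dL n : dyadic n <= L by apply: (sup_upper_bound hS); exists n.
have LA : L <= A by apply: ge_sup; [exact: hS.1|move=> _ [n _ <-]].
have mono n m : (n <= m)%N -> dyadic n <= dyadic m.
  move=> nm; rewrite -subr_ge0 -itg_stepf_diff//; apply: itg_ge0 => x _; exact: sqr_ge0.
have ex k : exists n, L - (2 ^+ k)^-1 ^+ 2 < dyadic n.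
  have := sup_adherent (_ : 0 < (2 ^+ k)^-1 ^+ 2 :> R) hS.
  by rewrite exprn_gt0 ?invr_gt0// => /(_ isT) [_ [n _ <-]]; exists n.
have [pk hpk] := choice ex.
pose phi k := (\sum_(i < k.+1) (pk i).+1)%N.
have phim k : (phi k <= phi k.+1)%N by rewrite /phi [X in (_ <= X)%N]big_ord_recr /= leq_addr.
have phik k : (k <= phi k)%N.
  by elim: k => // k ih; rewrite /phi big_ord_recr /= -/(phi k); rewrite addnS ltnS (leq_trans ih)// leq_addr.
have phip k : (pk k <= phi k)%N.
  by rewrite /phi big_ord_recr /= addnS (leq_trans (leq_addl _ _) (leqnSn _)).
have dphi k : L - (2 ^+ k)^-1 ^+ 2 < dyadic (phi k) by apply: lt_le_trans (hpk k) _; exact: mono.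
pose f k := stepf (phi k).
have If k : intg 0 l (f k) by exact: intg_stepf.
have If2 k : intg 0 l (fun x => f k x ^+ 2).
  by apply: intg_stepf_mul; exact: intg_stepf.
have E2 k : itg 0 l (fun x => f k x ^+ 2) = dyadic (phi k) by rewrite -(@itg_stepf_mul (phi k) (phi k)).
have Idiff k : intg 0 l (fun x => (f k.+1 x - f k x) ^+ 2).
  have i1 : intg 0 l (fun x => f k.+1 x * f k.+1 x) by apply: intg_stepf_mul; exact: intg_stepf.
  have i2 : intg 0 l (fun x => 2 * (f k x * f k.+1 x)).
    by apply: intgZ; apply: intg_stepf_mul; exact: intg_stepf.
  have i3 : intg 0 l (fun x => f k x * f k x) by apply: intg_stepf_mul; exact: intg_stepf.
  by apply: intg_eq (intgD (intgB i1 i2) i3) => x _; ring.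
have hd k : itg 0 l (fun x => `|f k.+1 x - f k x|) <= (l + 1) / 2 ^+ k.+1.
  pose t : R := (2 ^+ k)^-1.
  have t0 : 0 < t by rewrite invr_gt0.
  apply: (@le_trans _ _ (itg 0 l (fun x => 2^-1 * (t + t^-1 * (f k.+1 x - f k x) ^+ 2)))).
    apply: itg_le.
    - by apply: intg_abs; exact: intgB.
    - by apply: intgZ; apply: intgD; [exact: intg_cst|exact: intgZ].
    - move=> x _; set z := f k.+1 x - f k x.
      have h : 0 <= t^-1 * (`|z| - t) ^+ 2 by rewrite mulr_ge0 ?sqr_ge0// invr_ge0 ltW.
      have e : t^-1 * (`|z| - t) ^+ 2 = t^-1 * `|z| ^+ 2 - 2 * `|z| + t by field; rewrite gt_eqF.
      by rewrite e real_normK ?num_real// in h; lra.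
  rewrite itgZ; last by apply: intgD; [exact: intg_cst|exact: intgZ].
  rewrite itgD; [|exact: intg_cst|exact: intgZ].
  rewrite itg_cst ?(ltW l0)// itgZ// subr0 itg_stepf_diff//.
  have hdd : dyadic (phi k.+1) - dyadic (phi k) <= t ^+ 2.
    by have := dL (phi k.+1); have := dphi k; rewrite -/t; lra.
  apply: (@le_trans _ _ (2^-1 * (t * l + t^-1 * t ^+ 2))).
    by rewrite ler_pM2l// lerD2l ler_pM2l// invr_gt0.
  have -> : 2^-1 * (t * l + t^-1 * t ^+ 2) = (l + 1) * (t / 2) by field; rewrite gt_eqF.
  by rewrite exprS invfM /t mulrC [X in _ <= X]mulrC [2^-1 * _]mulrC.
have cA : itg 0 l (fun x => f k x ^+ 2) @[k --> \oo] --> L.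
  under eq_fun do rewrite E2.
  apply/cvgrPdist_le => e e0; near=> k.
  rewrite ger0_norm; last by rewrite subr_ge0.
  have h := dphi k.
  suff : ((2 ^+ k)^-1 : R) ^+ 2 <= e by move: h; lra.
  have k1 : (k%:R + 1 : R) <= 2 ^+ k.
    by rewrite natr1 -natrX ler_nat; exact: ltn_expl.
  have k2 : e^-1 <= (k%:R + 1 : R).
    apply: ltW; apply: (@lt_le_trans _ _ k%:R); last by rewrite lerDl.
    near: k; exact: nbhs_infty_gtr.
  have k3 : (2 ^+ k)^-1 <= e by rewrite -[e]invrK lef_pV2 ?posrE// ?invr_gt0// (le_trans k2 k1).
  have k4 : (2 ^+ k)^-1 <= 1 :> R by rewrite invf_le1// exprn_ege1// ler1n.
  rewrite expr2; apply: le_trans (ler_wpM2l _ k4) _; first by rewrite invr_ge0 ltW.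
  by rewrite mulr1.
have l10 : 0 <= l + 1 by rewrite addr_ge0// ltW.
have [g [ig ig2 cg gA]] := L2_limit l10 If If2 hd cA.
exists g; split; last exact: le_trans gA LA.
split=> //; have cG := prim_cts (prim_itg ig).
have Gnode n i : (i <= 2 ^ n)%N -> itg 0 (node n i) g = u (node n i) - u 0.
  move=> hi; have := cg _ (node_bnd hi) => /cvg_lim <-//.
  apply/cvg_lim => //; apply: cvg_near_cst; near=> k.
  apply: itg_stepf_refine => //; apply: leq_trans (phik k).
  by near: k; exact: nbhs_infty_ge.
apply: prim_intro => // x xl.
suff : u x - u 0 - itg 0 x g = 0 by lra.
have cv : cts 0 l (fun x => u x - u 0 - itg 0 x g).
  by apply: ctsD; [apply: ctsD => //; exact: cts_cst|exact: ctsN].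
apply/eqP; rewrite -normr_le0; apply/ler_addgt0Pr => e e0; rewrite add0r.
have [d d0 hd'] := cv _ xl _ e0.
pose n := (Num.truncn (l / d)).+1.
have hn : l / d < 2 ^+ n.
  apply: lt_trans (truncnS_gt _) _; rewrite -/n -natrX ltr_nat; exact: ltn_expl.
pose i := Num.truncn (x * 2 ^+ n / l).
have /andP[x0 xl'] := xl.
have z0 : 0 <= x * 2 ^+ n / l by rewrite divr_ge0 ?mulr_ge0// ltW.
have /andP[i1 i2] := truncn_itv z0; rewrite -/i in i1 i2.
have ni1 : node n i <= x.
  by rewrite /node ler_pdivrMr// mulrC -ler_pdivlMr.
have ni2 : x < node n i + l / 2 ^+ n.
  have : x < node n i.+1 by rewrite /node ltr_pdivlMr// [l * _]mulrC -ltr_pdivrMr.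
  by have := nodeS n i; lra.
have hi : (i <= 2 ^ n)%N.
  rewrite -(ler_nat R) natrX; apply: le_trans i1 _.
  by rewrite ler_pdivrMr// mulrC ler_pM2l.
have := hd' (node n i) (node_bnd hi).
rewrite (Gnode n i hi) subrr subr0 => h; apply/ltW/h.
rewrite ger0_norm ?subr_ge0//.
apply: (@lt_trans _ _ (l / 2 ^+ n)); first by lra.
by rewrite ltr_pdivrMr// mulrC -ltr_pdivrMr.
Unshelve. all: by end_near. Qed.

(** Cauchy-Schwarz on each dyadic interval. *)
Lemma dyadic_le (g : R -> R) n : abscont l u g -> dyadic n <= itg 0 l (fun x => g x ^+ 2).
Proof.
move=> [pu ig2]; rewrite -[in X in _ <= X](node_max n) itg_nodes// /dyadic.
apply: ler_sum => i _; have hi := ltn_ord i.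
have /andP[h1 h2] := node_bnd (ltnW hi); have /andP[h3 h4] := node_bnd hi.
have := @cauchy_increment R (node n i) (node n i.+1) u g (node_le n (leqnSn i))
   (prim_sub h1 h4 pu) (intgS h1 h4 ig2).
rewrite nodeS => h.
rewrite ler_pdivrMr// -ler_pdivlMr//; apply: le_trans h _.
by rewrite [X in X <= _](_ : _ = itg (node n i) (node n i.+1) (fun x => g x ^+ 2) * l / 2 ^+ n)//; ring.
Qed.
End Dyadic.

(** * Sums of nonnegative families *)

Section Tot.
Variables (R : realType).
Implicit Types T : choiceType.

(** Unordered sums over an arbitrary choice type, used for sums over all edges of
    the graph. *)
Definition psum T (f : T -> R) : set R := [set \sum_(i <- s) f i | s in [set s : seq T | uniq s]].
Definition summ T (f : T -> R) := (forall i, 0 <= f i) /\ has_ubound (psum f).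
Definition tot T (f : T -> R) := sup (psum f).

Lemma psum_neq0 T (f : T -> R) : psum f !=set0.
Proof. by exists (\sum_(i <- [::]) f i), [::]. Qed.
Lemma tot_ub T (f : T -> R) s : summ f -> uniq s -> \sum_(i <- s) f i <= tot f.
Proof.
move=> [_ h] us; apply: sup_upper_bound; first by split => //; exact: psum_neq0.
by exists s.
Qed.
Lemma tot_lub T (f : T -> R) M : (forall s, uniq s -> \sum_(i <- s) f i <= M) -> tot f <= M.
Proof. by move=> h; apply: ge_sup; [exact: psum_neq0|move=> _ [s us <-]; exact: h]. Qed.
Lemma summI T (f : T -> R) M : (forall i, 0 <= f i) ->
  (forall s, uniq s -> \sum_(i <- s) f i <= M) -> summ f.
Proof. by move=> f0 h; split=> //; exists M => _ [s us <-]; exact: h. Qed.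
Lemma summ_ge0 T (f : T -> R) i : summ f -> 0 <= f i. Proof. by case. Qed.
Lemma tot_ge0 T (f : T -> R) : summ f -> 0 <= tot f.
Proof. by move=> h; have := tot_ub h (isT : uniq [::]); rewrite big_nil. Qed.
Lemma tot_ub1 T (f : T -> R) i : summ f -> f i <= tot f.
Proof. by move=> h; have := tot_ub h (isT : uniq [:: i]); rewrite big_seq1. Qed.
Lemma summ_le T (f g : T -> R) : (forall i, 0 <= f i) -> (forall i, f i <= g i) -> summ g -> summ f.
Proof.
move=> f0 fg sg; apply: (@summI _ _ (tot g)) => // s us.
by apply: le_trans (tot_ub sg us); apply: ler_sum.
Qed.
Lemma tot_le T (f g : T -> R) : (forall i, f i <= g i) -> summ g -> tot f <= tot g.
Proof.
move=> fg sg; apply: tot_lub => s us.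
by apply: le_trans (tot_ub sg us); apply: ler_sum.
Qed.
Lemma eq_tot T (f g : T -> R) : (forall i, f i = g i) -> tot f = tot g.
Proof. by move=> fg; congr tot; apply/funext. Qed.
Lemma tot_adh T (f : T -> R) e : summ f -> 0 < e -> exists2 s, uniq s & tot f - e < \sum_(i <- s) f i.
Proof.
move=> [_ h] e0; have [_ [s us <-] hs] := sup_adherent e0 (conj (psum_neq0 f) h).
by exists s.
Qed.
Lemma sum_sub T (f : T -> R) s t : (forall i, 0 <= f i) -> uniq s -> uniq t -> {subset s <= t} ->
  \sum_(i <- s) f i <= \sum_(i <- t) f i.
Proof.
move=> f0 us ut st; rewrite (bigID (mem s) predT f (r := t)) /=.
have -> : \sum_(i <- t | i \in s) f i = \sum_(i <- s) f i.
  rewrite -big_filter; apply: perm_big; apply: uniq_perm => //; first exact: filter_uniq.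
  by move=> i; rewrite mem_filter andb_idr//; exact: st.
by rewrite lerDl sumr_ge0.
Qed.
Lemma totD T (f g : T -> R) : summ f -> summ g -> summ (fun i => f i + g i) /\ tot (fun i => f i + g i) = tot f + tot g.
Proof.
move=> sf sg; have H s : uniq s -> \sum_(i <- s) (f i + g i) <= tot f + tot g.
  by move=> us; rewrite big_split /= lerD// tot_ub.
have sfg : summ (fun i => f i + g i).
  by apply: (summI _ H) => i; rewrite addr_ge0// summ_ge0.
split=> //; apply/eqP; rewrite eq_le tot_lub//=.
apply/ler_addgt0Pr => e e0; have e20 : 0 < e / 2 by rewrite divr_gt0.
have [s us hs] := tot_adh sf e20; have [t ut ht] := tot_adh sg e20.
have uu := undup_uniq (s ++ t).
have := tot_ub sfg uu; rewrite big_split /=.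
have h1 : \sum_(i <- s) f i <= \sum_(i <- undup (s ++ t)) f i.
  by apply: sum_sub => //; [exact: sf.1|move=> i si; rewrite mem_undup mem_cat si].
have h2 : \sum_(i <- t) g i <= \sum_(i <- undup (s ++ t)) g i.
  by apply: sum_sub => //; [exact: sg.1|move=> i si; rewrite mem_undup mem_cat si orbT].
lra.
Qed.
Lemma totZ T (f : T -> R) k : 0 <= k -> summ f -> summ (fun i => k * f i) /\ tot (fun i => k * f i) = k * tot f.
Proof.
move=> k0 sf; have H s : uniq s -> \sum_(i <- s) (k * f i) <= k * tot f.
  by move=> us; rewrite -mulr_sumr ler_wpM2l// tot_ub.
have skf : summ (fun i => k * f i) by apply: (summI _ H) => i; rewrite mulr_ge0// summ_ge0.
split=> //; apply/eqP; rewrite eq_le tot_lub//=.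
have [k00|k00] := eqVneq k 0; first by rewrite {1}k00 mul0r tot_ge0.
have {}k0 : 0 < k by rewrite lt_def k00.
rewrite -ler_pdivlMl//; apply: tot_lub => s us; rewrite ler_pdivlMl// mulr_sumr.
exact: (tot_ub skf us).
Qed.
Lemma tot_fin T (f : T -> R) s : uniq s -> (forall i, 0 <= f i) -> (forall i, i \notin s -> f i = 0) ->
  summ f /\ tot f = \sum_(i <- s) f i.
Proof.
move=> us f0 h; have H t : uniq t -> \sum_(i <- t) f i <= \sum_(i <- s) f i.
  move=> ut; rewrite (bigID (mem s) predT f (r := t)) /= [X in _ + X]big1_seq ?addr0; last first.
    by move=> i /andP[/h].
  rewrite -big_filter; apply: sum_sub => //; first exact: filter_uniq.
  by move=> i; rewrite mem_filter => /andP[].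
have sf : summ f by exact: (summI f0 H).
by split=> //; apply/eqP; rewrite eq_le tot_lub//= tot_ub.
Qed.

(** The family with the entries in s replaced by 0, so that its sum is a tail. *)
Definition off T (s : seq T) (f : T -> R) i := if i \in s then 0 else f i.
Lemma tot_off T (f : T -> R) s : uniq s -> summ f ->
  summ (off s f) /\ tot f = \sum_(i <- s) f i + tot (off s f).
Proof.
move=> us sf; have s1 : summ (off s f).
  by apply: (summ_le _ _ sf) => i; rewrite /off; case: ifP => _; rewrite ?lexx ?sf.1.
pose g i := if i \in s then f i else 0.
have [sg eg] : summ g /\ tot g = \sum_(i <- s) g i.
  apply: tot_fin => // i; rewrite /g; first by case: ifP => // _; exact: sf.1.
  by move=> /negbTE ->.
split=> //; have [_ e] := totD sg s1.
have -> : \sum_(i <- s) f i = \sum_(i <- s) g i.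
  by rewrite big_seq [RHS]big_seq; apply: eq_bigr => i si; rewrite /g si.
rewrite -eg -e; apply: eq_tot => i; rewrite /g /off.
by case: ifP; rewrite ?addr0 ?add0r.
Qed.
Lemma tot_tail T (f : T -> R) e : summ f -> 0 < e -> exists2 s, uniq s & tot (off s f) < e.
Proof.
move=> sf e0; have [s us hs] := tot_adh sf e0; exists s => //.
by have [_ h] := tot_off us sf; move: hs; rewrite h; lra.
Qed.
Lemma tot_reindex T T' (f : T' -> R) (phi : T -> T') (psi : T' -> T) :
  cancel phi psi -> cancel psi phi -> summ f -> summ (f \o phi) /\ tot (f \o phi) = tot f.
Proof.
move=> k1 k2 sf; have H s : uniq s -> \sum_(i <- s) (f \o phi) i <= tot f.
  move=> us; rewrite -(big_map phi predT f); apply: tot_ub => //.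
  by rewrite map_inj_uniq//; exact: can_inj k1.
have s1 : summ (f \o phi) by apply: (summI _ H) => i; exact: sf.1.
split=> //; apply/eqP; rewrite eq_le tot_lub//=.
apply: tot_lub => s us.
have -> : \sum_(i <- s) f i = \sum_(i <- map psi s) (f \o phi) i.
  by rewrite big_map; apply: eq_bigr => i _ /=; rewrite k2.
apply: tot_ub => //.
by rewrite map_inj_uniq//; exact: can_inj k2.
Qed.
Lemma tot_pair T (I : choiceType) (es : seq T) (f : I * T -> R) : uniq es -> (forall e, e \in es) ->
  summ f -> summ (fun i => \sum_(e <- es) f (i, e)) /\ tot (fun i => \sum_(e <- es) f (i, e)) = tot f.
Proof.
move=> ue he sf; have H s : uniq s -> \sum_(i <- s) \sum_(e <- es) f (i, e) <= tot f.
  move=> us; have -> : \sum_(i <- s) \sum_(e <- es) f (i, e) = \sum_(p <- [seq (i, e) | i <- s, e <- es]) f p.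
    by rewrite big_allpairs_dep.
  by apply: tot_ub => //; apply: allpairs_uniq => // -[? ?] [? ?].
have s1 : summ (fun i => \sum_(e <- es) f (i, e)).
  by apply: (summI _ H) => i; apply: sumr_ge0 => e _; exact: summ_ge0.
split=> //; apply/eqP; rewrite eq_le tot_lub//=.
apply: tot_lub => s us; pose s' := undup (map fst s).
apply: le_trans (tot_ub s1 (undup_uniq (map fst s))).
have -> : \sum_(i <- s') \sum_(e <- es) f (i, e) = \sum_(p <- [seq (i, e) | i <- s', e <- es]) f p.
  by rewrite big_allpairs_dep.
apply: sum_sub => //; first exact: sf.1.
  by apply: allpairs_uniq; rewrite ?undup_uniq// => -[? ?] [? ?].
move=> [i e] h; apply/allpairsP; exists (i, e) => /=; split => //.
by rewrite mem_undup; apply/mapP; exists (i, e).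
Qed.

Lemma summ_pair T (I : choiceType) (es : seq T) (f : I * T -> R) (F : I -> R) : uniq es ->
  (forall e, e \in es) -> (forall p, 0 <= f p) -> (forall i, \sum_(e <- es) f (i, e) = F i) -> summ F ->
  summ f /\ tot f = tot F.
Proof.
move=> ue he f0 hF sF.
have H s : uniq s -> \sum_(p <- s) f p <= tot F.
  move=> us; pose s' := undup (map fst s).
  apply: le_trans (tot_ub sF (undup_uniq (map fst s))).
  rewrite -(eq_bigr _ (fun i _ => hF i)).
  have -> : \sum_(i <- s') \sum_(e <- es) f (i, e) = \sum_(p <- [seq (i, e) | i <- s', e <- es]) f p.
    by rewrite big_allpairs_dep.
  apply: sum_sub => //.
    by apply: allpairs_uniq; rewrite ?undup_uniq// => -[? ?] [? ?].
  move=> [i e] h; apply/allpairsP; exists (i, e) => /=; split => //.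
  by rewrite mem_undup; apply/mapP; exists (i, e).
have sf : summ f by exact: summI H.
split=> //; have [_ <-] := tot_pair ue he sf.
by apply: eq_tot => i; rewrite hF.
Qed.

(** Link with the extended real sums that define the norms. *)
Lemma tot_esum T (f : T -> R) : (forall i, 0 <= f i) ->
  ((\esum_(i in [set: T]) (f i)%:E < +oo)%E <-> summ f) /\
  (summ f -> (\esum_(i in [set: T]) (f i)%:E)%E = (tot f)%:E).
Proof.
move=> f0.
have H s : uniq s -> ((\sum_(i <- s) f i)%:E <= \esum_(i in [set: T]) (f i)%:E)%E.
  move=> us; apply: esum_ge; exists [set` s].
    by split => //; exact: finite_seq.
  by rewrite -fsbig_seq// sumEFin.
have E : summ f -> (\esum_(i in [set: T]) (f i)%:E)%E = (tot f)%:E.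
  move=> sf; apply/eqP; rewrite eq_le; apply/andP; split.
    apply: ge_ereal_sup => _ [A [fA _] <-].
    rewrite fsbig_finite// sumEFin lee_fin; exact: tot_ub.
  have [|h] := leP (tot f)%:E (\esum_(i in [set: T]) (f i)%:E)%E; first by [].
  have fin : (\esum_(i in [set: T]) (f i)%:E)%E \is a fin_num.
    rewrite ge0_fin_numE; last by apply: esum_ge0 => i _; rewrite lee_fin.
    by apply: lt_trans h _; rewrite ltry.
  exfalso; move: h; rewrite -(fineK fin) lte_fin ltNge => /negP; apply.
  by apply: tot_lub => s us; rewrite -lee_fin fineK//; exact: H.
split=> //; split=> [h|sf]; last by rewrite E// ltry.
have fin : (\esum_(i in [set: T]) (f i)%:E)%E \is a fin_num.
  by rewrite ge0_fin_numE//; apply: esum_ge0 => i _; rewrite lee_fin.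
apply: (@summI _ _ (fine (\esum_(i in [set: T]) (f i)%:E))) => // s us.
by rewrite -lee_fin fineK//; exact: H.
Qed.
End Tot.

(** * Sobolev functions on a metric graph *)

Section LocalBounds.
Variable R : realType.
Implicit Types (f g h u : R -> R) (a b c d x y l t : R).

(** The total variation of u^2. *)
Definition cross l u g : R := itg 0 l (fun x => 2 * `|u x * g x|).

Lemma abscont_cts l u g : abscont l u g -> cts 0 l u.
Proof. by move=> [/prim_cts]. Qed.
Lemma abscont_mul l u g : abscont l u g -> intg 0 l (fun x => u x * g x).
Proof. by move=> ac; have [[ig _] _] := ac; apply: intg_mul_cts => //; exact: abscont_cts ac. Qed.
Lemma abscont_sq l u g : abscont l u g -> prim 0 l (fun x => u x ^+ 2) (fun x => 2 * (u x * g x)).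
Proof.
move=> [pu _]; have := primM pu pu; apply: prim_eq => x _; by ring.
Qed.
Lemma cross_ge0 l u g : 0 <= cross l u g.
Proof. by apply: itg_ge0 => x _; rewrite mulr_ge0. Qed.
Lemma sq_diff l u g x y : abscont l u g -> 0 <= x <= l -> 0 <= y <= l ->
  `|u x ^+ 2 - u y ^+ 2| <= cross l u g.
Proof.
move=> ac; wlog xy : x y / x <= y.
  move=> W xl yl; have [h|/ltW h] := leP x y; first exact: W.
  by rewrite distrC; exact: W.
move=> /andP[x0 xl] /andP[y0 yl]; have [i p] := abscont_sq ac.
rewrite distrC p//; have i' : intg x y (fun x => 2 * (u x * g x)) by exact: intgS i.
apply: le_trans (itg_abs i') _.
have -> : itg x y (fun x => `|2 * (u x * g x)|) = itg x y (fun x => 2 * `|u x * g x|).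
  by apply: itg_eq => z _; rewrite normrM ger0_norm.
have i2 : intg 0 l (fun x => 2 * `|u x * g x|) by apply: intgZ; apply: intg_abs; exact: abscont_mul.
by apply: itg_sub_le => // z _; rewrite mulr_ge0.
Qed.
Lemma cross_le l u g t : abscont l u g -> 0 < t ->
  cross l u g <= t * itg 0 l (fun x => u x ^+ 2) + t^-1 * itg 0 l (fun x => g x ^+ 2).
Proof.
move=> ac t0; have [[ig _] ig2] := ac; have cu := abscont_cts ac.
have iu2 : intg 0 l (fun x => u x ^+ 2) by apply: cts_intg; exact: ctsX.
rewrite -!itgZ// -itgD; try exact: intgZ.
apply: itg_le; first by apply: intgZ; apply: intg_abs; exact: abscont_mul.
  by apply: intgD; exact: intgZ.
move=> x _; rewrite normrM -(real_normK (num_real (u x))) -(real_normK (num_real (g x))).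
rewrite -subr_ge0; set a := `|u x|; set b := `|g x|.
have -> : t * a ^+ 2 + t^-1 * b ^+ 2 - 2 * (a * b) = t^-1 * (t * a - b) ^+ 2 by field; rewrite gt_eqF.
by rewrite mulr_ge0 ?sqr_ge0// invr_ge0 ltW.
Qed.

(** The minimum of u^2 is at most its mean; elsewhere u^2 differs from it by at
    most its variation. *)
Lemma loc_sup l u g x : 0 < l -> abscont l u g -> 0 <= x <= l ->
  u x ^+ 2 <= l^-1 * itg 0 l (fun x => u x ^+ 2) + cross l u g.
Proof.
move=> l0 ac xl; have [y yl hy] := mean_point l0 (abscont_cts ac).
have := sq_diff ac xl yl; rewrite subr0 in hy => h.
have h1 : u y ^+ 2 <= l^-1 * itg 0 l (fun x => u x ^+ 2) by rewrite -ler_pdivrMl ?invr_gt0// invrK mulrC.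
have := ler_norm (u x ^+ 2 - u y ^+ 2); lra.
Qed.
End LocalBounds.

Section Graph.
Variables (R : realType) (G : metric_graph R).
Local Notation E := (edge G).
Implicit Types (u g v h : graph_fun G).

(** Applied to a function this is its mass on e, applied to its derivative it is the
    kinetic part of the energy; [six_int] is the nonlinear part. *)
Definition sq_int u e : R := itg 0 (len G e) (fun x => u e x ^+ 2).
Definition six_int u e : R := itg 0 (len G e) (fun x => u e x ^+ 6).
Definition glued u := forall h k : E * bool, endpoint G h.1 h.2 = endpoint G k.1 k.2 ->
  end_value u h = end_value u k.

(** H^1 functions on the graph with a chosen derivative g; by [in_H1_sobolev] and
    [sobolev_deriv] this is [in_H1] up to that choice. *)
Definition sobolev u g := [/\ forall e, abscont (len G e) (u e) (g e), glued u, summ (sq_int u) & summ (sq_int g)].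

Lemma len0 e : 0 < len G e. Proof. exact: len_gt0. Qed.
Lemma sq_int_ge0 u e : 0 <= sq_int u e.
Proof. by apply: itg_ge0 => x _; exact: sqr_ge0. Qed.
Lemma six_int_ge0 u e : 0 <= six_int u e.
Proof. by apply: itg_ge0 => x _; rewrite exprn_even_ge0. Qed.

Lemma LpnormE (p : nat) u : ~~ odd p -> (forall e, intg 0 (len G e) (fun x => u e x ^+ p)) ->
  Lp_normX p u = (\esum_(e in [set: E]) (itg 0 (len G e) (fun x => u e x ^+ p))%:E)%E.
Proof.
move=> op h; apply: eq_esum => e _.
rewrite -itg_EFin//; apply: eq_integral => x _.
by rewrite -normrX ger0_norm// exprn_even_ge0.
Qed.
Lemma sobolev_cts u g e : sobolev u g -> cts 0 (len G e) (u e).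
Proof. by case=> /(_ e) /abscont_cts. Qed.
Lemma sobolev_intgX u g e n : sobolev u g -> intg 0 (len G e) (fun x => u e x ^+ n).
Proof. by move=> /sobolev_cts c; apply: cts_intg; exact: ctsX. Qed.
Lemma Lp2E u g : sobolev u g -> Lp_normX 2 u = (tot (sq_int u))%:E.
Proof.
move=> s; rewrite LpnormE//; last by move=> e; exact: sobolev_intgX s.
by have [_ _ sm _] := s; apply: (tot_esum (sq_int_ge0 u)).2.
Qed.
Lemma Lp6E u g : sobolev u g -> summ (six_int u) -> Lp_normX 6 u = (tot (six_int u))%:E.
Proof.
move=> s s6; rewrite LpnormE//; last by move=> e; exact: sobolev_intgX s.
by apply: (tot_esum (six_int_ge0 u)).2.
Qed.

Lemma in_H1_sobolev u : in_H1 u -> sobolev u (graph_deriv u).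
Proof.
move=> [[cu gl] h1 [l2 n2] [l2' n2']].
have ac e : abscont (len G e) (u e) (graph_deriv u e).
  have [_ [g [hg hw]]] := h1 e.
  have [h2 h3] : Lp_itv 2 (len G e) (graph_deriv u e) /\ is_weak_derivative (len G e) (u e) (graph_deriv u e).
    by rewrite /graph_deriv /weak_derivative; case: xgetP => [y _ []//|/(_ g)]; case.
  by apply: weak_abscont => //; [exact: len0|exact/ctsP].
split=> //.
- apply: (tot_esum (sq_int_ge0 u)).1.1; move: n2; rewrite LpnormE// => e.
  by apply: cts_intg; apply: ctsX; exact/ctsP.
- apply: (tot_esum (sq_int_ge0 (graph_deriv u))).1.1; move: n2'; rewrite LpnormE// => e.
  by have [] := ac e.
Qed.

(** The norm of the weak derivative does not depend on the representative. *)
Lemma sobolev_deriv u g : sobolev u g -> in_H1 u /\ Lp_normX 2 (graph_deriv u) = (tot (sq_int g))%:E.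
Proof.
move=> s; have [ac gl sm sg] := s.
have Lg e : Lp_itv 2 (len G e) (g e).
  apply/Lp2_intgP; have [p i] := ac e; split=> //; exact: (abscont_mfun (ac e)).
have Lu e : Lp_itv 2 (len G e) (u e).
  by apply/Lp2_intgP; split; [exact: (cts_mfun (abscont_cts (ac e)))|exact: sobolev_intgX s].
have wd e : Lp_itv 2 (len G e) (graph_deriv u e) /\ is_weak_derivative (len G e) (u e) (graph_deriv u e).
  rewrite /graph_deriv /weak_derivative; case: xgetP => [y _ []//|/(_ (g e))]; case.
  by split=> //; exact: abscont_weak.
have ac' e : abscont (len G e) (u e) (graph_deriv u e).
  have [h2 h3] := wd e; apply: weak_abscont => //; [exact: len0|exact: abscont_cts (ac e)].
have mmE : sq_int (graph_deriv u) = sq_int g.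
  by apply/funext => e; apply: (@abscont_uniq _ _ (u e)) => //; exact/ltW/len0.
have e2 : Lp_normX 2 (graph_deriv u) = (tot (sq_int g))%:E.
  rewrite LpnormE//; last by move=> e; have [] := ac' e.
  have -> : (\esum_(e in [set: E]) (itg 0 (len G e) (fun x => graph_deriv u e x ^+ 2))%:E)%E = (\esum_(e in [set: E]) (sq_int g e)%:E)%E.
    by apply: eq_esum => e _; rewrite -mmE.
  exact: (tot_esum (sq_int_ge0 g)).2 sg.
split=> //; split.
- by split=> // e; apply/ctsP; exact: abscont_cts (ac e).
- by move=> e; split=> //; exists (g e); split=> //; exact: abscont_weak.
- by split=> //; rewrite (Lp2E s) ltry.
- by split=> [e|]; [have [] := wd e|rewrite e2 ltry].
Qed.

Definition gadd u v : graph_fun G := fun e x => u e x + v e x.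
Definition gscale (k : R) u : graph_fun G := fun e x => k * u e x.
Lemma sq_int_scale k u e : intg 0 (len G e) (fun x => u e x ^+ 2) -> sq_int (gscale k u) e = k ^+ 2 * sq_int u e.
Proof. by move=> i; rewrite /sq_int -itgZ//; apply: itg_eq => x _; rewrite /gscale exprMn. Qed.
Lemma six_int_scale k u e : cts 0 (len G e) (u e) -> six_int (gscale k u) e = k ^+ 6 * six_int u e.
Proof.
move=> i; rewrite /six_int -itgZ; first by apply: itg_eq => x _; rewrite /gscale exprMn.
by apply: cts_intg; exact: ctsX.
Qed.
Lemma abscontZ l (k : R) (u g : R -> R) : abscont l u g -> abscont l (fun x => k * u x) (fun x => k * g x).
Proof.
move=> [p i]; split; first exact: primZ.
by have := intgZ (k ^+ 2) i; apply: intg_eq => x _; rewrite exprMn.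
Qed.
Lemma abscontD l (u g v h : R -> R) : abscont l u g -> abscont l v h ->
  abscont l (fun x => u x + v x) (fun x => g x + h x).
Proof.
move=> ac1 ac2; have [p i] := ac1; have [q j] := ac2; split; first exact: primD.
have gh : intg 0 l (fun x => g x * h x).
  by apply: intg_mul2 => //; [exact: abscont_mfun ac1|exact: abscont_mfun ac2].
by apply: intg_eq (intgD (intgD i (intgZ 2 gh)) j) => x _; ring.
Qed.
Lemma sobolevZ k u g : sobolev u g -> sobolev (gscale k u) (gscale k g) /\
  tot (sq_int (gscale k u)) = k ^+ 2 * tot (sq_int u) /\ tot (sq_int (gscale k g)) = k ^+ 2 * tot (sq_int g).
Proof.
move=> s; have [ac gl sm sg] := s.
have e1 : sq_int (gscale k u) = fun e => k ^+ 2 * sq_int u e.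
  by apply/funext => e; apply: sq_int_scale; exact: sobolev_intgX s.
have e2 : sq_int (gscale k g) = fun e => k ^+ 2 * sq_int g e.
  by apply/funext => e; apply: sq_int_scale; have [] := ac e.
have [s1 t1] := totZ (sqr_ge0 k) sm; have [s2 t2] := totZ (sqr_ge0 k) sg.
split; last by rewrite e1 e2.
split; rewrite ?e1 ?e2//; first by move=> e; exact: abscontZ.
by move=> h1 h2 e; rewrite /end_value /gscale; congr (_ * _); exact: gl.
Qed.
Lemma six_intZ k u g : sobolev u g -> summ (six_int u) -> summ (six_int (gscale k u)) /\ tot (six_int (gscale k u)) = k ^+ 6 * tot (six_int u).
Proof.
move=> s s6; have -> : six_int (gscale k u) = fun e => k ^+ 6 * six_int u e.
  by apply/funext => e; apply: six_int_scale; exact: sobolev_cts s.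
by apply: totZ => //; rewrite exprn_even_ge0.
Qed.
Lemma sq_int_par u v e : intg 0 (len G e) (fun x => u e x ^+ 2) -> intg 0 (len G e) (fun x => v e x ^+ 2) ->
  intg 0 (len G e) (fun x => u e x * v e x) -> forall t : R,
  sq_int (gadd u (gscale t v)) e + t / 2 * sq_int (gadd u (gscale (-1) v)) e =
  sq_int u e + t ^+ 2 * sq_int v e + t / 2 * sq_int (gadd u v) e.
Proof.
move=> iu iv iuv t.
have i1 s : intg 0 (len G e) (fun x => (u e x ^+ 2 + (2 * s) * (u e x * v e x)) + s ^+ 2 * v e x ^+ 2).
  by apply: intgD; [apply: intgD => //|]; exact: intgZ.
have e1 s : itg 0 (len G e) (fun x => (u e x + s * v e x) ^+ 2) = sq_int u e + (2 * s) * itg 0 (len G e) (fun x => u e x * v e x) + s ^+ 2 * sq_int v e.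
  rewrite -itgZ// /sq_int -itgZ// -itgD//; last exact: intgZ.
  rewrite -itgD//; [|by apply: intgD => //; exact: intgZ|exact: intgZ].
  by apply: itg_eq => x _; ring.
have e2 : sq_int (gadd u v) e = sq_int u e + 2 * itg 0 (len G e) (fun x => u e x * v e x) + sq_int v e.
  have := e1 1; rewrite expr1n mul1r mulr1 => <-; apply: itg_eq => x _; by rewrite /gadd mul1r.
rewrite e2 {1 2}/sq_int /gadd /gscale !e1; by field.
Qed.
Lemma summ_add u v : (forall e, intg 0 (len G e) (fun x => u e x ^+ 2)) ->
  (forall e, intg 0 (len G e) (fun x => v e x ^+ 2)) ->
  (forall e, intg 0 (len G e) (fun x => u e x * v e x)) ->
  summ (sq_int u) -> summ (sq_int v) -> summ (sq_int (gadd u v)).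
Proof.
move=> iu iv iuv su sv.
have [s1 _] := totD su sv; have [s2 _] := totZ (ler0n R 2) s1.
apply: (summ_le _ _ s2) => e; first exact: sq_int_ge0.
rewrite -itgD// -itgZ; last by apply: intgD.
apply: itg_le.
- by apply: intg_eq (intgD (intgD (iu e) (intgZ 2 (iuv e))) (iv e)) => x _; rewrite /gadd; ring.
- by apply: intgZ; exact: intgD.
- by move=> x _; have := sqr_ge0 (u e x - v e x); rewrite /gadd; lra.
Qed.
Lemma sobolev_mul u g v h e : sobolev u g -> sobolev v h ->
  intg 0 (len G e) (fun x => u e x * v e x) /\ intg 0 (len G e) (fun x => g e x * h e x).
Proof.
move=> su sv; split.
  by apply: cts_intg; apply: ctsM; [exact: sobolev_cts su|exact: sobolev_cts sv].
have [ac _ _ _] := su; have [ac' _ _ _] := sv.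
have [p i] := ac e; have [q j] := ac' e.
by apply: intg_mul2 => //; [exact: abscont_mfun (ac e)|exact: abscont_mfun (ac' e)].
Qed.
Lemma sobolevD u g v h : sobolev u g -> sobolev v h -> sobolev (gadd u v) (gadd g h).
Proof.
move=> su sv; have [ac gl sm sg] := su; have [ac' gl' sm' sg'] := sv.
split.
- by move=> e; exact: abscontD.
- by move=> h1 h2 e; rewrite /end_value /gadd; congr (_ + _); [exact: gl|exact: gl'].
- apply: summ_add => // e; [exact: sobolev_intgX su|exact: sobolev_intgX sv|].
  by have [] := sobolev_mul e su sv.
- apply: summ_add => // e; [by have [] := ac e|by have [] := ac' e|].
  by have [] := sobolev_mul e su sv.
Qed.
Lemma sobolevB u g v h : sobolev u g -> sobolev v h -> sobolev (gadd u (gscale (-1) v)) (gadd g (gscale (-1) h)).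
Proof. by move=> su sv; apply: sobolevD => //; exact: (sobolevZ (-1) sv).1. Qed.

(** The parallelogram identity, arranged so that only nonnegative families are
    added. *)
Lemma tot_par u g v h (t : R) : 0 <= t -> sobolev u g -> sobolev v h ->
  tot (sq_int (gadd u (gscale t v))) + t / 2 * tot (sq_int (gadd u (gscale (-1) v))) =
  tot (sq_int u) + t ^+ 2 * tot (sq_int v) + t / 2 * tot (sq_int (gadd u v)) /\
  tot (sq_int (gadd g (gscale t h))) + t / 2 * tot (sq_int (gadd g (gscale (-1) h))) =
  tot (sq_int g) + t ^+ 2 * tot (sq_int h) + t / 2 * tot (sq_int (gadd g h)).
Proof.
move=> t0 su sv; have t20 : 0 <= t / 2 by rewrite divr_ge0.
have [_ _ a1 a2] := sobolevD su (sobolevZ t sv).1.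
have [_ _ b1 b2] := sobolevB su sv.
have [_ _ c1 c2] := sobolevD su sv.
have [ac _ d1 d2] := su; have [ac' _ e1 e2] := sv.
have K (p q : graph_fun G) : summ (sq_int p) -> summ (sq_int q) -> summ (sq_int (gadd p (gscale t q))) ->
   summ (sq_int (gadd p (gscale (-1) q))) -> summ (sq_int (gadd p q)) ->
   (forall e, intg 0 (len G e) (fun x => p e x ^+ 2)) -> (forall e, intg 0 (len G e) (fun x => q e x ^+ 2)) ->
   (forall e, intg 0 (len G e) (fun x => p e x * q e x)) ->
   tot (sq_int (gadd p (gscale t q))) + t / 2 * tot (sq_int (gadd p (gscale (-1) q))) =
   tot (sq_int p) + t ^+ 2 * tot (sq_int q) + t / 2 * tot (sq_int (gadd p q)).
  move=> h1 h2 h3 h4 h5 h6 h7 h8.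
  have [x1 y1] := totZ t20 h4; have [x2 y2] := totZ t20 h5; have [x3 y3] := totZ (sqr_ge0 t) h2.
  have [x4 y4] := totD h1 x3; have [x5 y5] := totD x4 x2; have [x6 y6] := totD h3 x1.
  rewrite -y1 -y2 -y3 -y4 -y5 -y6; apply: eq_tot => e; exact: sq_int_par.
split; apply: K => // e.
- exact: sobolev_intgX su.
- exact: sobolev_intgX sv.
- by have [] := sobolev_mul e su sv.
- by have [] := ac e.
- by have [] := ac' e.
- by have [] := sobolev_mul e su sv.
Qed.
End Graph.

(** * Calibration of families of arms *)

Section Arms.
Variable R : realType.
Variables (Q : choiceType) (C : Type).
Local Notation b0 := (arc_rate R).
Local Notation a0 := (arc_weight R).
Local Notation mR := (critical_mass_line R).

(** What the calibration needs to know of a family of intervals (arms), each with an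
    outer end and a centre: masses [aM], squared derivatives [aA], sixth powers
    [aB], the values u^4 at the outer end [az] and at the centre [ac].  Arms with
    the same centre share the value there, and no arm is alone at its centre. *)
Record arms := Arms {
  aM : Q -> R; aA : Q -> R; aB : Q -> R; az : Q -> R; ac : Q -> R; cen : Q -> C;
  aM_ge0 : forall q, 0 <= aM q;
  az_ge0 : forall q, 0 <= az q;
  cen_eq : forall q r, cen q = cen r -> ac q = ac r;
  partner : forall q, exists r, r <> q /\ cen r = cen q;
  arm_ineq : forall q (phi psi : R), - (pi / 2) < phi < pi / 2 -> psi < pi / 2 ->
    b0 * aM q <= phi + psi ->
    aB q / 6 <= aA q / 2 + a0 * (tan psi * az q + tan phi * ac q)
}.

(** With angle 0 at the centre, the boundary term at the centre disappears. *)
Lemma light_arm (S : arms) q (w : R) : b0 * aM S q < pi / 2 -> tan (b0 * aM S q) * az S q <= w ->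
  aB S q / 6 <= aA S q / 2 + a0 * w.
Proof.
move=> h1 h2; have pih : - (pi / 2) < (0 : R) < pi / 2.
  by have := @pi_gt0 R; rewrite oppr_lt0 divr_gt0// pi_gt0.
have := @arm_ineq S q 0 (b0 * aM S q) pih h1.
rewrite add0r lexx => /(_ isT) h; apply: le_trans h _.
by rewrite tan0 mul0r addr0 lerD2l ler_wpM2l// ltW// arc_weight_gt0.
Qed.

(** Opposite angles at the common centre cancel the two terms there, so that two
    partners behave like one interval, with half of the total angle at each outer
    end. *)
Lemma pair_arms (S : arms) q r (w w' : R) : r <> q -> cen S r = cen S q ->
  b0 * (aM S q + aM S r) / 2 < pi / 2 ->
  tan (b0 * (aM S q + aM S r) / 2) * az S q <= w ->
  tan (b0 * (aM S q + aM S r) / 2) * az S r <= w' ->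
  aB S q / 6 + aB S r / 6 <= (aA S q / 2 + a0 * w) + (aA S r / 2 + a0 * w').
Proof.
move=> rq cc hm h1 h2.
set psi := b0 * (aM S q + aM S r) / 2.
pose phi := b0 * (aM S q - aM S r) / 2.
have bq : 0 <= b0 * aM S q by rewrite mulr_ge0 ?aM_ge0// ltW// arc_rate_gt0.
have br : 0 <= b0 * aM S r by rewrite mulr_ge0 ?aM_ge0// ltW// arc_rate_gt0.
have hphi : - (pi / 2) < phi < pi / 2.
  by move: hm; rewrite /phi /psi mulrBr mulrDr => hm; apply/andP; split; lra.
have hphi' : - (pi / 2) < - phi < pi / 2 by move/andP : hphi => [? ?]; apply/andP; split; lra.
have e1 : b0 * aM S q <= phi + psi by rewrite /phi /psi; lra.
have e2 : b0 * aM S r <= - phi + psi by rewrite /phi /psi; lra.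
have H1 := arm_ineq hphi hm e1; have H2 := arm_ineq hphi' hm e2.
rewrite -/psi in h1 h2 H1 H2; rewrite (cen_eq cc) tanN in H2.
have a00 := arc_weight_gt0 R.
have h1' : a0 * (tan psi * az S q) <= a0 * w by rewrite ler_pM2l.
have h2' : a0 * (tan psi * az S r) <= a0 * w' by rewrite ler_pM2l.
rewrite mulrDr in H1; rewrite mulrDr mulNr mulrN in H2.
lra.
Qed.

Lemma arms_sum (S : arms) (w : Q -> R) (L : seq Q) : uniq L ->
  summ (aA S) -> summ (aB S) -> summ w ->
  \sum_(q <- L) aB S q / 6 <= \sum_(q <- L) (aA S q / 2 + a0 * w q) ->
  (forall q, q \notin L -> aB S q / 6 <= aA S q / 2 + a0 * w q) ->
  tot (aB S) / 6 <= tot (aA S) / 2 + a0 * tot w.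
Proof.
move=> uL sA sB sw hL hn.
have a00 := ltW (arc_weight_gt0 R).
have i6 : 0 <= 6^-1 :> R by rewrite invr_ge0.
have i2 : 0 <= 2^-1 :> R by rewrite invr_ge0.
have [sB' eB] := totZ i6 sB; have [sA' eA] := totZ i2 sA; have [sw' ew] := totZ a00 sw.
have [sAw eAw] := totD sA' sw'.
have [sb1 e1] := tot_off uL sB'; have [sb2 e2] := tot_off uL sAw.
rewrite [tot (aB S) / 6]mulrC [tot (aA S) / 2]mulrC -eB -eA -ew -eAw e1 e2.
apply: lerD.
  rewrite (eq_bigr (fun q => aB S q / 6)); last by move=> q _; rewrite mulrC.
  by apply: le_trans hL _; apply: ler_sum => q _; rewrite [2^-1 * _]mulrC.
apply: tot_le => // q; rewrite /off; case: ifPn => // /hn.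
by rewrite mulrC [2^-1 * _]mulrC.
Qed.

Lemma tan_ge0 (x : R) : 0 <= x -> x < pi / 2 -> 0 <= tan x.
Proof.
move=> x0 xp; rewrite -(tan0 R); apply: tan_le => //.
by rewrite oppr_lt0 divr_gt0// pi_gt0.
Qed.

(** The largest tangent that can occur when a deficit eta is left. *)
Definition heavy_const (eta : R) : R := tan (pi / 2 - b0 * eta / 4).

(** Arms with less than about mu_R / 2 are calibrated alone.  At most two arms are
    heavier, because the total mass is at most 13/12 mu_R, and these are calibrated
    with their partners; two heavy arms with the same centre are excluded by the
    bound on pairs. *)
Lemma spread_arms (S : arms) eta : 0 < eta -> eta <= mR / 6 ->
  summ (aM S) -> summ (aA S) -> summ (aB S) -> summ (az S) ->
  tot (aM S) <= (1 + 1 / 12) * mR ->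
  (forall q r, r <> q -> cen S r = cen S q -> aM S q + aM S r <= mR - eta) ->
  tot (aB S) / 6 <= tot (aA S) / 2 + a0 * heavy_const eta * tot (az S).
Proof.
move=> eta0 etaR sM sA sB sz htot hpair.
set K := heavy_const eta.
have bb := arc_rate_gt0 R; have bm := arc_rate_line R; have pp := @pi_gt0 R.
have be0 : 0 < b0 * eta by rewrite mulr_gt0.
have beR : b0 * eta <= pi / 6 by rewrite -bm -mulrA ler_pM2l.
have K0 : 0 <= K by apply: tan_ge0; lra.
have [sw ew] := totZ K0 sz.
rewrite -mulrA -ew.
have light q : aM S q <= mR / 2 - eta / 4 -> aB S q / 6 <= aA S q / 2 + a0 * (K * az S q).
  move=> hq; have bq : b0 * aM S q <= pi / 2 - b0 * eta / 4.
    have : b0 * aM S q <= b0 * (mR / 2 - eta / 4) by rewrite ler_pM2l.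
    by lra.
  apply: light_arm; first by lra.
  rewrite ler_wpM2r ?az_ge0//; apply: tan_le; [|exact: bq|lra].
  have : 0 <= b0 * aM S q by rewrite mulr_ge0 ?aM_ge0// ltW.
  lra.
have pairs q r : r <> q -> cen S r = cen S q ->
  aB S q / 6 + aB S r / 6 <= (aA S q / 2 + a0 * (K * az S q)) + (aA S r / 2 + a0 * (K * az S r)).
  move=> rq cc; have hp := hpair q r rq cc.
  have bq : b0 * (aM S q + aM S r) / 2 <= pi / 2 - b0 * eta / 2.
    have : b0 * (aM S q + aM S r) <= b0 * (mR - eta) by rewrite ler_pM2l.
    by rewrite mulrBr bm; lra.
  have b1 : 0 <= b0 * (aM S q + aM S r) by rewrite mulr_ge0 ?addr_ge0 ?aM_ge0// ltW.
  have tt : tan (b0 * (aM S q + aM S r) / 2) <= K by apply: tan_le; lra.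
  apply: pair_arms => //; first by lra.
  - by rewrite ler_wpM2r ?az_ge0.
  - by rewrite ler_wpM2r ?az_ge0.
pose heavy q := mR / 2 - eta / 4 < aM S q.
have lightN q : ~ heavy q -> aB S q / 6 <= aA S q / 2 + a0 * (K * az S q).
  by move=> /negP; rewrite -leNgt; exact: light.
have [[q1 hq1]|no] := pselect (exists q, heavy q); last first.
  apply: (@arms_sum S _ [::]) => //; first by rewrite !big_nil.
  by move=> q _; apply: lightN => h; apply: no; exists q.
have [r1 [nr1 cr1]] := partner S q1.
have [[q2 [hq2 [n1 n2]]]|no] := pselect (exists q, heavy q /\ q <> q1 /\ q <> r1); last first.
  have u1 : uniq [:: q1; r1] by rewrite /= inE andbT; apply/eqP => e; apply: nr1.
  apply: (@arms_sum S _ [:: q1; r1]) => //.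
    by rewrite !big_cons !big_nil !addr0; exact: pairs.
  move=> q; rewrite !inE negb_or => /andP[/eqP h1 /eqP h2].
  by apply: lightN => h; apply: no; exists q.
have nc : cen S q2 <> cen S q1.
  move=> cc; have := hpair q1 q2 n1 cc; move: hq1 hq2; rewrite /heavy; lra.
have [r2 [nr2 cr2]] := partner S q2.
have u4 : uniq [:: q1; r1; q2; r2].
  have e1 : q1 != r1 by apply/eqP => e; apply: nr1.
  have e2 : q1 != q2 by apply/eqP => e; apply: n1.
  have e3 : q1 != r2 by apply/eqP => e; apply: nc; rewrite e cr2.
  have e4 : r1 != q2 by apply/eqP => e; apply: n2.
  have e5 : r1 != r2 by apply/eqP => e; apply: nc; rewrite -cr2 -e cr1.
  have e6 : q2 != r2 by apply/eqP => e; apply: nr2.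
  by rewrite /= !inE !negb_or e1 e2 e3 e4 e5 e6.
apply: (@arms_sum S _ [:: q1; r1; q2; r2]) => //.
  rewrite !big_cons !big_nil !addr0.
  by have := pairs q1 r1 nr1 cr1; have := pairs q2 r2 nr2 cr2; lra.
move=> q; rewrite !inE !negb_or => /and4P[/eqP h1 /eqP h2 /eqP h3 /eqP h4].
apply: lightN => h.
have u3 : uniq [:: q1; q2; q].
  have e1 : q1 != q2 by apply/eqP => e; apply: n1.
  have e2 : q1 != q by apply/eqP => e; apply: h1.
  have e3 : q2 != q by apply/eqP => e; apply: h3.
  by rewrite /= !inE !negb_or e1 e2 e3.
have := tot_ub sM u3; rewrite !big_cons !big_nil addr0.
move: hq1 hq2 h; rewrite /heavy; lra.
Qed.

(** tan (pi/2 - x) = 1 / tan x, and tan x >= x. *)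
Lemma tan_cot (x : R) : 0 < x -> x < pi / 2 -> tan (pi / 2 - x) <= x^-1.
Proof.
move=> x0 xp; have c0 : 0 < cos x by apply: cos_gt0_pihalf; rewrite xp andbT; lra.
have s0 : 0 < sin x by apply: sin_gt0_pi; rewrite x0 /=; have := @pi_gt0 R; lra.
have -> : tan (pi / 2 - x) = (tan x)^-1.
  by rewrite /tan sinB cosB sin_pihalf cos_pihalf; field; rewrite !gt_eqF.
have t0 : 0 < tan x by rewrite /tan divr_gt0.
rewrite lef_pV2 ?posrE//.
have d z : z \in `]0, x[%R -> is_derive z 1 tan ((cos z)^-2).
  rewrite in_itv /= => /andP[xz zy]; apply: is_derive_tan; apply: cos_neq0; lra.
have [|c cx e] := @MVT _ (@tan R) (fun z => (cos z)^-2) 0 x x0 d.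
  apply: continuous_in_subspaceT => z; rewrite inE /= in_itv /= => /andP[xz zy].
  apply: continuous_tan; apply: cos_neq0; lra.
move: cx; rewrite in_itv /= => /andP[c1 c2].
have cc0 : cos c != 0 by apply: cos_neq0; lra.
rewrite tan0 !subr0 in e; rewrite e cosV2// ler_peMl ?(ltW x0)//.
by rewrite lerDl sqr_ge0.
Qed.

(** The tangent for the heavy pair may be huge, of the order of the inverse of the
    remaining mass, and is compensated by the smallness of u^4 at its outer ends,
    which is a hypothesis here. *)
Lemma concentrated_arms (S : arms) q r (w : Q -> R) : r <> q -> cen S r = cen S q ->
  summ (aM S) -> summ (aA S) -> summ (aB S) -> summ w ->
  aM S q + aM S r < mR ->
  2 / (b0 * (mR - (aM S q + aM S r))) * az S q <= w q ->
  2 / (b0 * (mR - (aM S q + aM S r))) * az S r <= w r ->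
  (forall p, p <> q -> p <> r -> aM S p <= mR / 4 /\ az S p <= w p) ->
  tot (aB S) / 6 <= tot (aA S) / 2 + a0 * tot w.
Proof.
move=> rq cc sM sA sB sw hm hq hr hp.
have bb := arc_rate_gt0 R; have bm := arc_rate_line R; have pp := @pi_gt0 R.
pose g := mR - (aM S q + aM S r).
have g0 : 0 < g by rewrite subr_gt0.
have bg0 : 0 < b0 * g by rewrite mulr_gt0.
have b1 : 0 <= b0 * (aM S q + aM S r) by rewrite mulr_ge0 ?addr_ge0 ?aM_ge0// ltW.
have E : b0 * (aM S q + aM S r) / 2 = pi / 2 - b0 * g / 2 by rewrite /g mulrBr bm; field.
have tt : tan (b0 * (aM S q + aM S r) / 2) <= 2 / (b0 * g).
  have [h0|h0] := eqVneq (b0 * (aM S q + aM S r)) 0.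
    by rewrite h0 mul0r tan0 divr_ge0// ltW.
  rewrite E; have -> : 2 / (b0 * g) = (b0 * g / 2)^-1 by rewrite invf_div.
  apply: tan_cot; first by lra.
  have : 0 < b0 * (aM S q + aM S r) by rewrite lt_def h0.
  move: E; lra.
have u1 : uniq [:: q; r] by rewrite /= inE andbT; apply/eqP => e; apply: rq.
apply: (@arms_sum S w [:: q; r]) => //.
  rewrite !big_cons !big_nil !addr0; apply: pair_arms => //; first by rewrite E; lra.
  - by apply: le_trans hq; rewrite ler_wpM2r ?az_ge0.
  - by apply: le_trans hr; rewrite ler_wpM2r ?az_ge0.
move=> p; rewrite !inE negb_or => /andP[/eqP h1 /eqP h2].
have [h3 h4] := hp p h1 h2.
have bp : b0 * aM S p <= pi / 4 by rewrite -bm -mulrA ler_pM2l.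
have bp0 : 0 <= b0 * aM S p by rewrite mulr_ge0 ?aM_ge0// ltW.
apply: light_arm; first by lra.
apply: le_trans h4; rewrite -[X in _ <= X]mul1r ler_wpM2r ?az_ge0//.
by rewrite -(tan_piquarter R); apply: tan_le; lra.
Qed.
End Arms.

(** * Cutting the edges of a graph without terminal edges *)

Section GraphArms.
Variables (R : realType) (G : metric_graph R) (lmin : R).
Hypotheses (lmin0 : 0 < lmin) (lminP : forall e, lmin <= len G e).
Hypothesis hterm : forall e : edge G, ~ terminal_edge e.
Local Notation E := (edge G).
Local Notation b0 := (arc_rate R).
Local Notation a0 := (arc_weight R).
Local Notation mR := (critical_mass_line R).
Implicit Types (u g : graph_fun G).

(** A vertex with a single edge end would have degree 1. *)
Lemma end_partner (h : E * bool) : exists k, k <> h /\ endpoint G k.1 k.2 = endpoint G h.1 h.2.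
Proof.
apply: contrapT => hn; apply: (hterm (e := h.1)); exists h.2.
rewrite /degree_eq1; have -> : ends (endpoint G h.1 h.2) = [set h].
  apply/seteqP; split => k /=; last by move=> ->.
  by move=> hk; apply: contrapT => kh; apply: hn; exists k.
exact: card_set1.
Qed.

(** The piece (e, (b, s)) of the edge e lies in the half next to the end b; it
    runs from the cut point of that half to the midpoint of e if s holds, and to the
    end b otherwise.  Its centre is that midpoint or that vertex. *)
Definition piece : choiceType := (E * (bool * bool))%type.
Implicit Types (q r p : piece) (c : E -> bool -> R).
Definition lo c q : R := let: (e, (b, s)) := q in
  if b then (if s then len G e / 2 else c e true) else (if s then c e false else 0).
Definition hi c q : R := let: (e, (b, s)) := q in
  if b then (if s then c e true else len G e) else (if s then len G e / 2 else c e false).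
Definition validcut c := forall e,
  [/\ 0 <= c e false, c e false <= len G e / 2, len G e / 2 <= c e true & c e true <= len G e].

Lemma lohi c q : validcut c -> [/\ 0 <= lo c q, lo c q <= hi c q & hi c q <= len G q.1].
Proof.
move=> vc; case: q => e [b s]; have [h1 h2 h3 h4] := vc e; have l0 := len_gt0 (m:=G) e.
by case: b; case: s => /=; split => //; lra.
Qed.

Definition cenv u q : R := let: (e, (b, s)) := q in
  if s then u e (len G e / 2) else end_value u (e, b).
Definition pcen q : vtx G + E := let: (e, (b, s)) := q in
  if s then inr e else inl (endpoint G e b).
Definition pM c u q : R := itg (lo c q) (hi c q) (fun x => u q.1 x ^+ 2).
Definition pB c u q : R := itg (lo c q) (hi c q) (fun x => u q.1 x ^+ 6).
Definition pz c u q : R := u q.1 (c q.1 q.2.1) ^+ 4.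

Section System.
Variables (c : E -> bool -> R) (u g : graph_fun G).
Hypotheses (vc : validcut c) (su : sobolev u g).

Let pM_ge0 q : 0 <= pM c u q.
Proof. by apply: itg_ge0 => x _; exact: sqr_ge0. Qed.
Let pz_ge0 q : 0 <= pz c u q.
Proof. by rewrite exprn_even_ge0. Qed.
Let cenv_eq q r : pcen q = pcen r -> cenv u q ^+ 4 = cenv u r ^+ 4.
Proof.
case: q => e [b s]; case: r => e' [b' s'] /=.
case: s; case: s' => // -[]; first by move=> ->.
move=> h; congr (_ ^+ 4); have [_ gl _ _] := su.
by apply: (gl (e, b) (e', b')).
Qed.
Let ppartner q : exists r, r <> q /\ pcen r = pcen q.
Proof.
case: q => e [b s]; case: s.
  by exists (e, (~~ b, true)); split => // -[]; case: b.
have [[e' b'] [h1 h2]] := end_partner (e, b).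
exists (e', (b', false)); split; first by move=> [h3 h4]; apply: h1; rewrite h3 h4.
by rewrite /= in h2 *; rewrite h2.
Qed.
Let parm q (phi psi : R) : - (pi / 2) < phi < pi / 2 -> psi < pi / 2 ->
    b0 * pM c u q <= phi + psi ->
    pB c u q / 6 <= pM c g q / 2 + a0 * (tan psi * pz c u q + tan phi * cenv u q ^+ 4).
Proof.
move=> hphi hpsi hm; have [h1 h2 h3] := lohi q vc.
have [ac _ _ _] := su; have [p i] := ac q.1.
have p' := prim_sub h1 h3 p; have i' := intgS h1 h3 i.
have m0 : 0 <= b0 * pM c u q by rewrite mulr_ge0 ?pM_ge0// ltW// arc_rate_gt0.
have hpsi' : - (pi / 2) < psi < pi / 2 by move/andP : hphi => [? ?]; apply/andP; split; lra.
have [hphi1 hphi2] := andP hphi.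
clear p i; case: q h1 h2 h3 p' i' hm m0 => e [b s].
case: b; case: s => h1 h2 h3 p' i' hm m0; rewrite /pB /pM /pz /cenv /end_value /=.
- have := arc_ineq h2 p' i' hphi hpsi hm; rewrite /= => h; apply: le_trans h _.
  by rewrite [X in a0 * X]addrC.
- by rewrite addrC in hm; exact: (arc_ineq h2 p' i' hpsi' hphi2 hm).
- by rewrite addrC in hm; exact: (arc_ineq h2 p' i' hpsi' hphi2 hm).
- have := arc_ineq h2 p' i' hphi hpsi hm; rewrite /= => h; apply: le_trans h _.
  by rewrite [X in a0 * X]addrC.
Qed.

(** The partner of a piece at a midpoint is the opposite piece of the same edge; at
    a vertex it is given by [end_partner]. *)
Definition gsys : arms R piece (vtx G + E) :=
  @Arms R piece _ (pM c u) (pM c g) (pB c u) (pz c u) (fun q => cenv u q ^+ 4) pcen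
    pM_ge0 pz_ge0 cenv_eq ppartner parm.
End System.

Definition all_pieces : seq (bool * bool) :=
  [:: (false, false); (false, true); (true, true); (true, false)].
Lemma all_pieces_uniq : uniq all_pieces. Proof. by []. Qed.
Lemma all_piecesP t : t \in all_pieces. Proof. by case: t => -[] []. Qed.

Lemma half_cat c e b (f : R -> R) : validcut c -> intg 0 (len G e) f ->
  itg (lo c (e, (b, false))) (hi c (e, (b, false))) f + itg (lo c (e, (b, true))) (hi c (e, (b, true))) f =
  itg (if b then len G e / 2 else 0) (if b then len G e else len G e / 2) f.
Proof.
move=> vc hf; have [h1 h2 h3 h4] := vc e; have l0 := len_gt0 (m:=G) e.
case: b => /=.
  rewrite (@itg_cat _ (len G e / 2) (len G e) (c e true))//; first by rewrite addrC.
  by apply: intgS hf => //; lra.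
rewrite (@itg_cat _ 0 (len G e / 2) (c e false))//.
by apply: intgS hf => //; lra.
Qed.
Lemma piece_cat c e (f : R -> R) : validcut c -> intg 0 (len G e) f ->
  \sum_(t <- all_pieces) itg (lo c (e, t)) (hi c (e, t)) f = itg 0 (len G e) f.
Proof.
move=> vc hf; rewrite !big_cons big_nil addr0 addrA (half_cat _ vc hf).
rewrite [X in _ + X]addrC (half_cat true vc hf) -itg_cat//; have l0 := len_gt0 (m:=G) e; lra.
Qed.
Lemma pM_tot c u : validcut c -> (forall e, intg 0 (len G e) (fun x => u e x ^+ 2)) -> summ (sq_int u) ->
  summ (pM c u) /\ tot (pM c u) = tot (sq_int u).
Proof.
move=> vc hu; apply: (summ_pair all_pieces_uniq all_piecesP).
  by move=> p; apply: itg_ge0 => x _; exact: sqr_ge0.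
by move=> e; exact: (piece_cat vc (hu e)).
Qed.
Lemma pB_tot c u : validcut c -> (forall e, intg 0 (len G e) (fun x => u e x ^+ 6)) -> summ (six_int u) ->
  summ (pB c u) /\ tot (pB c u) = tot (six_int u).
Proof.
move=> vc hu; apply: (summ_pair all_pieces_uniq all_piecesP).
  by move=> p; apply: itg_ge0 => x _; rewrite exprn_even_ge0.
by move=> e; exact: (piece_cat vc (hu e)).
Qed.
Lemma sys_tot c u g : validcut c -> sobolev u g -> summ (six_int u) ->
  [/\ summ (pM c u) /\ tot (pM c u) = tot (sq_int u), summ (pM c g) /\ tot (pM c g) = tot (sq_int g) &
      summ (pB c u) /\ tot (pB c u) = tot (six_int u)].
Proof.
move=> vc su s6; have [ac _ sm sg] := su; split.
- by apply: pM_tot => // e; exact: sobolev_intgX su.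
- by apply: pM_tot => // e; have [] := ac e.
- by apply: pB_tot => // e; exact: sobolev_intgX su.
Qed.

Definition half_mass u (h : E * bool) : R :=
  itg (if h.2 then len G h.1 / 2 else 0) (if h.2 then len G h.1 else len G h.1 / 2) (fun x => u h.1 x ^+ 2).
Lemma half_mass_ge0 u h : 0 <= half_mass u h.
Proof. by apply: itg_ge0 => x _; exact: sqr_ge0. Qed.
Lemma half_mass_pM c u g e b : validcut c -> sobolev u g -> pM c u (e, (b, false)) + pM c u (e, (b, true)) = half_mass u (e, b).
Proof. by move=> vc su; apply: (half_cat b vc); exact: sobolev_intgX su. Qed.
Lemma half_mass_sq_int u g e : sobolev u g -> half_mass u (e, false) + half_mass u (e, true) = sq_int u e.
Proof.
move=> su; have l0 := len_gt0 (m:=G) e; rewrite /half_mass /= -itg_cat//; [lra|lra|exact: sobolev_intgX su].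
Qed.

(** The cuts are placed away from the ends and from the midpoint, at points where
    u^2 does not exceed its mean on the middle third of the half. *)
Definition goodcut u c := forall e,
  [/\ len G e / 6 <= c e false <= len G e / 3,
      2 * len G e / 3 <= c e true <= 5 * len G e / 6 &
      forall b, u e (c e b) ^+ 2 * (len G e / 6) <= half_mass u (e, b)].
Lemma goodcut_valid u c : goodcut u c -> validcut c.
Proof.
move=> gc e; have l0 := len_gt0 (m:=G) e.
have [/andP[h1 h2] /andP[h3 h4] _] := gc e; split; lra.
Qed.
Lemma goodcut_ex u g : sobolev u g -> exists c, goodcut u c.
Proof.
move=> su.
have H (h : E * bool) : exists x, (if h.2 then 2 * len G h.1 / 3 <= x <= 5 * len G h.1 / 6
    else len G h.1 / 6 <= x <= len G h.1 / 3) /\ u h.1 x ^+ 2 * (len G h.1 / 6) <= half_mass u h.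
  case: h => e b /=; have l0 := len_gt0 (m:=G) e.
  have cu := @sobolev_cts _ _ u g e su; have iu := @sobolev_intgX _ _ u g e 2 su.
  case: b.
  - have ab : 2 * len G e / 3 < 5 * len G e / 6 by lra.
    have cu' : cts (2 * len G e / 3) (5 * len G e / 6) (u e) by apply: cts_sub cu; lra.
    have [x xab hx] := mean_point ab cu'; exists x; split=> //.
    have -> : len G e / 6 = 5 * len G e / 6 - 2 * len G e / 3 by field.
    apply: le_trans hx _; apply: itg_sub_le => //=; [lra|lra|lra|by apply: intgS iu; lra|].
    by move=> z _; exact: sqr_ge0.
  - have ab : len G e / 6 < len G e / 3 by lra.
    have cu' : cts (len G e / 6) (len G e / 3) (u e) by apply: cts_sub cu; lra.
    have [x xab hx] := mean_point ab cu'; exists x; split=> //.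
    have -> : len G e / 6 = len G e / 3 - len G e / 6 by field.
    apply: le_trans hx _; apply: itg_sub_le => //=; [lra|lra|lra|by apply: intgS iu; lra|].
    by move=> z _; exact: sqr_ge0.
have [f hf] := choice H; exists (fun e b => f (e, b)) => e.
have [h1 h2] := hf (e, false); have [h3 h4] := hf (e, true); split=> //.
by case.
Qed.
Lemma goodcut_pz u c e b : goodcut u c -> u e (c e b) ^+ 4 <= 36 / lmin ^+ 2 * half_mass u (e, b) ^+ 2.
Proof.
move=> gc; have [_ _ /(_ b) h] := gc e; have l0 := len_gt0 (m:=G) e.
have h1 : u e (c e b) ^+ 2 <= 6 / lmin * half_mass u (e, b).
  have : u e (c e b) ^+ 2 * (lmin / 6) <= half_mass u (e, b).
    apply: le_trans h; rewrite ler_wpM2l ?sqr_ge0// ler_pM2r ?invr_gt0//.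
  rewrite -ler_pdivlMr ?divr_gt0// => h1; apply: le_trans h1 _.
  by rewrite le_eqVlt; apply/orP; left; apply/eqP; field; rewrite gt_eqF.
have -> : u e (c e b) ^+ 4 = (u e (c e b) ^+ 2) ^+ 2 by ring.
have -> : 36 / lmin ^+ 2 * half_mass u (e, b) ^+ 2 = (6 / lmin * half_mass u (e, b)) ^+ 2 by field; rewrite gt_eqF.
by rewrite ler_pXn2r// ?nnegrE ?sqr_ge0// mulr_ge0 ?half_mass_ge0// divr_ge0// ltW.
Qed.
Lemma half_mass_le u g e b : sobolev u g -> half_mass u (e, b) <= sq_int u e.
Proof.
move=> su; rewrite -(half_mass_sq_int e su); have := half_mass_ge0 u (e, false); have := half_mass_ge0 u (e, true).
by case: b; lra.
Qed.
Lemma half_mass_summ u g k : 0 <= k -> sobolev u g -> summ (fun q : piece => k * half_mass u (q.1, q.2.1)) /\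
  tot (fun q : piece => k * half_mass u (q.1, q.2.1)) = 2 * k * tot (sq_int u).
Proof.
move=> k0 su; have [_ _ sm _] := su.
have k20 : 0 <= 2 * k by rewrite mulr_ge0.
have [s1 <-] := totZ k20 sm.
apply: (summ_pair all_pieces_uniq all_piecesP) => //.
  by move=> p; rewrite mulr_ge0// half_mass_ge0.
by move=> e; rewrite !big_cons big_nil -(half_mass_sq_int e su) /=; ring.
Qed.

(** u^4 at a cut is bounded by the square of the mass of the half edge, and a sum of
    squares of masses by the square of the total mass. *)
Lemma pz_summ u g c : sobolev u g -> goodcut u c -> summ (pz c u) /\
  tot (pz c u) <= 72 / lmin ^+ 2 * tot (sq_int u) ^+ 2.
Proof.
move=> su gc; have [_ _ sm _] := su; have T0 := tot_ge0 sm.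
pose k := 36 / lmin ^+ 2 * tot (sq_int u).
have k0 : 0 <= k by rewrite mulr_ge0// divr_ge0// sqr_ge0.
have [s1 e1] := half_mass_summ k0 su.
have le q : pz c u q <= k * half_mass u (q.1, q.2.1).
  apply: le_trans (goodcut_pz q.1 q.2.1 gc) _.
  rewrite /k -[X in _ <= X]mulrA ler_wpM2l// ?divr_ge0 ?sqr_ge0// expr2 ler_wpM2r ?half_mass_ge0//.
  by apply: le_trans (half_mass_le _ _ su) _; exact: tot_ub1.
split; first by apply: (summ_le _ le s1) => q; rewrite exprn_even_ge0.
apply: le_trans (tot_le le s1) _; rewrite e1 /k le_eqVlt; apply/orP; left; apply/eqP.
by field; rewrite gt_eqF.
Qed.

Lemma pairs_le_tot (S : arms R piece (vtx G + E)) q r : r <> q -> summ (aM S) -> aM S q + aM S r <= tot (aM S).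
Proof.
move=> rq sM; have u2 : uniq [:: q; r] by rewrite /= inE andbT; apply/eqP => e; apply: rq.
by have := tot_ub sM u2; rewrite !big_cons big_nil addr0.
Qed.

(** [spread_arms] for good cuts. *)
Lemma spread_bound eta u g c : 0 < eta -> eta <= mR / 6 -> sobolev u g -> summ (six_int u) -> goodcut u c ->
  tot (sq_int u) <= (1 + 1 / 12) * mR ->
  (forall q r, r <> q -> pcen r = pcen q -> pM c u q + pM c u r <= mR - eta) ->
  tot (six_int u) / 6 <= tot (sq_int g) / 2 + a0 * heavy_const eta * (72 / lmin ^+ 2 * tot (sq_int u) ^+ 2).
Proof.
move=> e0 eR su s6 gc ht hp; have vc := goodcut_valid gc.
have [[s1 t1] [s2 t2] [s3 t3]] := sys_tot vc su s6.
have [s4 t4] := pz_summ su gc.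
rewrite -t1 in ht.
have := @spread_arms _ _ _ (gsys vc su) eta e0 eR s1 s2 s3 s4 ht hp.
rewrite /= t2 t3 => h; apply: le_trans h _; rewrite lerD2l ler_wpM2l//.
rewrite mulr_ge0 ?(ltW (arc_weight_gt0 R))//; apply: tan_ge0.
  have : b0 * eta <= pi / 6 by rewrite -(arc_rate_line R) -mulrA ler_pM2l ?arc_rate_gt0.
  have := @pi_gt0 R; lra.
have : 0 < b0 * eta by rewrite mulr_gt0// arc_rate_gt0.
lra.
Qed.

(** A new cut beyond the old one, on the far side of the piece: the piece grows,
    and u^4 at the new cut is controlled by the product of the masses that lie
    beyond the old and beyond the new cut. *)
Lemma tail_cut u g c e b s : sobolev u g -> goodcut u c ->
  exists y, [/\ (if b then len G e / 2 <= y <= len G e else 0 <= y <= len G e / 2),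
    (forall c', c' e b = y -> pM c u (e, (b, s)) <= pM c' u (e, (b, s))) &
    (forall c', c' e b = y -> u e y ^+ 4 <= 144 / lmin ^+ 2 *
        (pM c u (e, (b, ~~ s)) * pM c' u (e, (b, ~~ s))))].
Proof.
move=> su gc; have l0 := len_gt0 (m:=G) e; have ll := lminP e.
have cu := @sobolev_cts _ _ u g e su; have iu := @sobolev_intgX _ _ u g e 2 su.
have [/andP[h1 h2] /andP[h3 h4] _] := gc e.
have pos z : 0 <= u e z ^+ 2 by exact: sqr_ge0.
have conv y w m1 m2 : lmin / 6 <= w -> 0 <= m1 -> 0 <= m2 -> u e y ^+ 4 * w ^+ 2 <= 4 * m1 * m2 ->
   u e y ^+ 4 <= 144 / lmin ^+ 2 * (m1 * m2).
  move=> hw hm1 hm2 h.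
  have lm6 : 0 <= lmin / 6 by rewrite divr_ge0// ltW.
  have h5 : u e y ^+ 4 * (lmin / 6) ^+ 2 <= 4 * m1 * m2.
    apply: le_trans h; rewrite ler_wpM2l ?exprn_even_ge0//.
    by rewrite ler_pXn2r// nnegrE// (le_trans lm6 hw).
  have -> : 144 / lmin ^+ 2 * (m1 * m2) = (4 * m1 * m2) / (lmin / 6) ^+ 2 by field; rewrite gt_eqF.
  by rewrite ler_pdivlMr// exprn_gt0// divr_gt0.
have m0 (p q : R) : 0 <= itg p q (fun x => u e x ^+ 2) by apply: itg_ge0.
case: b; case: s => /=.
- have w0 : c e true < len G e by lra.
  have [y /andP[y1 y2] hy] := tail_point_r w0 (cts_sub (ltac:(lra) : 0 <= c e true) (lexx _) cu).
  exists y; split; first by apply/andP; split; lra.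
  + by move=> c' hc; rewrite /pM /= hc; apply: itg_sub_le => //; [lra|apply: intgS iu; lra].
  + by move=> c' hc; rewrite /pM /= hc; apply: conv hy => //; lra.
- have w0 : len G e / 2 < c e true by lra.
  have [y /andP[y1 y2] hy] := tail_point_l w0 (cts_sub (ltac:(lra) : 0 <= len G e / 2) (ltac:(lra) : c e true <= len G e) cu).
  exists y; split; first by apply/andP; split; lra.
  + by move=> c' hc; rewrite /pM /= hc; apply: itg_sub_le => //; [lra|apply: intgS iu; lra].
  + by move=> c' hc; rewrite /pM /= hc; apply: conv hy => //; lra.
- have w0 : 0 < c e false by lra.
  have [y /andP[y1 y2] hy] := tail_point_l w0 (cts_sub (lexx _) (ltac:(lra) : c e false <= len G e) cu).
  exists y; split; first by apply/andP; split; lra.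
  + by move=> c' hc; rewrite /pM /= hc; apply: itg_sub_le => //; [lra|apply: intgS iu; lra].
  + by move=> c' hc; rewrite /pM /= hc; apply: conv hy => //; lra.
- have w0 : c e false < len G e / 2 by lra.
  have [y /andP[y1 y2] hy] := tail_point_r w0 (cts_sub (ltac:(lra) : 0 <= c e false) (ltac:(lra) : len G e / 2 <= len G e) cu).
  exists y; split; first by apply/andP; split; lra.
  + by move=> c' hc; rewrite /pM /= hc; apply: itg_sub_le => //; [lra|apply: intgS iu; lra].
  + by move=> c' hc; rewrite /pM /= hc; apply: conv hy => //; lra.
Qed.

Definition conc_const : R :=
  a0 * (72 / lmin ^+ 2 * mR + 4 * (288 / (b0 * lmin ^+ 2) + 144 / lmin ^+ 2 * mR)).

Lemma critical_mass_line_gt0 : 0 < mR.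
Proof. by rewrite -(pmulr_rgt0 _ (arc_rate_gt0 R)) arc_rate_line pi_gt0. Qed.

(** Move the cuts of the two heavy pieces outwards by [tail_cut].  The masses beyond
    the new cuts are then at most the deficit D that enters the tangent as 1 / D,
    and the masses beyond the old ones are at most eta: the product of tangent and
    u^4 is of order eta.  All other pieces have mass at most eta. *)
Lemma concentrated_bound u g c eta q r : sobolev u g -> summ (six_int u) -> goodcut u c ->
  tot (sq_int u) < mR -> 0 < eta -> eta <= mR / 4 ->
  r <> q -> pcen r = pcen q -> mR - eta <= pM c u q + pM c u r ->
  tot (six_int u) / 6 <= tot (sq_int g) / 2 + conc_const * eta.
Proof.
move=> su s6 gc htot eta0 etaR rq cc hqr.
have mm0 := critical_mass_line_gt0; have bb := arc_rate_gt0 R.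
have [_ _ sm _] := su; have T0 := tot_ge0 sm.
have vc := goodcut_valid gc.
have [[s1 t1] _ _] := sys_tot vc su s6.
case: q rq cc hqr => e [b s]; case: r => e' [b' s'] rq cc hqr.
have ss' : s' = s by clear -cc; move: cc => /=; case: s; case: s'.
subst s'.
have hh : (e', b') <> (e, b) by move=> [h1 h2]; apply: rq; rewrite h1 h2.
have [y [y1 y2 y3]] := tail_cut e b s su gc.
have [y' [y1' y2' y3']] := tail_cut e' b' s su gc.
(* only the cuts bounding the two heavy pieces are moved *)
pose c' e1 b1 := if (e1, b1) == (e, b) then y else if (e1, b1) == (e', b') then y' else c e1 b1.
have c'1 : c' e b = y by rewrite /c' eqxx.
have c'2 : c' e' b' = y' by rewrite /c' eqxx; case: eqP.
have c'3 e1 b1 : (e1, b1) <> (e, b) -> (e1, b1) <> (e', b') -> c' e1 b1 = c e1 b1.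
  by move=> h1 h2; rewrite /c'; case: eqP => //; case: eqP.
have vc1 e1 b1 : if b1 then len G e1 / 2 <= c' e1 b1 <= len G e1 else 0 <= c' e1 b1 <= len G e1 / 2.
  have [[-> ->]|n1] := eqVneq (e1, b1) (e, b); first by rewrite c'1.
  have [[-> ->]|n2] := eqVneq (e1, b1) (e', b'); first by rewrite c'2.
  rewrite c'3; [|exact/eqP|exact/eqP].
  by have [h1 h2 h3 h4] := vc e1; case: (b1); apply/andP.
have vc' : validcut c'.
  by move=> e1; have /andP[? ?] := vc1 e1 false; have /andP[? ?] := vc1 e1 true.
have [[s1' t1'] [s2' t2'] [s3' t3']] := sys_tot vc' su s6.
pose q : piece := (e, (b, s)); pose r : piece := (e', (b', s)).
pose oq : piece := (e, (b, ~~ s)); pose or : piece := (e', (b', ~~ s)).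
have rq' : r <> q by [].
have Mq : pM c u q <= pM c' u q by exact: y2.
have Mr : pM c u r <= pM c' u r by exact: y2'.
have p0 c1 p : 0 <= pM c1 u p by apply: itg_ge0 => x _; exact: sqr_ge0.
pose D := mR - (pM c' u q + pM c' u r).
have sum2 := @pairs_le_tot (gsys vc' su) q r rq' s1'.
have D0 : 0 < D by rewrite /D; move: sum2 htot; rewrite /= t1'; clear; lra.
have nb (x : bool) : x <> ~~ x by case: x.
have noq : oq <> q by move=> [h]; apply: (@nb s).
have noq' : oq <> r by move=> [h1 h2 h3]; apply: (@nb s).
have nor : or <> q by move=> [h1 h2 h3]; apply: (@nb s).
have nor' : or <> r by move=> [h]; apply: (@nb s).
have nqr : oq <> or by move=> [h1 h2]; apply: hh; rewrite h1 h2.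
have third (c1 : E -> bool -> R) (vc1' : validcut c1) p : p <> q -> p <> r -> pM c1 u q + pM c1 u r + pM c1 u p <= tot (sq_int u).
  move=> n1 n2; have [[z1 z2] _ _] := sys_tot vc1' su s6.
  have u3 : uniq [:: q; r; p].
    have e1 : q != r by apply/eqP => h; apply: rq'.
    have e2 : q != p by apply/eqP => h; apply: n1.
    have e3 : r != p by apply/eqP => h; apply: n2.
    by rewrite /= !inE !negb_or e1 e2 e3.
  by rewrite -z2; have := tot_ub z1 u3; rewrite !big_cons big_nil addr0 addrA.
have four p1 p2 : p1 <> q -> p1 <> r -> p2 <> q -> p2 <> r -> p1 <> p2 ->
   pM c' u q + pM c' u r + (pM c' u p1 + pM c' u p2) <= tot (sq_int u).
  move=> n1 n2 n3 n4 n5.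
  have u4 : uniq [:: q; r; p1; p2].
    have e1 : q != r by apply/eqP => h; apply: rq'.
    have e2 : q != p1 by apply/eqP => h; apply: n1.
    have e3 : r != p1 by apply/eqP => h; apply: n2.
    have e4 : q != p2 by apply/eqP => h; apply: n3.
    have e5 : r != p2 by apply/eqP => h; apply: n4.
    have e6 : p1 != p2 by apply/eqP.
    by rewrite /= !inE !negb_or e1 e2 e3 e4 e5 e6.
  by rewrite -t1'; have := tot_ub s1' u4; rewrite !big_cons big_nil addr0 !addrA.
have small p : p <> q -> p <> r -> pM c' u p <= eta.
  by move=> n1 n2; move: (third c' vc' p n1 n2) htot hqr Mq Mr; rewrite -/q -/r; clear; lra.
have smallo p : p <> q -> p <> r -> pM c u p <= eta.
  by move=> n1 n2; move: (third c vc p n1 n2) htot hqr; rewrite -/q -/r; clear; lra.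
have gD : pM c' u oq + pM c' u or <= D.
  by move: (four oq or noq noq' nor nor' nqr) htot; rewrite /D; clear; lra.
have l20 : 0 < lmin ^+ 2 by rewrite exprn_gt0.
have k0 : 0 <= 144 / lmin ^+ 2 by rewrite divr_ge0// ltW.
have zb (p : piece) th gg : pz c' u p <= 144 / lmin ^+ 2 * (th * gg) -> 0 <= th -> th <= eta ->
   0 <= gg -> gg <= D -> pz c' u p <= 144 / lmin ^+ 2 * (eta * D).
  move=> h h1 h2 h3 h4; apply: le_trans h _; rewrite ler_wpM2l//.
  apply: (@le_trans _ _ (eta * gg)); first by rewrite ler_wpM2r.
  by rewrite ler_wpM2l// ltW.
have zq : pz c' u q <= 144 / lmin ^+ 2 * (eta * D).
  apply: (zb _ (pM c u oq) (pM c' u oq)) => //.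
  - by rewrite /pz /= c'1; exact: y3.
  - exact: smallo.
  - by move: (p0 c' or) gD; clear; lra.
have zr : pz c' u r <= 144 / lmin ^+ 2 * (eta * D).
  apply: (zb _ (pM c u or) (pM c' u or)) => //.
  - by rewrite /pz /= c'2; exact: y3'.
  - exact: smallo.
  - by move: (p0 c' oq) gD; clear; lra.
have DR : D <= mR by rewrite /D; move: (p0 c' q) (p0 c' r); clear; lra.
pose k2 := 288 / (b0 * lmin ^+ 2) + 144 / lmin ^+ 2 * mR.
have k2a : 0 <= 288 / (b0 * lmin ^+ 2) := (divr_ge0 (ler0n R 288) (mulr_ge0 (ltW bb) (ltW l20))).
have k2b : 0 <= 144 / lmin ^+ 2 * mR by rewrite mulr_ge0// ltW.
have k20 : 0 <= k2 by rewrite addr_ge0.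
have k2e : 0 <= k2 * eta by rewrite mulr_ge0// ltW.
pose k1 := 36 / lmin ^+ 2 * eta.
have k10 : 0 <= k1 by rewrite mulr_ge0// ?divr_ge0// ltW.
have [sh th] := half_mass_summ k10 su.
pose bad : seq piece := [:: q; r; oq; or].
have ubad : uniq bad.
  have e1 : q != r by apply/eqP => h; apply: rq'.
  have e2 : q != oq by apply/eqP => h; apply: noq.
  have e3 : r != oq by apply/eqP => h; apply: noq'.
  have e4 : q != or by apply/eqP => h; apply: nor.
  have e5 : r != or by apply/eqP => h; apply: nor'.
  have e6 : oq != or by apply/eqP.
  by rewrite /= !inE !negb_or e1 e2 e3 e4 e5 e6.
pose v (p : piece) := if p \in bad then k2 * eta else 0.
have [sv tv] : summ v /\ tot v = \sum_(p <- bad) v p.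
  by apply: tot_fin => // p; rewrite /v; [case: ifP|move=> /negbTE ->].
have tv' : tot v = 4 * (k2 * eta).
  by rewrite tv /v /bad !big_cons big_nil !inE !eqxx !orbT /=; ring.
have [sw tw] := totD sh sv.
have hq1 (p : piece) : pz c' u p <= 144 / lmin ^+ 2 * (eta * D) -> p \in bad ->
    2 / (b0 * D) * pz c' u p <= k1 * half_mass u (p.1, p.2.1) + v p.
  move=> hz pb; apply: (@le_trans _ _ (k2 * eta)); last first.
    by rewrite /v pb lerDr mulr_ge0// half_mass_ge0.
  have h2 : 0 <= 2 / (b0 * D) by rewrite divr_ge0// mulr_ge0// ltW.
  apply: le_trans (ler_wpM2l h2 hz) _.
  have -> : 2 / (b0 * D) * (144 / lmin ^+ 2 * (eta * D)) = 288 / (b0 * lmin ^+ 2) * eta.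
    by field; rewrite !gt_eqF.
  by rewrite ler_wpM2r ?(ltW eta0)// /k2 lerDl.
have := @concentrated_arms _ _ _ (gsys vc' su) q r (fun p => k1 * half_mass u (p.1, p.2.1) + v p) rq' cc s1' s2' s3' sw.
have hDm : pM c' u q + pM c' u r < mR by rewrite -subr_gt0.
move=> /(_ hDm).
move=> /(_ (hq1 q zq ltac:(by rewrite !inE eqxx))).
move=> /(_ (hq1 r zr ltac:(by rewrite !inE eqxx orbT))).
rewrite /= t2' t3' tw th tv' => H.
apply: le_trans (H _) _; last first.
  rewrite lerD2l /conc_const -[X in _ <= X]mulrA ler_wpM2l ?(ltW (arc_weight_gt0 R))//.
  have -> : (72 / lmin ^+ 2 * mR + 4 * (288 / (b0 * lmin ^+ 2) + 144 / lmin ^+ 2 * mR)) * eta =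
    72 / lmin ^+ 2 * mR * eta + 4 * (k2 * eta) by rewrite /k2; ring.
  rewrite lerD2r /k1.
  have -> : 2 * (36 / lmin ^+ 2 * eta) * tot (sq_int u) = 72 / lmin ^+ 2 * tot (sq_int u) * eta by ring.
  by rewrite ler_wpM2r ?(ltW eta0)// ler_wpM2l ?divr_ge0// ltW.
move=> p pq pr; split; first exact: le_trans (small p pq pr) etaR.
have [pb|pb] := boolP (p \in bad).
  have h : pz c' u p <= 144 / lmin ^+ 2 * (eta * D).
    move: pb; rewrite !inE => /or4P[] /eqP pe.
    - by case: (pq pe).
    - by case: (pr pe).
    - by rewrite (_ : pz c' u p = pz c' u q)// pe.
    - by rewrite (_ : pz c' u p = pz c' u r)// pe.
  apply: (le_trans h); apply: (@le_trans _ _ (k2 * eta)); last first.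
    by rewrite /v pb lerDr mulr_ge0// half_mass_ge0.
  rewrite [eta * D]mulrC mulrA ler_wpM2r ?(ltW eta0)//.
  apply: (@le_trans _ _ (144 / lmin ^+ 2 * mR)); first by rewrite ler_wpM2l.
  by rewrite /k2 lerDr.
rewrite /v (negbTE pb) addr0.
case: p pq pr pb => e1 [b1 s1x] pq pr pb.
have s1s : s1x = s \/ s1x = ~~ s.
  by clear; case: s1x; case: s; [left|right|right|left].
have n1 : (e1, b1) <> (e, b).
  move=> [h1 h2]; move/negP : pb; apply; rewrite h1 h2 !inE.
  by case: s1s => ->; [rewrite -/q eqxx|rewrite -/oq eqxx !orbT].
have n2 : (e1, b1) <> (e', b').
  move=> [h1 h2]; move/negP : pb; apply; rewrite h1 h2 !inE.
  by case: s1s => ->; [rewrite -/r eqxx !orbT|rewrite -/or eqxx !orbT].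
rewrite /pz /= c'3//; apply: le_trans (goodcut_pz e1 b1 gc) _.
rewrite /k1 -[X in _ <= X]mulrA ler_wpM2l ?divr_ge0 ?(ltW l20)//.
rewrite expr2 ler_wpM2r ?half_mass_ge0//.
rewrite -(half_mass_pM e1 b1 vc' su).
have := four (e1, (b1, false)) (e1, (b1, true)).
have x1 s0 : (e1, (b1, s0)) <> q by move=> [h1 h2 h3]; apply: n1; rewrite h1 h2.
have x2 s0 : (e1, (b1, s0)) <> r by move=> [h1 h2 h3]; apply: n2; rewrite h1 h2.
by move=> /(_ (x1 _) (x2 _) (x1 _) (x2 _) ltac:(by [])); move: htot hqr Mq Mr; rewrite -/q -/r; clear; lra.
Qed.
End GraphArms.

(** * Energy bounds below and at the critical mass of the line *)

Opaque critical_mass_line arc_rate arc_weight.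

Section EnergyBounds.
Local Notation b0 := (arc_rate _).
Local Notation a0 := (arc_weight _).
Local Notation mR := (critical_mass_line _).

Lemma heavy_ge0 (R : realType) (eta : R) : 0 < eta -> eta <= mR / 6 -> 0 <= heavy_const eta.
Proof.
move=> e0 eR; apply: tan_ge0.
  have : b0 * eta <= pi / 6 by rewrite -(arc_rate_line R) -mulrA ler_pM2l ?arc_rate_gt0.
  have := @pi_gt0 R; clear; lra.
have : 0 < b0 * eta by rewrite mulr_gt0// arc_rate_gt0.
clear; lra.
Qed.

(** All pairs of pieces have mass at most m1 < mu_R, so only [spread_bound] is
    needed. *)
Lemma bound_strict (R : realType) (G : metric_graph R) (lmin : R) (lmin0 : 0 < lmin)
  (lminP : forall e, lmin <= len G e) (hterm : forall e : edge G, ~ terminal_edge e) (m1 : R) : m1 < mR -> exists2 C : R, 0 <= C & forall u g : graph_fun G, sobolev u g -> summ (six_int u) ->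
  tot (sq_int u) <= m1 -> tot (six_int u) / 6 <= tot (sq_int g) / 2 + C.
Proof.
move=> m1R; have mm0 := critical_mass_line_gt0 R.
pose eta := Num.min (mR - m1) (mR / 6).
have e0 : 0 < eta by rewrite lt_min subr_gt0 m1R divr_gt0.
have eR : eta <= mR / 6 by rewrite ge_min lexx orbT.
have eR' : eta <= mR - m1 by rewrite ge_min lexx.
exists (a0 * heavy_const eta * (72 / lmin ^+ 2 * m1 ^+ 2)).
  rewrite mulr_ge0//; first by rewrite mulr_ge0 ?heavy_ge0// ltW// arc_weight_gt0.
  by rewrite mulr_ge0 ?sqr_ge0// divr_ge0 ?sqr_ge0.
move=> u g su s6 hm; have [_ _ sm _] := su; have T0 := tot_ge0 sm.
have [c gc] := goodcut_ex su; have vc := goodcut_valid gc.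
have [[s1 t1] _ _] := sys_tot vc su s6.
have := spread_bound lmin0 lminP hterm e0 eR su s6 gc.
have h1 : tot (sq_int u) <= (1 + 1 / 12) * mR by move: hm m1R mm0; clear; lra.
move=> /(_ h1) H; apply: le_trans (H _) _.
  move=> q r rq cc; have := @pairs_le_tot _ _ (gsys hterm vc su) q r rq s1.
  by rewrite /= t1; move: hm eR'; clear; lra.
rewrite lerD2l ler_wpM2l//; first by rewrite mulr_ge0 ?heavy_ge0// ltW// arc_weight_gt0.
rewrite ler_wpM2l ?divr_ge0 ?sqr_ge0// ler_pXn2r// nnegrE//.
exact: le_trans T0 hm.
Qed.

Lemma goodcut_scale (R : realType) (G : metric_graph R) k (u g : graph_fun G) c : sobolev u g -> goodcut u c -> goodcut (gscale k u) c.
Proof.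
move=> su gc e; have [h1 h2 h3] := gc e; split=> // b.
have l0 := len_gt0 (m:=G) e.
have -> : half_mass (gscale k u) (e, b) = k ^+ 2 * half_mass u (e, b).
  rewrite /half_mass /= -itgZ; first by apply: itg_eq => x _; rewrite /gscale exprMn.
  have iu := @sobolev_intgX _ _ u g e 2 su.
  by apply: intgS iu; case: b => //; move: l0; clear; lra.
by rewrite /gscale exprMn -mulrA ler_wpM2l ?sqr_ge0.
Qed.
Lemma pM_scale (R : realType) (G : metric_graph R) k (u g : graph_fun G) c q : validcut c -> sobolev u g -> pM c (gscale k u) q = k ^+ 2 * pM c u q.
Proof.
move=> vc su; rewrite /pM -itgZ; first by apply: itg_eq => x _; rewrite /gscale exprMn.
have [h1 h2 h3] := lohi q vc.
have iu := @sobolev_intgX _ _ u g q.1 2 su.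
exact: intgS iu.
Qed.

Lemma conc_const_ge0 (R : realType) (lmin : R) : 0 < lmin -> 0 <= conc_const lmin.
Proof.
move=> lmin0; have bb := arc_rate_gt0 R; have mm0 := critical_mass_line_gt0 R.
have l20 : 0 < lmin ^+ 2 by rewrite exprn_gt0.
exact: (mulr_ge0 (ltW (arc_weight_gt0 R)) (addr_ge0 (mulr_ge0 (divr_ge0 (ler0n R 72) (ltW l20)) (ltW mm0))
  (mulr_ge0 (ler0n R 4) (addr_ge0 (divr_ge0 (ler0n R 288) (mulr_ge0 (ltW bb) (ltW l20)))
     (mulr_ge0 (divr_ge0 (ler0n R 144) (ltW l20)) (ltW mm0)))))).
Qed.

(** If the mass is spread, [spread_bound] still applies to a multiple of u slightly
    larger than u, and comparing powers of the factor bounds A.  If it is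
    concentrated, apply [concentrated_bound] to multiples slightly smaller than u
    (whose mass is below mu_R): the energy of u would exceed - c0. *)
Lemma bound_critical (R : realType) (G : metric_graph R) (lmin : R) (lmin0 : 0 < lmin)
  (lminP : forall e, lmin <= len G e) (hterm : forall e : edge G, ~ terminal_edge e) (c0 : R) : 0 < c0 -> exists a : R, forall u g : graph_fun G, sobolev u g -> summ (six_int u) ->
  tot (sq_int u) <= mR -> tot (sq_int g) / 2 - tot (six_int u) / 6 <= - c0 -> tot (sq_int g) <= a.
Proof.
move=> c00; have mm0 := critical_mass_line_gt0 R.
pose K := conc_const lmin.
have K0 : 0 <= K := conc_const_ge0 lmin0.
pose eta := Num.min (mR / 8) (c0 / (4 * (K + 1))).
have K1 : 0 < 4 * (K + 1) by rewrite mulr_gt0// ltr_wpDl.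
have e0 : 0 < eta by rewrite lt_min !divr_gt0.
have eR : eta <= mR / 8 by rewrite ge_min lexx.
have eK : 2 * K * eta < c0.
  have h : eta * (4 * (K + 1)) <= c0 by rewrite -ler_pdivlMr// ge_min lexx orbT.
  have : 0 <= K * eta by rewrite mulr_ge0// ltW.
  by move: h e0; clear; lra.
have e20 : 0 < eta / 2 by rewrite divr_gt0.
have e2R : eta / 2 <= mR / 6 by move: eR mm0; clear; lra.
pose kap := eta / (2 * mR).
have kap0 : 0 < kap by rewrite divr_gt0// mulr_gt0.
have kapR : kap * mR = eta / 2 by rewrite /kap; field; rewrite gt_eqF.
have kap1 : kap <= 1 / 12.
  by rewrite -(ler_pM2r mm0) kapR; move: eR mm0; clear; lra.
pose K2 := a0 * heavy_const (eta / 2) * (72 / lmin ^+ 2 * ((1 + 1 / 12) * mR) ^+ 2).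
exists (K2 / kap) => u g su s6 hm hE.
have [_ _ sm sg] := su; have T0 := tot_ge0 sm; have A0 := tot_ge0 sg.
have B0 := tot_ge0 s6.
have [c gc] := goodcut_ex su; have vc := goodcut_valid gc.
have [spread|conc] := pselect (forall q r, r <> q -> pcen r = pcen q -> pM c u q + pM c u r <= mR - eta).
(* the larger multiple: its mass is (1 + kap) m, which uses half of the deficit eta *)
- pose lam := Num.sqrt (1 + kap).
  have lam2 : lam ^+ 2 = 1 + kap by rewrite sqr_sqrtr// addr_ge0// ltW.
  have [slu [tu tg]] := sobolevZ lam su; have [s6' t6] := six_intZ lam su s6.
  have gc' := goodcut_scale lam su gc.
  have ht : tot (sq_int (gscale lam u)) <= (1 + 1 / 12) * mR.
    rewrite tu lam2; apply: ler_pM => //; first by rewrite addr_ge0// ltW.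
    by rewrite lerD2l.
  have := spread_bound lmin0 lminP hterm e20 e2R slu s6' gc' ht.
  have hp : forall q r, r <> q -> pcen r = pcen q ->
     pM c (gscale lam u) q + pM c (gscale lam u) r <= mR - eta / 2.
    move=> q r rq cc; rewrite !(pM_scale lam _ vc su) -mulrDr lam2.
    have h := spread q r rq cc.
    have : (1 + kap) * (pM c u q + pM c u r) <= (1 + kap) * (mR - eta).
      by rewrite ler_wpM2l// addr_ge0// ltW.
    have : 0 <= kap * eta by rewrite mulr_ge0// ltW.
    move: kapR; clear; lra.
  move=> /(_ hp); rewrite t6 tg.
  have hK2 : a0 * heavy_const (eta / 2) * (72 / lmin ^+ 2 * tot (sq_int (gscale lam u)) ^+ 2) <= K2.
    rewrite /K2 ler_wpM2l//; first by rewrite mulr_ge0 ?heavy_ge0// ltW// arc_weight_gt0.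
    rewrite ler_wpM2l ?divr_ge0 ?sqr_ge0// ler_pXn2r// nnegrE//.
      by have [_ _ sml _] := slu; exact: tot_ge0.
    by rewrite mulr_ge0// ltW.
  have -> : lam ^+ 6 = (1 + kap) ^+ 3 by rewrite -lam2; ring.
  rewrite lam2 => h; rewrite ler_pdivlMr//.
  have hB : tot (sq_int g) / 2 <= tot (six_int u) / 6 by move: hE c00; clear; lra.
  have h3 : (1 + kap) ^+ 3 * (tot (sq_int g) / 2) <= (1 + kap) ^+ 3 * (tot (six_int u) / 6).
    by rewrite ler_wpM2l// exprn_ge0// addr_ge0// ltW.
  have h4 : (1 + kap) ^+ 3 * (tot (sq_int g) / 2) - (1 + kap) * tot (sq_int g) / 2 =
     tot (sq_int g) * kap + (3 / 2 * kap ^+ 2 + kap ^+ 3 / 2) * tot (sq_int g) by field.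
  have h5 : 0 <= (3 / 2 * kap ^+ 2 + kap ^+ 3 / 2) * tot (sq_int g).
    have k3 : 0 <= kap ^+ 3 / 2 by rewrite divr_ge0// exprn_ge0// ltW.
    have k2 : 0 <= 3 / 2 * kap ^+ 2 by rewrite mulr_ge0 ?sqr_ge0.
    exact: mulr_ge0 (addr_ge0 k2 k3) A0.
  move: h hK2 h3 h4 h5; clear; lra.
- exfalso.
  have [q [r [rq [cc hqr]]]] : exists q r, r <> q /\ pcen r = pcen q /\ mR - eta < pM c u q + pM c u r.
    apply: contrapT => hn; apply: conc => q r rq cc; rewrite leNgt; apply/negP => h.
    by apply: hn; exists q, r.
  pose gam := tot (six_int u) / 6 - tot (sq_int g) / 2 - 2 * K * eta.
  have gam0 : 0 < gam by rewrite /gam; move: hE eK; clear; lra.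
  (* the smaller multiple: t is so small that the loss 3 t B of the sixth power and
     the loss of mass t mu_R are both absorbed *)
  pose t := Num.min (1 / 2) (Num.min (eta / mR) (gam / (tot (six_int u) + 1))).
  have B1 : 0 < tot (six_int u) + 1 by rewrite ltr_wpDl.
  have t0 : 0 < t by rewrite !lt_min !divr_gt0.
  have t1 : t <= 1 / 2 by rewrite ge_min lexx.
  have t2 : t * mR <= eta by rewrite -ler_pdivlMr// !ge_min lexx !orbT.
  have t3 : t * (tot (six_int u) + 1) <= gam by rewrite -ler_pdivlMr// !ge_min lexx !orbT.
  pose lam := Num.sqrt (1 - t).
  have ti : 0 < 1 - t by move: t1; clear; lra.
  have lam2 : lam ^+ 2 = 1 - t by rewrite sqr_sqrtr// ltW.
  have [slu [tu tg]] := sobolevZ lam su; have [s6' t6] := six_intZ lam su s6.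
  have gc' := goodcut_scale lam su gc.
  have ht : tot (sq_int (gscale lam u)) < mR.
    rewrite tu lam2; apply: (@le_lt_trans _ _ ((1 - t) * mR)); first by rewrite ler_wpM2l// ltW.
    by rewrite gtr_pMl//; move: t0; clear; lra.
  have e40 : 0 < 2 * eta by rewrite mulr_gt0.
  have e4R : 2 * eta <= mR / 4 by move: eR; clear; lra.
  have := concentrated_bound lmin0 lminP hterm slu s6' gc' ht e40 e4R rq cc.
  have hp : mR - 2 * eta <= pM c (gscale lam u) q + pM c (gscale lam u) r.
    rewrite !(pM_scale lam _ vc su) -mulrDr lam2.
    have : (1 - t) * (mR - eta) <= (1 - t) * (pM c u q + pM c u r) by rewrite ler_pM2l// ltW.
    have : 0 <= t * eta by rewrite mulr_ge0// ltW.
    move: t2; clear; lra.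
  move=> /(_ hp); rewrite t6 tg -/K.
  have -> : lam ^+ 6 = (1 - t) ^+ 3 by rewrite -lam2; ring.
  rewrite lam2 => h.
  have h1 : (1 - t) * tot (sq_int g) <= tot (sq_int g) by rewrite ler_piMl//; move: t0; clear; lra.
  have h2 : (1 - 3 * t) * tot (six_int u) <= (1 - t) ^+ 3 * tot (six_int u).
    rewrite ler_wpM2r// -subr_ge0.
    have -> : (1 - t) ^+ 3 - (1 - 3 * t) = t ^+ 2 * (3 - t) by ring.
    by rewrite mulr_ge0 ?sqr_ge0//; move: t1; clear; lra.
  have h3 : 0 <= t * tot (six_int u) by rewrite mulr_ge0// ltW.
  move: h h1 h2 t3 gam0 t0 h3; rewrite /gam; clear; lra.
Qed.
End EnergyBounds.

(** * Cells of a periodic graph *)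

Section Reach.
Variables (R : realType) (K : metric_graph R).

(** Collapsing the interval between p and q to a point shortens distances by at most
    its length. *)
Lemma collapse_interval (p q : R) : exists T : R -> R,
  (forall y z, `|T y - T z| <= `|y - z|) /\ (forall y z, `|y - z| <= `|T y - T z| + `|p - q|) /\
  T p = T q.
Proof.
wlog lh : p q / p <= q.
  move=> W; have [/W//|/ltW/W [T [h1 [h2 h3]]]] := leP p q.
  by exists T; split=> //; split=> // y z; rewrite [`|p - q|]distrC.
rewrite distrC ger0_norm ?subr_ge0//.
exists (fun y => if y <= p then y else if y <= q then p else y - (q - p)).
split; last split.
- move=> y z; wlog yz : y z / y <= z.
    by move=> W; have [/W//|/ltW/W] := leP y z; rewrite distrC [X in _ <= X]distrC.
  rewrite distrC [X in _ <= X]distrC [X in _ <= X]ger0_norm ?subr_ge0//.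
  by rewrite ler_norml; do !case: ifPn; rewrite -?ltNge => *; apply/andP; split; lra.
- move=> y z; wlog yz : y z / y <= z.
    by move=> W; have [/W//|/ltW/W] := leP y z; rewrite distrC [X in _ <= X + _]distrC.
  rewrite distrC [X in _ <= X + _]distrC ger0_norm ?subr_ge0//.
  rewrite -lerBlDr ler_normr; apply/orP; left.
  by do !case: ifPn; rewrite -?ltNge => *; lra.
- by rewrite !lexx; case: ifPn => // h; apply/eqP; rewrite eq_le lh h.
Qed.

Lemma reach_cst (phi : vtx K -> R) : connected_graph K ->
  (forall e, phi (endpoint K e false) = phi (endpoint K e true)) -> forall v w, phi v = phi w.
Proof.
move=> cK h v w; have := cK v w; rewrite /reachable; elim => //.
- by move=> x y [e _ [b [<- <-]]]; case: b => /=; rewrite h.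
- by move=> x y z _ -> _ ->.
Qed.

(** The sharp constant 1 matters: it makes a cell as good as a segment of the same total
    length.  Induct on the edges by collapsing the interval between the two end
    values of one edge, instead of extracting a simple path. *)
Lemma cell_reach (rho : edge K -> R) : connected_graph K ->
  forall (s : seq (edge K)) (phi : vtx K -> R),
  (forall e, e \in s -> `|phi (endpoint K e false) - phi (endpoint K e true)| <= rho e) ->
  (forall e, e \notin s -> phi (endpoint K e false) = phi (endpoint K e true)) ->
  forall v w, `|phi v - phi w| <= \sum_(e <- s) rho e.
Proof.
move=> cK; elim=> [|e s IH] phi h1 h2 v w.
  by rewrite big_nil (reach_cst cK (fun e => h2 e isT) v w) subrr normr0.
have [T [T1 [T2 T3]]] := collapse_interval (phi (endpoint K e false)) (phi (endpoint K e true)).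
rewrite big_cons [X in _ <= X]addrC; apply: le_trans (T2 _ _) _; apply: lerD; last by apply: h1; exact: mem_head.
apply: (IH (T \o phi)) => f fs /=.
  by apply: le_trans (T1 _ _) _; apply: h1; rewrite in_cons fs orbT.
have [-> //|fe] := eqVneq f e.
by rewrite h2// in_cons negb_or fe.
Qed.
End Reach.

Section Periodic.
Variables (R : realType) (P : periodicity_data R).
Let K := cell P.
Local Notation G := (periodic_graph P).
Implicit Types (u g : graph_fun G) (i j : int).

Lemma cell_edges : exists es : seq (edge K), uniq es /\ forall e, e \in es.
Proof.
have [_ /finite_seqP [s hs]] := cell_compact P.
exists (undup s); rewrite undup_uniq; split=> // e; rewrite mem_undup.
by have : [set: edge K] e by []; rewrite hs.
Qed.
Definition es : seq (edge K) := sval (cid cell_edges).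
Lemma es_uniq : uniq es. Proof. by have [] := svalP (cid cell_edges). Qed.
Lemma es_all e : e \in es. Proof. by have [_] := svalP (cid cell_edges); exact. Qed.
Definition dv : vtx K := sval (cid (pasteD_neq0 P)).
Lemma dvP : pasteD dv. Proof. exact: svalP (cid (pasteD_neq0 P)). Qed.
Lemma pasteR_img d : pasteD d -> pasteR (paste (p:=P) d).
Proof. by have [h _ _] := paste_bij P; exact: h. Qed.
Lemma dv_neq : dv <> paste (p:=P) dv.
Proof.
move=> h; have : (@pasteD _ P `&` @pasteR _ P) dv by split; [exact: dvP|rewrite h; exact: pasteR_img dvP].
by rewrite paste_disj.
Qed.

(** A connected cell has at least two vertices, because the two pasted sets are
    disjoint and nonempty. *)
Lemma vertex_end (v : vtx K) : exists h : edge K * bool, endpoint K h.1 h.2 = v.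
Proof.
have H (x y : vtx K) : reachable setT x y -> x = y \/ exists h : edge K * bool, endpoint K h.1 h.2 = x.
  elim=> [a b [e _ [c [<- _]]]|a|a b c _ [->|h1] _ h2]; [by right; exists (e, c)|by left|exact: h2|by right].
have [w vw] : exists w, v <> w.
  by have [->|h] := pselect (v = dv); [exists (paste (p:=P) dv); exact: dv_neq|exists dv].
by have [//|] := H v w (cell_connected v w).
Qed.
Definition vend v := sval (cid (vertex_end v)).
Lemma vendP v : endpoint K (vend v).1 (vend v).2 = v. Proof. exact: svalP (cid (vertex_end v)). Qed.

Definition vertex_value u (i : int) (v : vtx K) : R := end_value u ((i, (vend v).1) : edge G, (vend v).2).
Lemma vertex_valueE u i e b : glued u -> end_value u ((i, e) : edge G, b) = vertex_value u i (endpoint K e b).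
Proof. by move=> gl; apply: gl; rewrite /= /periodic_endpoint /= vendP. Qed.
Lemma vertex_value_paste u i d : glued u -> pasteD d -> vertex_value u i d = vertex_value u (i + 1) (paste (p:=P) d).
Proof.
move=> gl hd; apply: gl; rewrite /= /periodic_endpoint /= !vendP.
by apply/eqmodP/asboolP/rst_step.
Qed.

(** Values prescribed on the copies of the cell descend to the quotient. *)
Lemma glue_intro (W : int -> vtx K -> R) u : (forall i d, pasteD d -> W i d = W (i + 1) (paste (p:=P) d)) ->
  (forall i e b, end_value u ((i, e) : edge G, b) = W i (endpoint K e b)) -> glued u.
Proof.
move=> hW hu [[i e] b] [[j f] c] /=; rewrite /periodic_endpoint /= => h.
have {h} /eqmodP/asboolP h := h.
rewrite !hu.
have H (x y : int * vtx K) : clos_refl_sym_trans _ (@paste_step _ P) x y -> W x.1 x.2 = W y.1 y.2.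
  elim=> [a b' [hd ->]|//|a b' _ -> //|a b' c' _ -> _ -> //]; exact: hW.
exact: (H _ _ h).
Qed.

Definition gshift (k : int) u : graph_fun G := fun e => u (e.1 + k, e.2).
Lemma sobolev_shift k u g : sobolev u g -> [/\ sobolev (gshift k u) (gshift k g),
  tot (sq_int (gshift k u)) = tot (sq_int u) & tot (sq_int (gshift k g)) = tot (sq_int g)].
Proof.
move=> [ac gl su sg].
pose phi (e : int * edge K) := (e.1 + k, e.2); pose psi (e : int * edge K) := (e.1 - k, e.2).
have k1 : cancel phi psi by move=> [i e]; rewrite /phi /psi /= addrK.
have k2 : cancel psi phi by move=> [i e]; rewrite /phi /psi /= subrK.
have [s1 t1] := tot_reindex k1 k2 su; have [s2 t2] := tot_reindex k1 k2 sg.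
split; [split; [by move=> [i e]; exact: (ac (i + k, e))| |exact: s1|exact: s2]|exact: t1|exact: t2].
apply: (@glue_intro (fun i v => vertex_value u (i + k) v)).
- by move=> i d hd; rewrite (vertex_value_paste _ gl hd) addrAC.
- by move=> i e b; rewrite -vertex_valueE.
Qed.
Lemma six_shift k u : summ (six_int u) -> summ (six_int (gshift k u)) /\ tot (six_int (gshift k u)) = tot (six_int u).
Proof.
move=> su.
pose phi (e : int * edge K) := (e.1 + k, e.2); pose psi (e : int * edge K) := (e.1 - k, e.2).
have k1 : cancel phi psi by move=> [i e]; rewrite /phi /psi /= addrK.
have k2 : cancel psi phi by move=> [i e]; rewrite /phi /psi /= subrK.
exact: tot_reindex k1 k2 su.
Qed.

Definition lmin : R := \big[Num.min/1]_(e <- es) len K e.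
Lemma lmin_gt0 : 0 < lmin.
Proof.
by rewrite /lmin; elim/big_rec: _ => // e x _ x0; rewrite lt_min x0 andbT; exact: len_gt0.
Qed.
Lemma lmin_le (e : edge G) : lmin <= len G e.
Proof.
rewrite /= /lmin; have := es_all e.2; elim: es => // a s IH.
rewrite in_cons big_cons ge_min => /orP[/eqP <-|/IH ->]; rewrite ?lexx ?orbT//.
Qed.
Definition Ltot : R := \sum_(e <- es) len K e.
Lemma len_le (e : edge K) : len K e <= Ltot.
Proof.
rewrite /Ltot (bigD1_seq e) ?es_uniq ?es_all//= lerDl; apply: sumr_ge0 => f _.
exact/ltW/len_gt0.
Qed.
Lemma Ltot_gt0 : 0 < Ltot.
Proof. by apply: lt_le_trans (len_gt0 (vend dv).1) (len_le _). Qed.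

Definition csum (F : edge G -> R) i : R := \sum_(e <- es) F (i, e).
Lemma csum_summ (F : edge G -> R) : summ F -> summ (csum F) /\ tot (csum F) = tot F.
Proof. move=> sF; exact: (tot_pair es_uniq es_all sF). Qed.
Lemma csum_ub (F : edge G -> R) i e : (forall p, 0 <= F p) -> F (i, e) <= csum F i.
Proof.
move=> F0; rewrite /csum (bigD1_seq e) ?es_uniq ?es_all//= lerDl; exact: sumr_ge0.
Qed.

Lemma tot_ub_nat (f : int -> R) i N : summ f -> \sum_(0 <= n < N) f (i + n%:Z) <= tot f.
Proof.
move=> sf; rewrite -(big_map (fun n : nat => i + n%:Z) predT f); apply: tot_ub => //.
rewrite map_inj_uniq ?iota_uniq// => a b /addrI []; exact.
Qed.
Lemma summ_small (f : int -> R) (eps : R) i : summ f -> 0 < eps -> exists n : nat, f (i + n%:Z) < eps.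
Proof.
move=> sf e0; apply: contrapT => hn.
have h n : eps <= f (i + n%:Z) by rewrite leNgt; apply/negP => h; apply: hn; exists n.
have T0 := tot_ge0 sf; pose N := Num.bound (tot f / eps).
have hN : tot f / eps < N%:R by apply: archi_boundP; rewrite divr_ge0// ltW.
have := tot_ub_nat i N sf; apply/negP; rewrite -ltNge.
apply: (@lt_le_trans _ _ (\sum_(0 <= n < N) eps)); last exact: ler_sum.
by rewrite sumr_const_nat subn0 -mulr_natl -ltr_pdivrMr.
Qed.

(** c is small somewhere far away, because f is summable. *)
Lemma telescope_inf (c X f : int -> R) i : summ X -> summ f -> (forall j, `|c (j + 1) - c j| <= X (j + 1)) ->
  (forall j, c j <= f j) -> c i <= tot X.
Proof.
move=> sX sf hc hf.
have H n : c i <= c (i + n%:Z) + \sum_(0 <= k < n) X (i + 1 + k%:Z).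
  elim: n => [|n IH]; first by rewrite big_nil !addr0.
  rewrite big_nat_recr//=; apply: le_trans IH _.
  have := hc (i + n%:Z); rewrite distrC => /(le_trans (ler_norm _)).
  have -> : i + n%:Z + 1 = i + n.+1%:Z by rewrite -addn1 PoszD addrA.
  have -> : i + 1 + n%:Z = i + n.+1%:Z by rewrite -addn1 PoszD addrA addrAC.
  lra.
apply/ler_addgt0Pr => e e0; have [n hn] := summ_small i sf e0.
by have := H n; have := tot_ub_nat (i + 1) n sX; have := hf (i + n%:Z); lra.
Qed.

Definition edge_cross u g (e : edge G) : R := cross (len G e) (u e) (g e).
Lemma edge_cross_ge0 u g e : 0 <= edge_cross u g e. Proof. exact: cross_ge0. Qed.
Lemma edge_cross_tot u g (t : R) : sobolev u g -> 0 < t ->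
  summ (edge_cross u g) /\ tot (edge_cross u g) <= t * tot (sq_int u) + t^-1 * tot (sq_int g).
Proof.
move=> [ac gl su sg] t0; have t1 : 0 < t^-1 by rewrite invr_gt0.
have [s1 t2] := totZ (ltW t0) su; have [s2 t3] := totZ (ltW t1) sg.
have [s3 t4] := totD s1 s2; rewrite -t2 -t3 -t4.
have h e : edge_cross u g e <= t * sq_int u e + t^-1 * sq_int g e by apply: cross_le.
by split; [exact: summ_le (edge_cross_ge0 u g) h s3|exact: tot_le].
Qed.
Lemma cell_sq u g i v w : sobolev u g -> `|vertex_value u i v ^+ 2 - vertex_value u i w ^+ 2| <= csum (edge_cross u g) i.
Proof.
move=> [ac gl _ _]; have H := @cell_reach _ K (fun e => edge_cross u g (i, e)) (@cell_connected _ P) es (fun v => vertex_value u i v ^+ 2).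
rewrite /csum; apply: H.
- move=> e _; rewrite -!vertex_valueE// /end_value /=; apply: sq_diff; first exact: ac.
    by rewrite lexx ltW ?len_gt0.
  by rewrite lexx ltW ?len_gt0.
- by move=> e; rewrite es_all.
Qed.

(** Follow the copies of the pasted vertex [dv] towards infinity, where u^2 becomes
    small; the increments of u^2 are bounded by its variation on the cells passed. *)
Lemma sup_le u g i e x : sobolev u g -> 0 <= x <= len K e -> u (i, e) x ^+ 2 <= 3 * tot (edge_cross u g).
Proof.
move=> su xl; have [sX _] := edge_cross_tot su ltr01; have [sC tC] := csum_summ sX.
have [ac gl sm sg] := su.
have c1 j : vertex_value u j dv ^+ 2 <= lmin^-1 * csum (sq_int u) j + csum (edge_cross u g) j.
  rewrite /vertex_value; set f := (vend dv).1.
  have h : forall y, 0 <= y <= len K f -> u (j, f) y ^+ 2 <= lmin^-1 * csum (sq_int u) j + csum (edge_cross u g) j.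
    move=> y hy; apply: le_trans (loc_sup (len_gt0 f) (ac (j, f)) hy) _.
    apply: lerD; last exact: (csum_ub _ _ (edge_cross_ge0 u g)).
    apply: ler_pM => //; first by rewrite invr_ge0 ltW ?len_gt0.
    - exact: (@sq_int_ge0 _ G u (j, f)).
    - by rewrite lef_pV2 ?posrE ?lmin_gt0 ?len_gt0//; exact: (lmin_le (j, f)).
    - exact: (csum_ub _ _ (sq_int_ge0 u)).
  by rewrite /end_value /=; apply: h; case: ifP; rewrite lexx ltW ?len_gt0.
have [sM _] := csum_summ sm.
have li : 0 <= lmin^-1 by rewrite invr_ge0 ltW// lmin_gt0.
have [s1 _] := totZ li sM.
have [s2 _] := totD s1 sC.
have H := @telescope_inf (fun j => vertex_value u j dv ^+ 2) _ _ i sC s2 _ c1.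
have {}H : vertex_value u i dv ^+ 2 <= tot (edge_cross u g).
  rewrite -tC; apply: H => j; rewrite [in X in `|_ - X|](vertex_value_paste _ gl dvP); exact: cell_sq.
have h1 := cell_sq i (endpoint K e false) dv su.
have h2 := sq_diff (ac (i, e)) xl (_ : 0 <= 0 <= len K e).
rewrite lexx ltW ?len_gt0// in h2; have {}h2 := h2 isT.
have h3 : u (i, e) 0 = vertex_value u i (endpoint K e false) by rewrite -vertex_valueE.
rewrite h3 in h2.
have := le_trans (ler_norm _) h1; have := le_trans (ler_norm _) h2.
have := csum_ub i e (edge_cross_ge0 u g); have := tot_ub1 i sC; rewrite tC /edge_cross /=.
move: H; clear; lra.
Qed.
Lemma sup_bound u g i e x (t : R) : sobolev u g -> 0 < t -> 0 <= x <= len K e ->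
  u (i, e) x ^+ 2 <= 3 * (t * tot (sq_int u) + t^-1 * tot (sq_int g)).
Proof.
move=> su t0 xl; apply: le_trans (sup_le i su xl) _; rewrite ler_pM2l//.
by have [] := edge_cross_tot su t0.
Qed.
Lemma six_le_sup u g (M : R) : sobolev u g -> (forall i e x, 0 <= x <= len K e -> u (i, e) x ^+ 2 <= M) ->
  summ (six_int u) /\ tot (six_int u) <= M ^+ 2 * tot (sq_int u).
Proof.
move=> su h; have [_ _ sm _] := su; have [s1 t1] := totZ (sqr_ge0 M) sm.
have H e : six_int u e <= M ^+ 2 * sq_int u e.
  case: e => i e; rewrite /six_int /sq_int -itgZ; last exact: sobolev_intgX su.
  apply: itg_le; [exact: sobolev_intgX su|by apply: intgZ; exact: sobolev_intgX su|].
  move=> x hx; have -> : u (i, e) x ^+ 6 = (u (i, e) x ^+ 2) ^+ 2 * u (i, e) x ^+ 2 by ring.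
  by rewrite ler_wpM2r ?sqr_ge0// ler_pXn2r ?nnegrE ?sqr_ge0 ?(le_trans _ (h i e x hx)) ?sqr_ge0//; exact: h.
by rewrite -t1; split; [exact: summ_le (six_int_ge0 u) H s1|exact: tot_le].
Qed.
Lemma six_summ u g : sobolev u g -> summ (six_int u).
Proof.
by move=> su; have [] := six_le_sup su (fun i e x h => sup_bound i su ltr01 h).
Qed.

(** Optimize t in [sup_bound]. *)
Lemma rough_GN u g : sobolev u g -> tot (six_int u) <= 36 * tot (sq_int u) ^+ 2 * tot (sq_int g).
Proof.
move=> su; have [_ _ sm sg] := su; have m0 := tot_ge0 sm; have A0 := tot_ge0 sg.
have H t : 0 < t -> tot (six_int u) <= (3 * (t * tot (sq_int u) + t^-1 * tot (sq_int g))) ^+ 2 * tot (sq_int u).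
  by move=> t0; have [_ ] := six_le_sup su (fun i e x h => sup_bound i su t0 h).
have [m1|m1] := eqVneq (tot (sq_int u)) 0.
  by have := H 1 ltr01; rewrite m1 expr0n /= !mulr0 mul0r.
have {}m1 : 0 < tot (sq_int u) by rewrite lt_def m1.
have [A1|A1] := eqVneq (tot (sq_int g)) 0.
  rewrite A1 mulr0; apply/ler_addgt0Pr => e e0; rewrite add0r.
  pose t := Num.min 1 (e / (9 * tot (sq_int u) ^+ 3)).
  have c0 : 0 < 9 * tot (sq_int u) ^+ 3 by rewrite mulr_gt0// exprn_gt0.
  have t0 : 0 < t by rewrite lt_min ltr01 divr_gt0.
  apply: le_trans (H t t0) _; rewrite A1 mulr0 addr0.
  have t1 : t * (9 * tot (sq_int u) ^+ 3) <= e by rewrite -ler_pdivlMr// ge_min lexx orbT.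
  have t2 : t <= 1 by rewrite ge_min lexx.
  have -> : (3 * (t * tot (sq_int u))) ^+ 2 * tot (sq_int u) = t * (t * (9 * tot (sq_int u) ^+ 3)) by ring.
  apply: le_trans t1; rewrite ger_pMl//; exact: mulr_gt0.
have {}A1 : 0 < tot (sq_int g) by rewrite lt_def A1.
pose t := Num.sqrt (tot (sq_int g) / tot (sq_int u)).
have t0 : 0 < t by rewrite sqrtr_gt0 divr_gt0.
have t2 : t ^+ 2 * tot (sq_int u) = tot (sq_int g) by rewrite sqr_sqrtr ?divr_ge0// divfK// gt_eqF.
have -> : 36 * tot (sq_int u) ^+ 2 * tot (sq_int g) = (3 * (t * tot (sq_int u) + t^-1 * tot (sq_int g))) ^+ 2 * tot (sq_int u).
  by rewrite -t2; field; rewrite gt_eqF.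
exact: H.
Qed.
End Periodic.

(** * Functions of small derivative *)

Section Line.
Local Notation b0 := (arc_rate _).
Local Notation a0 := (arc_weight _).
Local Notation mR := (critical_mass_line _).
Variables (R : realType) (L : R).
Hypothesis L0 : 0 < L.
Implicit Types a b x : R.

(** The segment of length L that replaces a cell. *)
Definition lin a b x : R := a + (b - a) / L * x.
Definition linm a b : R := itg 0 L (fun x => lin a b x ^+ 2).
Definition linb a b : R := itg 0 L (fun x => lin a b x ^+ 6).
Lemma lin_prim a b : prim 0 L (lin a b) (fun=> (b - a) / L).
Proof.
split; first exact: intg_cst.
by move=> x y _ xy _; rewrite itg_cst// /lin; ring.
Qed.
Lemma lin_intg a b n : intg 0 L (fun x => lin a b x ^+ n).
Proof. by apply: cts_intg; apply: ctsX; exact: prim_cts (lin_prim a b). Qed.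
Lemma lin_arc a b (D pa pb : R) : (b - a) ^+ 2 <= L * D ->
  - (pi / 2) < pa < pi / 2 -> pb < pi / 2 -> b0 * linm a b <= pa + pb ->
  linb a b / 6 <= D / 2 + a0 * (tan pa * a ^+ 4 + tan pb * b ^+ 4).
Proof.
move=> hD hpa hpb hm.
have := arc_ineq (ltW L0) (lin_prim a b) (intg_cst _ _ _) hpa hpb hm.
have -> : lin a b 0 = a by rewrite /lin mulr0 addr0.
have -> : lin a b L = b by rewrite /lin divfK ?gt_eqF//; ring.
rewrite (@itg_cst _ 0 L _ (ltW L0)) subr0 => h; apply: le_trans h _; rewrite lerD2r ler_pM2r ?invr_gt0//.
have -> : ((b - a) / L) ^+ 2 * L = (b - a) ^+ 2 / L by field; rewrite gt_eqF.
by rewrite ler_pdivrMr// mulrC.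
Qed.
Lemma lin_bnd a b (M x : R) : 0 <= x <= L -> `|a| <= M -> `|b| <= M -> `|lin a b x| <= M.
Proof.
move=> /andP[x0 xL] ha hb.
have -> : lin a b x = (1 - x / L) * a + (x / L) * b by rewrite /lin; field; rewrite gt_eqF.
have t0 : 0 <= x / L by rewrite divr_ge0// ltW.
have t1 : x / L <= 1 by rewrite ler_pdivrMr// mul1r.
apply: le_trans (ler_normD _ _) _; rewrite (normrM (1 - x / L)) (normrM (x / L)) (ger0_norm t0) ger0_norm ?subr_ge0//.
have h1 : x / L * `|b| <= x / L * M by rewrite ler_wpM2l.
have h2 : (1 - x / L) * `|a| <= (1 - x / L) * M by rewrite ler_wpM2l// subr_ge0.
by move: h1 h2; clear; lra.
Qed.
Lemma linm_ge0 a b : 0 <= linm a b.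
Proof. by apply: itg_ge0 => x _; exact: sqr_ge0. Qed.
Lemma linb_ge0 a b : 0 <= linb a b.
Proof. by apply: itg_ge0 => x _; rewrite exprn_even_ge0. Qed.
Lemma lin_scale k a b x : lin (k * a) (k * b) x = k * lin a b x.
Proof. by rewrite /lin -mulrBr; ring. Qed.
Lemma linm_scale k a b : linm (k * a) (k * b) = k ^+ 2 * linm a b.
Proof. by rewrite /linm -itgZ ?lin_intg//; apply: itg_eq => x _; rewrite lin_scale exprMn. Qed.
Lemma linb_scale k a b : linb (k * a) (k * b) = k ^+ 6 * linb a b.
Proof. by rewrite /linb -itgZ ?lin_intg//; apply: itg_eq => x _; rewrite lin_scale exprMn. Qed.

(** The calibration along the chain of segments: consecutive boundary terms cancel, the
    angle runs from - f0 to f0 < pi/2, and the two outermost terms tend to 0. *)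
Lemma line_ineq (c D : int -> R) : (forall i, (c i - c (i - 1)) ^+ 2 <= L * D i) -> summ D ->
  summ (fun i => linm (c (i - 1)) (c i)) -> tot (fun i => linm (c (i - 1)) (c i)) < mR ->
  summ (fun i => c i ^+ 4) ->
  summ (fun i => linb (c (i - 1)) (c i)) /\ tot (fun i => linb (c (i - 1)) (c i)) <= 3 * tot D.
Proof.
move=> hD sD sm hm s4.
set M := tot _ in hm; have M0 : 0 <= M by exact: tot_ge0.
pose f0 := b0 * M / 2; have bb := arc_rate_gt0 R.
have f00 : 0 <= f0 by rewrite divr_ge0// mulr_ge0// ltW.
have f01 : f0 < pi / 2.
  by rewrite ltr_pM2r ?invr_gt0// -(arc_rate_line R) ltr_pM2l.
have pi0 := @pi_gt0 R.
have hf : 2 * f0 = b0 * M by rewrite /f0; field.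
pose w i n := \sum_(0 <= k < n) linm (c (i + 1 + k%:Z - 1)) (c (i + 1 + k%:Z)).
have w0 i n : 0 <= w i n by apply: sumr_ge0 => k _; exact: linm_ge0.
have wM i n : w i n <= M by exact: (tot_ub_nat (i + 1) n sm).
have step i n : \sum_(0 <= k < n) linb (c (i + 1 + k%:Z - 1)) (c (i + 1 + k%:Z)) / 6 <=
   \sum_(0 <= k < n) D (i + 1 + k%:Z) / 2 +
   a0 * (tan f0 * c i ^+ 4 + tan (b0 * w i n - f0) * c (i + n%:Z) ^+ 4).
  elim: n => [|n IH].
    by rewrite /w !big_nil mulr0 sub0r addr0 add0r tanN mulNr subrr mulr0.
  rewrite !big_nat_recr//=.
  have e1 : i + 1 + n%:Z - 1 = i + n%:Z by rewrite addrAC addrK.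
  have e2 : i + 1 + n%:Z = i + n.+1%:Z by rewrite -addn1 PoszD addrA addrAC.
  have hw : w i n.+1 = w i n + linm (c (i + 1 + n%:Z - 1)) (c (i + 1 + n%:Z)).
    by rewrite /w big_nat_recr.
  have bw0 : 0 <= b0 * w i n by rewrite mulr_ge0// ltW.
  have bw1 : b0 * w i n <= 2 * f0 by rewrite hf ler_pM2l.
  have bw2 : b0 * w i n.+1 <= 2 * f0 by rewrite hf ler_pM2l.
  have h1 : - (pi / 2) < f0 - b0 * w i n < pi / 2.
    by apply/andP; split; move: bw0 bw1 f01 f00; clear; lra.
  have h2 : b0 * w i n.+1 - f0 < pi / 2 by move: bw2 f01 f00; clear; lra.
  have h3 : b0 * linm (c (i + 1 + n%:Z - 1)) (c (i + 1 + n%:Z)) <= f0 - b0 * w i n + (b0 * w i n.+1 - f0).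
    by rewrite hw; clear; lra.
  have := lin_arc (hD (i + 1 + n%:Z)) h1 h2 h3.
  have -> : tan (f0 - b0 * w i n) = - tan (b0 * w i n - f0) by rewrite -tanN opprB.
  rewrite e1 e2; move: IH; clear; lra.
have T0 : 0 <= tan f0 by exact: tan_ge0.
have key i n : \sum_(0 <= k < n) linb (c (i + 1 + k%:Z - 1)) (c (i + 1 + k%:Z)) <=
   3 * tot D + 6 * a0 * tan f0 * (c i ^+ 4 + c (i + n%:Z) ^+ 4).
  have := step i n; rewrite -!mulr_suml.
  have := tot_ub_nat (i + 1) n sD.
  have h : tan (b0 * w i n - f0) <= tan f0.
    have bw0 : 0 <= b0 * w i n by rewrite mulr_ge0// ltW.
    have bw1 : b0 * w i n <= 2 * f0 by rewrite hf ler_pM2l.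
    by apply: tan_le; move: bw0 bw1 f01 f00; clear; lra.
  have h' : tan (b0 * w i n - f0) * c (i + n%:Z) ^+ 4 <= tan f0 * c (i + n%:Z) ^+ 4.
    by rewrite ler_wpM2r// exprn_even_ge0.
  have : a0 * (tan f0 * c i ^+ 4 + tan (b0 * w i n - f0) * c (i + n%:Z) ^+ 4) <=
     a0 * (tan f0 * c i ^+ 4 + tan f0 * c (i + n%:Z) ^+ 4).
    by rewrite ler_pM2l ?arc_weight_gt0// lerD2l.
  clear; lra.
have main s : uniq s -> \sum_(i <- s) linb (c (i - 1)) (c i) <= 3 * tot D.
  move=> us; apply/ler_addgt0Pr => e e0.
  pose Q := 6 * a0 * tan f0.
  have Q0 : 0 <= Q by rewrite /Q mulr_ge0// mulr_ge0// ltW// arc_weight_gt0.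
  have eQ : 0 < e / (2 * (Q + 1)) by rewrite divr_gt0// mulr_gt0// ltr_wpDl.
  have [N hN] : exists N : nat, forall i, i \in s -> (`|i| <= N)%N.
    exists (\max_(i <- s) `|i|)%N => i si; exact: leq_bigmax_seq.
  have sneg : summ (fun i => c (- i) ^+ 4).
    by have [] := @tot_reindex _ _ _ _ (@GRing.opp int) (@GRing.opp int) (@opprK _) (@opprK _) s4.
  have [n1 h1] := summ_small N s4 eQ.
  have [n2 h2] := summ_small (N.+1) sneg eQ.
  pose i0 : int := - (N.+1%:Z + n2%:Z).
  pose n := (N.+1 + n2 + N + n1)%N.
  have en : i0 + n%:Z = N%:Z + n1%:Z by rewrite /i0 /n !PoszD; ring.
  have := key i0 n; rewrite en.
  have hs : \sum_(i <- s) linb (c (i - 1)) (c i) <= \sum_(0 <= k < n) linb (c (i0 + 1 + k%:Z - 1)) (c (i0 + 1 + k%:Z)).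
    rewrite -(big_map (fun k : nat => i0 + 1 + k%:Z) predT (fun i => linb (c (i - 1)) (c i))).
    apply: sum_sub => //.
    - by move=> i; exact: linb_ge0.
    - by rewrite map_inj_uniq ?iota_uniq// => a b /addrI [].
    - move=> i /hN hi; apply/mapP; exists `|(i - i0 - 1)%R|%N.
        by rewrite mem_iota; move: hi; rewrite /i0 /n; clear; lia.
      by move: hi; rewrite /i0; clear; lia.
  have hQ : Q * (c i0 ^+ 4 + c (N%:Z + n1%:Z) ^+ 4) <= e.
    have : Q * (c i0 ^+ 4 + c (N%:Z + n1%:Z) ^+ 4) <= Q * (2 * (e / (2 * (Q + 1)))).
      rewrite ler_wpM2l//; move: h1 h2; rewrite -/i0; clear; lra.
    move=> /le_trans; apply.
    have -> : Q * (2 * (e / (2 * (Q + 1)))) = (Q * e) / (Q + 1) by field; rewrite gt_eqF// ltr_wpDl.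
    rewrite ler_pdivrMr ?ltr_wpDl//; move: e0; clear; lra.
  move: hs hQ; rewrite -/Q; clear; lra.
have s6 : summ (fun i => linb (c (i - 1)) (c i)).
  by apply: (summI _ main) => i; exact: linb_ge0.
by split=> //; exact: tot_lub.
Qed.
End Line.

Section Vanishing.
Local Notation mR := (critical_mass_line _).
Variables (R : realType) (P : periodicity_data R).
Let K := cell P.
Local Notation G := (periodic_graph P).
Implicit Types (u g : graph_fun G) (i j : int).
Local Notation L := (Ltot P).
Local Notation es := (es P).

Lemma seq_CS (T : eqType) (s : seq T) (r l a : T -> R) : (forall e, 0 <= r e) -> (forall e, 0 <= l e) ->
  (forall e, 0 <= a e) -> (forall e, r e ^+ 2 <= l e * a e) ->
  (\sum_(e <- s) r e) ^+ 2 <= (\sum_(e <- s) l e) * (\sum_(e <- s) a e).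
Proof.
move=> r0 l0 a0' h; elim: s => [|e s IH]; first by rewrite !big_nil expr0n mul0r.
rewrite !big_cons; move: IH; set r' := \sum_(i <- s) r i; set l' := \sum_(i <- s) l i; set a' := \sum_(i <- s) a i => IH.
have r'0 : 0 <= r' by exact: sumr_ge0.
have l'0 : 0 <= l' by exact: sumr_ge0.
have a'0 : 0 <= a' by exact: sumr_ge0.
have : 2 * (r e * r') <= l e * a' + l' * a e.
  rewrite -(@ler_pXn2r _ 2) ?nnegrE// ?mulr_ge0 ?addr_ge0 ?mulr_ge0//.
  have h1 : r e ^+ 2 * r' ^+ 2 <= (l e * a e) * (l' * a') by rewrite ler_pM ?sqr_ge0.
  have := sqr_ge0 (l e * a' - l' * a e); move: h1; clear; nra.
have := h e; move: IH; clear; nra.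
Qed.

(** Two vertices of a cell are at most as far apart as the ends of a segment whose
    length is the total length of the cell. *)
Lemma cell_incr u g i v w : sobolev u g -> (vertex_value u i v - vertex_value u i w) ^+ 2 <= L * csum (sq_int g) i.
Proof.
move=> [ac gl _ _].
pose rho e := `|vertex_value u i (endpoint K e false) - vertex_value u i (endpoint K e true)|.
have H := @cell_reach _ K rho (@cell_connected _ P) es (vertex_value u i).
have {}H : `|vertex_value u i v - vertex_value u i w| <= \sum_(e <- es) rho e.
  by apply: H => // e; rewrite es_all.
rewrite -(real_normK (num_real _)); apply: le_trans (_ : (\sum_(e <- es) rho e) ^+ 2 <= _).
  by rewrite ler_pXn2r ?nnegrE ?sumr_ge0// => e _; exact: normr_ge0.
apply: seq_CS => e; [exact: normr_ge0|exact/ltW/len_gt0|exact: sq_int_ge0|].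
rewrite real_normK ?num_real// -sqrrN opprB -!vertex_valueE// /end_value /=.
have [p ig] := ac (i, e).
by have := cauchy_increment (ltW (len_gt0 e)) p ig; rewrite subr0.
Qed.

(** Bounds the oscillation of u on the i-th cell. *)
Definition osc g i : R := 2 * Num.sqrt (L * csum (sq_int g) i).
Lemma csum_ge0 (F : edge G -> R) i : (forall p, 0 <= F p) -> 0 <= csum F i.
Proof. by move=> F0; apply: sumr_ge0. Qed.
Lemma osc_ge0 g i : 0 <= osc g i. Proof. by rewrite mulr_ge0// sqrtr_ge0. Qed.
Lemma osc_sq g i : osc g i ^+ 2 = 4 * (L * csum (sq_int g) i).
Proof.
rewrite exprMn sqr_sqrtr ?mulr_ge0 ?(ltW (Ltot_gt0 P)) ?csum_ge0//; last by move=> p; exact: sq_int_ge0.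
by congr (_ * _); ring.
Qed.
Lemma sqrt_abs (x y : R) : 0 <= y -> x ^+ 2 <= y -> `|x| <= Num.sqrt y.
Proof. by move=> y0 h; rewrite -sqrtr_sqr ler_sqrt. Qed.
Lemma vertex_osc u g i v w : sobolev u g -> `|vertex_value u i v - vertex_value u i w| <= osc g i / 2.
Proof.
move=> su; rewrite /osc mulrC mulKf//; apply: sqrt_abs; last exact: cell_incr.
by rewrite mulr_ge0 ?(ltW (Ltot_gt0 P)) ?csum_ge0// => p; exact: sq_int_ge0.
Qed.
Lemma edge_osc u g i e x v : sobolev u g -> 0 <= x <= len K e -> `|u (i, e) x - vertex_value u i v| <= osc g i.
Proof.
move=> su hx; have [ac gl _ _] := su; have := vertex_osc i (endpoint K e false) v su.
have [p ig] := ac (i, e); have /andP[x0 xl] := hx.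
have p' := prim_sub (lexx 0) xl p; have ig' := intgS (lexx 0) xl ig.
have h := cauchy_increment x0 p' ig'; rewrite subr0 in h.
have h1 : `|u (i, e) x - u (i, e) 0| <= osc g i / 2.
  rewrite /osc mulrC mulKf//; apply: sqrt_abs; first by rewrite mulr_ge0 ?(ltW (Ltot_gt0 P)) ?csum_ge0// => q; exact: sq_int_ge0.
  apply: le_trans h _; apply: ler_pM => //; first by apply: itg_ge0 => y _; exact: sqr_ge0.
    by apply: le_trans xl _; exact: len_le.
  apply: le_trans (csum_ub i e (sq_int_ge0 g)).
  by apply: itg_sub_le => // y _; exact: sqr_ge0.
have -> : vertex_value u i (endpoint K e false) = u (i, e) 0 by rewrite -vertex_valueE.
move=> h2; have := ler_normD (u (i, e) x - u (i, e) 0) (u (i, e) 0 - vertex_value u i v).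
rewrite addrA subrK; move: h1 h2; clear; lra.
Qed.
Lemma pow_near n (y c M o : R) : `|y| <= M -> `|c| <= M -> `|y - c| <= o ->
  `|y ^+ n.+1 - c ^+ n.+1| <= n.+1%:R * M ^+ n * o.
Proof.
move=> hy hc ho; have M0 : 0 <= M by exact: le_trans (normr_ge0 _) hy.
rewrite subrXX normrM mulrC; apply: ler_pM => //.
apply: le_trans (ler_norm_sum _ _ _) _.
apply: le_trans (_ : \sum_(i < n.+1) M ^+ n <= _); last by rewrite sumr_const card_ord mulr_natl.
apply: ler_sum => i _; rewrite normrM !normrX.
have -> : M ^+ n = M ^+ (n.+1.-1 - i) * M ^+ i by rewrite -exprD subnK// -ltnS ltn_ord.
by apply: ler_pM; rewrite ?exprn_ge0// lerXn2r ?nnegrE.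
Qed.
Lemma itg_near (l k E : R) f : 0 <= l -> intg 0 l f -> (forall x, 0 <= x <= l -> `|f x - k| <= E) ->
  `|itg 0 l f - l * k| <= E * l.
Proof.
move=> l0 i1 h.
have ik : itg 0 l (fun=> k) = l * k by rewrite itg_cst// subr0 mulrC.
have iE : itg 0 l (fun=> E) = E * l by rewrite itg_cst// subr0.
have i2 : intg 0 l (fun x => f x - k) by apply: intgB => //; exact: intg_cst.
rewrite -ik -itgB ?intg_cst// -iE; apply: le_trans (itg_abs i2) _.
by apply: itg_le => //; [exact: intg_abs|exact: intg_cst].
Qed.
Lemma cell_near n u g i (c o M : R) : sobolev u g ->
  (forall e x, 0 <= x <= len K e -> `|u (i, e) x - c| <= o) -> M = `|c| + o -> 0 <= o ->
  `|\sum_(e <- es) itg 0 (len K e) (fun x => u (i, e) x ^+ n.+1) - L * c ^+ n.+1| <= n.+1%:R * M ^+ n * o * L.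
Proof.
move=> su hu hM o0; rewrite /L mulr_suml -sumrB mulr_sumr.
apply: le_trans (ler_norm_sum _ _ _) _; apply: ler_sum => e _.
have l0 := ltW (len_gt0 e).
have i1 := @sobolev_intgX _ _ u g (i, e) n.+1 su.
apply: itg_near => // x hx; have h := hu e x hx; apply: pow_near => //; last by rewrite hM lerDl.
by rewrite hM; have := ler_normD (u (i, e) x - c) c; rewrite subrK; move: h; clear; lra.
Qed.
Lemma lin_near n (a b o M : R) : `|b - a| <= o -> M = `|b| + o ->
  `|itg 0 L (fun x => lin L a b x ^+ n.+1) - L * b ^+ n.+1| <= n.+1%:R * M ^+ n * o * L.
Proof.
move=> hu hM; have l0 := Ltot_gt0 P; have o0 : 0 <= o by apply: le_trans hu.
have i1 := lin_intg L a b n.+1.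
apply: itg_near (ltW l0) i1 _ => x hx; have ha : `|a| <= M.
    by rewrite hM; have := ler_normB b (b - a); rewrite opprB addrC subrK; move: hu; clear; lra.
  have hb : `|b| <= M by rewrite hM lerDl.
  apply: pow_near => //; first exact: lin_bnd.
  have -> : lin L a b x - b = lin L (a - b) 0 x by rewrite /lin; field; rewrite gt_eqF.
  by apply: lin_bnd => //; rewrite ?normr0// distrC.
Qed.

Lemma small_param (x K1 K2 e1 e2 : R) : 0 <= K1 -> 0 <= K2 -> 0 < e1 -> 0 < e2 ->
  exists2 d : R, 0 < d <= 1 & d * K1 <= e1 /\ d * K2 <= e2.
Proof.
move=> k1 k2 e10 e20.
have a1 : 0 < K1 + 1 by rewrite ltr_wpDl.
have a2 : 0 < K2 + 1 by rewrite ltr_wpDl.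
exists (Num.min 1 (Num.min (e1 / (K1 + 1)) (e2 / (K2 + 1)))).
  by rewrite !lt_min ltr01 !divr_gt0//= ge_min lexx.
set d := Num.min _ _; have d0 : 0 < d by rewrite !lt_min ltr01 !divr_gt0.
have h1 : d * (K1 + 1) <= e1 by rewrite -ler_pdivlMr// !ge_min lexx !orbT.
have h2 : d * (K2 + 1) <= e2 by rewrite -ler_pdivlMr// !ge_min lexx !orbT.
split; [move: h1|move: h2]; move: d0; clear; lra.
Qed.

(** Replace each cell by a segment on which u is linear between the values at
    consecutive copies of [dv].  Mass and sixth power change by terms of the form
    (|c| + o) o and (|c| + o)^5 o, where o is the oscillation on the cell; both
    are small compared with the mass and with A, as o^2 is of order A and the
    supremum of u^4 is of order A.  The room between m1 and mu_R is used by
    applying [line_ineq] to a multiple of u. *)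
Lemma vanishing (m1 : R) : m1 < mR -> exists2 kap : R, kap < 1 & exists2 a1 : R, 0 < a1 &
  forall u g, sobolev u g -> tot (sq_int u) <= m1 -> tot (sq_int g) <= a1 -> tot (six_int u) <= 3 * kap * tot (sq_int g).
Proof.
wlog m10 : m1 / 0 <= m1.
  move=> W m1R; have [h|h] := leP 0 m1; first exact: W.
  exists 0; first exact: ltr01.
  exists 1; first exact: ltr01.
  move=> u g [_ _ sm _] hm.
  by have := lt_le_trans h (tot_ge0 sm); rewrite ltNge hm.
move=> m1R; have l0 := Ltot_gt0 P; set l := L in l0 *.
pose m2 := (m1 + mR) / 2; have m20 : 0 < m2 by rewrite divr_gt0// ltr_wpDl// (le_lt_trans m10).
(* any factor q > 1 with q m2 < mu_R would do *)
pose q := (mR / m2 + 1) / 2.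
have m2R : m2 < mR by rewrite /m2; move: m1R; clear; lra.
have q1 : 1 < q by have : 1 < mR / m2 by [rewrite ltr_pdivlMr// mul1r]; rewrite /q; clear; lra.
have q0 : 0 < q by exact: lt_trans q1.
have qm : q * m2 < mR.
  have -> : q * m2 = (mR + m2) / 2 by rewrite /q; field; rewrite gt_eqF.
  by move: m2R; clear; lra.
have qi : q ^- 2 < 1 by rewrite invf_lt1 ?exprn_gt0// expr2 -[1]mulr1 ltr_pM.
pose kap := (1 + q ^- 2) / 2.
pose S0 := 6 * (m1 + 1) + 8 * l.
have S00 : 0 <= S0 by rewrite addr_ge0// mulr_ge0 ?addr_ge0// ltW.
have [d /andP[d0 d1] [hd1 hd2]] := @small_param 0 (4 * m1 + 88 * l ^+ 2) (12 * S0 ^+ 2 * (m1 + 22 * l ^+ 2)) (m2 - m1) (3 * (kap - q ^- 2))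
  (addr_ge0 (mulr_ge0 (ler0n R 4) m10) (mulr_ge0 (ler0n R 88) (sqr_ge0 l)))
  (mulr_ge0 (mulr_ge0 (ler0n R 12) (sqr_ge0 S0)) (addr_ge0 m10 (mulr_ge0 (ler0n R 22) (sqr_ge0 l))))
  ltac:(rewrite /m2; move: m1R; clear; lra) ltac:(rewrite /kap; move: qi; clear; lra).
exists kap; first by rewrite /kap; move: qi; clear; lra.
exists (d ^+ 2); first exact: exprn_gt0.
move=> u g su hm hA; have [ac gl sm sg] := su; have s6 := six_summ su.
have A0 := tot_ge0 sg; have M0 := tot_ge0 sm.
have [Az|An] := eqVneq (tot (sq_int g)) 0.
  by have := rough_GN su; rewrite Az !mulr0.
have {An} A1 : 0 < tot (sq_int g) by rewrite lt_def An.
set A := tot (sq_int g) in A0 A1 hA *; set m := tot (sq_int u) in M0 hm.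
have [sW tW] := csum_summ sm; have [sD tD] := csum_summ sg; have [sB tB] := csum_summ s6.
pose W := csum (sq_int u); pose D := csum (sq_int g); pose B := csum (six_int u).
pose c i := vertex_value u i (dv P); pose o i := osc g i; pose M i := `|c i| + o i.
have o0 i : 0 <= o i := osc_ge0 g i.
have M0' i : 0 <= M i by rewrite addr_ge0.
have W0 i : 0 <= W i := sW.1 i.
have D0 i : 0 <= D i := sD.1 i.
have osq i : o i ^+ 2 = 4 * (l * D i) := osc_sq g i.
have near i e x : 0 <= x <= len K e -> `|u (i, e) x - c i| <= o i by move=> h; apply: edge_osc su h.
have cl i : `|c i - c (i - 1)| <= o i.
  have -> : c (i - 1) = vertex_value u i (paste (p:=P) (dv P)) by rewrite /c (vertex_value_paste _ gl (dvP P)) subrK.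
  by apply: le_trans (vertex_osc i _ _ su) _; have := o0 i; rewrite /o; clear; lra.
have Wlow i : l * c i ^+ 2 <= W i + 2 * M i * o i * l.
  have := cell_near 1 su (near i) erefl (o0 i).
  have -> : \sum_(e <- es) itg 0 (len K e) (fun x : R => u (i, e) x ^+ 2) = W i by [].
  rewrite expr1 -/(M i) -/l ler_norml => /andP[h _]; move: h; clear; lra.
have Blow i : B i <= l * c i ^+ 6 + 6 * M i ^+ 5 * o i * l.
  have := cell_near 5 su (near i) erefl (o0 i).
  have -> : \sum_(e <- es) itg 0 (len K e) (fun x : R => u (i, e) x ^+ 6) = B i by [].
  rewrite -/(M i) -/l ler_norml => /andP[_ h]; move: h; clear; lra.
have mup i : linm l (c (i - 1)) (c i) <= l * c i ^+ 2 + 2 * M i * o i * l.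
  have := @lin_near 1 (c (i - 1)) (c i) (o i) (M i) (cl i) erefl; rewrite expr1 -/l.
  by rewrite ler_norml => /andP[_ h]; move: h; rewrite /linm; clear; lra.
have bup i : l * c i ^+ 6 <= linb l (c (i - 1)) (c i) + 6 * M i ^+ 5 * o i * l.
  have := @lin_near 5 (c (i - 1)) (c i) (o i) (M i) (cl i) erefl; rewrite -/l.
  by rewrite ler_norml => /andP[h _]; move: h; rewrite /linb; clear; lra.
have cW i : l * c i ^+ 2 <= 2 * W i + 32 * l ^+ 2 * D i.
  have h := Wlow i; have h2 : M i * o i <= c i ^+ 2 / 4 + 2 * o i ^+ 2.
    rewrite /M mulrDl -expr2 -(real_normK (num_real (c i))).
    have := sqr_ge0 (`|c i| / 2 - o i); clear; nra.
  have h3 : (M i * o i) * l <= (c i ^+ 2 / 4 + 2 * o i ^+ 2) * l by rewrite ler_pM2r.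
  move: h3 h; rewrite osq; clear; lra.
have MoW i : M i * o i * l <= d * W i + 22 * l ^+ 2 / d * D i.
  have h2 : M i * o i <= d / 2 * c i ^+ 2 + (1 / (2 * d) + 1) * o i ^+ 2.
    rewrite /M mulrDl -(real_normK (num_real (c i))) -subr_ge0.
    have -> : d / 2 * `|c i| ^+ 2 + (1 / (2 * d) + 1) * o i ^+ 2 - (`|c i| * o i + o i * o i) =
      (2 * d)^-1 * (d * `|c i| - o i) ^+ 2 by field; rewrite gt_eqF.
    by rewrite mulr_ge0 ?sqr_ge0// invr_ge0 mulr_ge0// ltW.
  have h3 : (M i * o i) * l <= (d / 2 * c i ^+ 2 + (1 / (2 * d) + 1) * o i ^+ 2) * l by rewrite ler_pM2r.
  apply: le_trans h3 _; rewrite osq.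
  have h4 : d / 2 * (l * c i ^+ 2) <= d / 2 * (2 * W i + 32 * l ^+ 2 * D i) by rewrite ler_wpM2l// divr_ge0// ltW.
  have -> : (d / 2 * c i ^+ 2 + (1 / (2 * d) + 1) * (4 * (l * D i))) * l = d / 2 * (l * c i ^+ 2) + (2 / d + 4) * (l ^+ 2 * D i).
    by field; rewrite gt_eqF.
  have P0 : 0 <= l ^+ 2 * D i by rewrite mulr_ge0 ?sqr_ge0.
  have h5 : 16 * d + (2 / d + 4) <= 22 / d.
    rewrite -(ler_pM2r d0) mulrDl [(2 / d + 4) * d]mulrDl !divfK ?gt_eqF//.
    move: d0 d1; clear; nra.
  have h6 : (16 * d + (2 / d + 4)) * (l ^+ 2 * D i) <= 22 / d * (l ^+ 2 * D i) by rewrite ler_wpM2r.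
  have -> : 22 * l ^+ 2 / d * D i = 22 / d * (l ^+ 2 * D i) by field; rewrite gt_eqF.
  move: h4 h6; clear; lra.
pose t := Num.sqrt A; have t0 : 0 < t by rewrite sqrtr_gt0.
have tA : t ^+ 2 = A by rewrite sqr_sqrtr.
have td : t <= d by rewrite -ler_sqr ?nnegrE ?(ltW t0) ?(ltW d0)// tA.
have t1 : t <= 1 by exact: le_trans d1.
have MS i : M i ^+ 2 <= S0 * t.
  have h1 : c i ^+ 2 <= 3 * (t * m + t^-1 * A).
    rewrite /c /vertex_value /end_value; apply: sup_bound => //.
    by case: ifP => _ /=; rewrite lexx ltW ?len_gt0.
  have h2 : t^-1 * A = t by rewrite -tA expr2 mulKf// gt_eqF.
  have h3 : M i ^+ 2 <= 2 * c i ^+ 2 + 2 * o i ^+ 2.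
    rewrite /M -(real_normK (num_real (c i))); have := sqr_ge0 (`|c i| - o i); clear; nra.
  have h4 : D i <= A by rewrite /A -tD; exact: tot_ub1.
  have h5 : l * D i <= l * (t * t) by rewrite ler_pM2l// -expr2 tA.
  have h6 : l * (t * t) <= l * t by rewrite ler_pM2l// ger_pMl.
  have h7 : t * m <= t * m1 by rewrite ler_pM2l.
  move: h1 h3 h5 h6 h7; rewrite h2 osq /S0; clear; nra.
have mL i : linm l (c (i - 1)) (c i) <= (1 + 4 * d) * W i + 88 * l ^+ 2 / d * D i.
  have := mup i; have := Wlow i; have := MoW i.
  have -> : 88 * l ^+ 2 / d * D i = 4 * (22 * l ^+ 2 / d * D i) by ring.
  clear; lra.
have BL i : B i <= linb l (c (i - 1)) (c i) + (12 * S0 ^+ 2 * A * d) * W i + (12 * S0 ^+ 2 * A * (22 * l ^+ 2 / d)) * D i.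
  have h1 : M i ^+ 4 <= S0 ^+ 2 * A.
    have -> : M i ^+ 4 = (M i ^+ 2) ^+ 2 by ring.
    have -> : S0 ^+ 2 * A = (S0 * t) ^+ 2 by rewrite exprMn tA.
    by rewrite ler_pXn2r ?nnegrE ?sqr_ge0// mulr_ge0// ltW.
  have h2 : M i ^+ 4 * (M i * o i * l) <= S0 ^+ 2 * A * (d * W i + 22 * l ^+ 2 / d * D i).
    by apply: ler_pM => //; [rewrite exprn_ge0|rewrite !mulr_ge0// ltW].
  have := Blow i; have := bup i; move: h2.
  have -> : 6 * M i ^+ 5 * o i * l = 6 * (M i ^+ 4 * (M i * o i * l)) by ring.
  clear; lra.
have k88 : 0 <= 88 * l ^+ 2 / d by rewrite divr_ge0 ?(ltW d0)// mulr_ge0 ?sqr_ge0.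
have k22 : 0 <= 22 * l ^+ 2 / d by rewrite divr_ge0 ?(ltW d0)// mulr_ge0 ?sqr_ge0.
have k4 : 0 <= 1 + 4 * d by rewrite addr_ge0// mulr_ge0// ltW.
have [s1 e1] := totZ k4 sW; have [s2 e2] := totZ k88 sD; have [s3 e3] := totD s1 s2.
have sL : summ (fun i => linm l (c (i - 1)) (c i)).
  by apply: (summ_le _ mL s3) => i; exact: linm_ge0.
have dA : d^-1 * A <= d by rewrite ler_pdivrMl// -expr2.
have tL : tot (fun i => linm l (c (i - 1)) (c i)) <= m2.
  apply: le_trans (tot_le mL s3) _; rewrite e3 e1 e2 tW tD -/m -/A.
  have h1 : l ^+ 2 * (d^-1 * A) <= l ^+ 2 * d by rewrite ler_wpM2l// sqr_ge0.
  have h2 : d * m <= d * m1 by rewrite ler_pM2l.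
  have -> : 88 * l ^+ 2 / d * A = 88 * (l ^+ 2 * (d^-1 * A)) by ring.
  move: h1 h2 hd1 hm; clear; lra.
have s4 : summ (fun i => c i ^+ 4).
  have cs i : c i ^+ 4 <= (S0 * t / l) * (2 * W i + 32 * l ^+ 2 * D i).
    have h1 : c i ^+ 2 <= S0 * t.
      apply: le_trans (MS i); rewrite -(real_normK (num_real (c i))) ler_pXn2r ?nnegrE// lerDl//.
    have -> : c i ^+ 4 = (c i ^+ 2 / l) * (l * c i ^+ 2) by field; rewrite gt_eqF.
    apply: ler_pM => //.
    - by rewrite divr_ge0 ?sqr_ge0// ltW.
    - by rewrite mulr_ge0 ?sqr_ge0// ltW.
    - by rewrite ler_pM2r ?invr_gt0.
  have k32 : 0 <= 32 * l ^+ 2 by rewrite mulr_ge0 ?sqr_ge0.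
  have kS : 0 <= S0 * t / l by rewrite divr_ge0 ?mulr_ge0// ltW.
  have [z1 _] := totZ (ler0n R 2) sW; have [z2 _] := totZ k32 sD.
  have [z3 _] := totD z1 z2; have [z4 _] := totZ kS z3.
  by apply: summ_le cs z4 => i; rewrite exprn_even_ge0.
pose lam := Num.sqrt q; have lq : lam ^+ 2 = q by rewrite sqr_sqrtr// ltW.
have [sl1 tl1] := totZ (ltW q0) sL.
have [sd1 td1] := totZ (ltW q0) sD.
have := @line_ineq R l l0 (fun i => lam * c i) (fun i => q * D i).
have em i : linm l (lam * c (i - 1)) (lam * c i) = q * linm l (c (i - 1)) (c i) by rewrite linm_scale// lq.
have eb i : linb l (lam * c (i - 1)) (lam * c i) = q ^+ 3 * linb l (c (i - 1)) (c i).
  by rewrite linb_scale// -lq; ring.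
have -> : (fun i => linm l (lam * c (i - 1)) (lam * c i)) = (fun i => q * linm l (c (i - 1)) (c i)) by apply/funext.
have -> : (fun i => linb l (lam * c (i - 1)) (lam * c i)) = (fun i => q ^+ 3 * linb l (c (i - 1)) (c i)) by apply/funext.
move=> H; have [] := H.
- move=> i; rewrite -mulrBr exprMn lq [l * _]mulrCA ler_pM2l//.
  have -> : c (i - 1) = vertex_value u i (paste (p:=P) (dv P)) by rewrite /c (vertex_value_paste _ gl (dvP P)) subrK.
  exact: cell_incr.
- exact: sd1.
- exact: sl1.
- by rewrite tl1; apply: le_lt_trans qm; rewrite ler_pM2l.
- have [z _] := totZ (exprn_even_ge0 lam (isT : ~~ odd 4)) s4.
  by apply: summ_le z => i; rewrite ?exprn_even_ge0// exprMn.
move=> sb tb; have q30 : 0 <= q ^- 3 by rewrite invr_ge0 exprn_ge0// ltW.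
have [sb' tb'] := totZ q30 sb.
have el i : q ^- 3 * (q ^+ 3 * linb l (c (i - 1)) (c i)) = linb l (c (i - 1)) (c i).
  by rewrite mulKf// expf_neq0// gt_eqF.
have sb2 : summ (fun i => linb l (c (i - 1)) (c i)) by apply: summ_le sb' => i; rewrite ?el// linb_ge0.
have tb2 : tot (fun i => linb l (c (i - 1)) (c i)) <= 3 * q ^- 2 * A.
  rewrite -(eq_tot el) tb'; apply: le_trans (ler_wpM2l q30 tb) _.
  by rewrite td1 tD -/A le_eqVlt; apply/orP; left; apply/eqP; field; rewrite gt_eqF.
have k1 : 0 <= 12 * S0 ^+ 2 * A * d by rewrite !mulr_ge0 ?sqr_ge0// ltW.
have k2 : 0 <= 12 * S0 ^+ 2 * A * (22 * l ^+ 2 / d) by rewrite mulr_ge0// !mulr_ge0 ?sqr_ge0// ltW.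
have [y1 f1] := totZ k1 sW; have [y2 f2] := totZ k2 sD.
have [y3 f3] := totD sb2 y1; have [y4 f4] := totD y3 y2.
rewrite -tB; apply: le_trans (tot_le BL y4) _.
rewrite f4 f3 f1 f2 tW tD -/m -/A.
have c12 : 0 <= 12 * S0 ^+ 2 * A by rewrite !mulr_ge0 ?sqr_ge0.
have h1 : 12 * S0 ^+ 2 * A * (d * m + 22 * (l ^+ 2 * (d^-1 * A))) <= 12 * S0 ^+ 2 * A * (d * m1 + 22 * (l ^+ 2 * d)).
  have x1 : d * m <= d * m1 by rewrite ler_pM2l.
  have x2 : l ^+ 2 * (d^-1 * A) <= l ^+ 2 * d by rewrite ler_wpM2l// sqr_ge0.
  by rewrite ler_wpM2l//; move: x1 x2; clear; lra.
have h2 : d * (12 * S0 ^+ 2 * (m1 + 22 * l ^+ 2)) * A <= 3 * (kap - q ^- 2) * A by rewrite ler_wpM2r.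
have -> : 12 * S0 ^+ 2 * A * d * m = 12 * S0 ^+ 2 * A * (d * m) by ring.
have -> : 12 * S0 ^+ 2 * A * (22 * l ^+ 2 / d) * A = 12 * S0 ^+ 2 * A * (22 * (l ^+ 2 * (d^-1 * A))) by ring.
move: h1 h2 tb2; clear; lra.
Qed.
End Vanishing.

(** * Compactness up to translation *)

(** Distinguish whether |b| is at most d |x|. *)
Lemma pow6_split (R : realType) (x b d : R) : 0 < d <= 1 -> (x + b) ^+ 6 <= (1 + 63 * d) * x ^+ 6 + (1 + d^-1) ^+ 6 * b ^+ 6.
Proof.
move=> /andP[d0 d1].
have ev (y : R) : y ^+ 6 = `|y| ^+ 6 by rewrite -normrX ger0_norm// exprn_even_ge0.
have x6 : 0 <= `|x| ^+ 6 by rewrite exprn_ge0.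
have b6 : 0 <= `|b| ^+ 6 by rewrite exprn_ge0.
have di : 0 <= d^-1 by rewrite invr_ge0 ltW.
rewrite (ev (x + b)) (ev x) (ev b); apply: le_trans (_ : (`|x| + `|b|) ^+ 6 <= _).
  by rewrite lerXn2r ?nnegrE ?addr_ge0// ler_normD.
have [h|h] := leP `|b| (d * `|x|).
- apply: le_trans (_ : ((1 + d) * `|x|) ^+ 6 <= _).
    by rewrite lerXn2r ?nnegrE ?addr_ge0 ?mulr_ge0 ?addr_ge0 ?(ltW d0)// mulrDl mul1r lerD2l.
  rewrite exprMn -[X in X <= _]addr0; apply: lerD; last by rewrite mulr_ge0// exprn_ge0// addr_ge0.
  rewrite ler_wpM2r//.
  have p n : d ^+ n.+1 <= d by rewrite exprS ler_piMr ?(ltW d0)// exprn_ile1// ltW.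
  have := p 1%N; have := p 2%N; have := p 3%N; have := p 4%N; have := p 5%N.
  have -> : (1 + d) ^+ 6 = 1 + 6 * d + 15 * d ^+ 2 + 20 * d ^+ 3 + 15 * d ^+ 4 + 6 * d ^+ 5 + d ^+ 6 by ring.
  clear; lra.
- apply: le_trans (_ : ((1 + d^-1) * `|b|) ^+ 6 <= _).
    rewrite lerXn2r ?nnegrE ?addr_ge0 ?mulr_ge0 ?addr_ge0//.
    rewrite mulrDl mul1r addrC lerD2l// ler_pdivlMl//; exact: ltW.
  rewrite exprMn lerDr mulr_ge0// addr_ge0// mulr_ge0// ltW//.
Qed.

Lemma quad_bound (R : realType) (t q q1 p r b : R) : 0 < t -> q1 = (1 + t) * q + (t ^+ 2 + t) * p - t * r ->
  0 <= r -> q <= b -> q1 <= (1 + t) * b + (t ^+ 2 + t) * p.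
Proof.
move=> t0 -> r0 qb; have h1 : 0 <= t * r by rewrite mulr_ge0// ltW.
have h2 : (1 + t) * q <= (1 + t) * b by rewrite ler_wpM2l// addr_ge0// ltW.
move: h1 h2; clear; lra.
Qed.

(** If r exceeds q - p by eps, the term - t r makes q1 drop below (t + 1)^2 p, for
    p >= 0. *)
Lemma quad_drop (R : realType) (t q q1 p r b eps : R) : 0 < t -> q1 = (1 + t) * q + (t ^+ 2 + t) * p - t * r ->
  t * eps = b + 1 -> q - p + eps < r -> q <= b -> q1 <= (t ^+ 2 + 2 * t) * p - 1.
Proof.
move=> t0 -> te h qb; have h1 : t * (q - p + eps) < t * r by rewrite ltr_pM2l.
rewrite mulrDr te in h1; move: h1 qb; clear; lra.
Qed.

Section Limits.
Variables (R : realType) (P : periodicity_data R) (U : set_system nat).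
Context {PU : ProperFilter U}.
Local Notation K := (cell P).
Local Notation G := (periodic_graph P).
Implicit Types (u g w k : graph_fun G) (i : int).

(** Upper bounds for the limit superior along U, without assuming convergence. *)
Definition ule (a : nat -> R) (c : R) := forall eps, 0 < eps -> U [set n | a n <= c + eps].
Lemma ule_cst a c : (forall n, a n <= c) -> ule a c.
Proof. by move=> h eps e0; apply: filterS (filterT) => n _ /=; have := h n; lra. Qed.
Lemma uleD a b c d : ule a c -> ule b d -> ule (fun n => a n + b n) (c + d).
Proof.
move=> h1 h2 eps e0; have e2 : 0 < eps / 2 by rewrite divr_gt0.
by apply: filterS2 (h1 _ e2) (h2 _ e2) => n /=; lra.
Qed.
Lemma ule_sum (T : Type) (s : seq T) (f : T -> nat -> R) (F : T -> R) : (forall e, ule (f e) (F e)) ->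
  ule (fun n => \sum_(e <- s) f e n) (\sum_(e <- s) F e).
Proof.
move=> h; elim: s => [|e s IH].
  by rewrite big_nil; apply: ule_cst => n; rewrite big_nil.
rewrite big_cons => eps e0; have := uleD (h e) IH e0.
by apply: filterS => n /=; rewrite big_cons.
Qed.
Lemma ule_le a c al : ule (fun n => - a n) (- c) -> U [set n | a n <= al] -> c <= al.
Proof.
move=> h ha; apply/ler_addgt0Pr => eps e0.
have [n [/= h1 h2]] := filter_ex (filterI (h eps e0) ha).
by move: h1 h2; clear; lra.
Qed.

Section Lsc.
Variables (v h : nat -> graph_fun G) (w : graph_fun G) (m0 a0 : R).
Hypothesis sv : forall n, sobolev (v n) (h n).
Hypothesis hm : forall n, tot (sq_int (v n)) <= m0.
Hypothesis ha : forall n, tot (sq_int (h n)) <= a0.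
Hypothesis hw : forall i e x, 0 <= x <= len K e -> forall eps, 0 < eps ->
  U [set n | `|v n (i, e) x - w (i, e) x| <= eps].

Let S := 1 + 3 * (m0 + a0).
Lemma deriv_bound_ge0 : 0 <= a0.
Proof. by have [_ _ _ sh] := sv 0; exact: le_trans (tot_ge0 sh) (ha 0). Qed.
Lemma mass_bound_ge0 : 0 <= m0.
Proof. by have [_ _ sm _] := sv 0; exact: le_trans (tot_ge0 sm) (hm 0). Qed.
Lemma sup_const_ge1 : 1 <= S.
Proof. by have := deriv_bound_ge0; have := mass_bound_ge0; rewrite /S; lra. Qed.
Lemma seq_bounded n i e x : 0 <= x <= len K e -> `|v n (i, e) x| <= S.
Proof.
move=> hx; have := sup_bound i (sv n) ltr01 hx; rewrite invr1 !mul1r => h1.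
have := hm n; have := ha n; move: h1.
rewrite -(real_normK (num_real (v n (i, e) x))); set y := `|_|.
have := sqr_ge0 (y - 1); rewrite /S; nra.
Qed.
Lemma limit_bounded i e x : 0 <= x <= len K e -> `|w (i, e) x| <= S.
Proof.
move=> hx; apply/ler_addgt0Pr => eps e0.
have [n /= hn] := filter_ex (hw i hx e0); have := seq_bounded n i hx.
have := ler_normB (v n (i, e) x) (v n (i, e) x - w (i, e) x).
by rewrite opprB addrC subrK; move: hn; lra.
Qed.

(** Equicontinuity, from the bound on the derivatives. *)
Lemma seq_holder n i e x y : 0 <= x <= len K e -> 0 <= y <= len K e ->
  `|v n (i, e) x - v n (i, e) y| <= Num.sqrt (a0 * `|x - y|).
Proof.
wlog xy : x y / y <= x.
  move=> W hx hy; have [l|/ltW l] := leP y x; first exact: W.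
  by rewrite distrC [`|x - y|]distrC; exact: W.
move=> /andP[x0 xl] /andP[y0 yl]; rewrite (ger0_norm (_ : 0 <= x - y)) ?subr_ge0//.
apply: sqrt_abs; first by rewrite mulr_ge0 ?deriv_bound_ge0// subr_ge0.
have [ac _ _ sh] := sv n; have [p ig] := ac (i, e).
apply: le_trans (cauchy_increment xy (prim_sub y0 xl p) (intgS y0 xl ig)) _.
rewrite mulrC ler_wpM2r ?subr_ge0//; apply: le_trans (ha n); apply: le_trans (tot_ub1 (i, e) sh).
by apply: itg_sub_le => // z _; exact: sqr_ge0.
Qed.
Lemma limit_holder i e x y : 0 <= x <= len K e -> 0 <= y <= len K e ->
  `|w (i, e) x - w (i, e) y| <= Num.sqrt (a0 * `|x - y|).
Proof.
move=> hx hy; apply/ler_addgt0Pr => eps e0; have e2 : 0 < eps / 2 by rewrite divr_gt0.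
have [n [/= h1 h2]] := filter_ex (filterI (hw i hx e2) (hw i hy e2)).
have := seq_holder n i hx hy; move: h1 h2; rewrite !ler_norml => /andP[? ?] /andP[? ?] /andP[? ?].
by apply/andP; split; lra.
Qed.
Lemma holder_small (eps : R) : 0 < eps -> exists2 d, 0 < d & forall y : R, `|y| <= d -> Num.sqrt (a0 * `|y|) <= eps.
Proof.
move=> e0; have A1 : 0 < a0 + 1 by rewrite ltr_wpDl ?deriv_bound_ge0.
exists (eps ^+ 2 / (a0 + 1)); first by rewrite divr_gt0// exprn_gt0.
move=> y; rewrite ler_pdivlMr// => hy.
have : Num.sqrt (a0 * `|y|) <= Num.sqrt (eps ^+ 2).
  by rewrite ler_sqrt ?sqr_ge0//; apply: le_trans hy; rewrite mulrC ler_wpM2l// lerDl.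
by rewrite sqrtr_sqr (ger0_norm (ltW e0)).
Qed.
Lemma limit_cts e : cts 0 (len G e) (w e).
Proof.
case: e => i e x hx eps e0; have e2 : 0 < eps / 2 by rewrite divr_gt0.
have [d d0 hd] := holder_small e2.
exists d => // y hy hxy.
apply: le_lt_trans (_ : eps / 2 < eps); last by rewrite ltr_pdivrMr// mulr_natr mulr2n ltrDl.
exact: le_trans (limit_holder i hx hy) (hd _ (ltW hxy)).
Qed.

(** Equicontinuity turns pointwise limits at finitely many points into uniform ones
    on an edge. *)
Lemma limit_unif i e (eps : R) : 0 < eps -> U [set n | forall x, 0 <= x <= len K e -> `|v n (i, e) x - w (i, e) x| <= eps].
Proof.
move=> e0; have e3 : 0 < eps / 3 by rewrite divr_gt0.
have [d d0 hd] := holder_small e3; set l := len K e; have l0 : 0 < l := len_gt0 e.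
pose N := Num.bound (l / d).
have hN : l / d < N%:R by apply: archi_boundP; rewrite divr_ge0// ltW.
have N0 : 0 < N%:R :> R by apply: le_lt_trans hN; rewrite divr_ge0// ltW.
pose nd (j : nat) : R := j%:R * l / N%:R.
have hnd (j : 'I_N.+1) : 0 <= nd j <= l.
  rewrite /nd divr_ge0 ?mulr_ge0 ?(ltW l0) ?(ltW N0)//= ler_pdivrMr// mulrC ler_pM2l// ler_nat -ltnS.
  exact: ltn_ord.
have F : U [set n | forall j : 'I_N.+1, `|v n (i, e) (nd j) - w (i, e) (nd j)| <= eps / 3].
  exact: (filter_forall PU (fun j => hw i (hnd j) e3)).
apply: filterS F => n /= H x /andP[x0 xl].
have y0 : 0 <= x * N%:R / l by rewrite divr_ge0 ?mulr_ge0 ?(ltW l0) ?(ltW N0).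
have /andP[t1 t2] := Num.Theory.truncn_itv y0.
set j := Num.truncn _ in t1 t2.
have jN : (j < N.+1)%N.
  rewrite ltnS -(ler_nat R); apply: le_trans t1 _; rewrite ler_pdivrMr// mulrC ler_pM2l//.
have := H (Ordinal jN); rewrite /= => h1.
have hx : 0 <= x <= len K e by rewrite x0.
have hz : `|x - nd j| <= d.
  have e1 : x - nd j = (x * N%:R / l - j%:R) * (l / N%:R) by rewrite /nd; field; rewrite !gt_eqF.
  have ld : l / N%:R <= d by rewrite ler_pdivrMr// mulrC -ler_pdivrMr// ltW.
  have lN : 0 <= l / N%:R by rewrite divr_ge0// ltW.
  rewrite e1 normrM (ger0_norm lN); apply: le_trans ld; apply: ler_piMl => //.
  rewrite ger0_norm ?subr_ge0//; move: t2; rewrite -natr1; lra.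
have h2 := le_trans (seq_holder n i hx (hnd (Ordinal jN))) (hd _ hz).
have h3 := le_trans (limit_holder i hx (hnd (Ordinal jN))) (hd _ hz).
move: h1 h2 h3; rewrite !ler_norml /= => /andP[? ?] /andP[? ?] /andP[? ?].
by apply/andP; split; lra.
Qed.
Lemma limit_glued : glued w.
Proof.
move=> [[i e] b] [[j f] c] hE; apply/eqP; rewrite -subr_eq0 -normr_le0; apply/ler_addgt0Pr => eps e0.
have e2 : 0 < eps / 2 by rewrite divr_gt0.
have X (i' : int) (e' : edge K) (b' : bool) : 0 <= (if b' then len K e' else 0) <= len K e'.
  by case: b'; rewrite lexx ltW ?len_gt0.
have [n [/= h1 h2]] := filter_ex (filterI (hw i (X i e b) e2) (hw j (X j f c) e2)).
have [_ gl _ _] := sv n; have := gl _ _ hE; rewrite /end_value /= => E.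
rewrite -E distrC in h2; rewrite add0r.
have := ler_normB (w (i, e) (if b then len K e else 0) - v n (i, e) (if b then len K e else 0)) (w (j, f) (if c then len K f else 0) - v n (i, e) (if b then len K e else 0)).
rewrite opprB addrA subrK; rewrite distrC in h1; move: h1 h2; lra.
Qed.
Lemma limit_itg p e : ule (fun n => `|itg 0 (len G e) (fun x => v n e x ^+ p.+1) - itg 0 (len G e) (fun x => w e x ^+ p.+1)|) 0.
Proof.
case: e => i e eps e0; set l := len _ _; have l0 : 0 < l := len_gt0 e.
have S0 : 0 < S by apply: lt_le_trans sup_const_ge1.
pose k : R := p.+1%:R * S ^+ p * l; have k0 : 0 < k by rewrite !mulr_gt0// exprn_gt0.
have d0 : 0 < eps / k by rewrite divr_gt0.
apply: filterS (limit_unif i e d0) => n /= H.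
have i1 := @sobolev_intgX _ G _ _ (i, e) p.+1 (sv n).
have wc : cts 0 l (w (i, e)) by exact: (@limit_cts (i, e)).
have i2 : intg 0 l (fun x => w (i, e) x ^+ p.+1) by apply: cts_intg; apply: ctsX; exact: wc.
rewrite -itgB// add0r; apply: le_trans (itg_abs (intgB i1 i2)) _.
have -> : eps = itg 0 l (fun=> p.+1%:R * S ^+ p * (eps / k)).
  by rewrite itg_cst ?ltW// subr0 mulrAC -/k mulrC divfK// gt_eqF.
apply: itg_le; [exact: intg_abs (intgB i1 i2)|exact: intg_cst|].
move=> x hx; apply: pow_near; [exact: seq_bounded|exact: limit_bounded|exact: H].
Qed.
Lemma limit_dyadic (q : nat) e : ule (fun n => - dyadic (len G e) (v n e) q) (- dyadic (len G e) (w e) q).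
Proof.
case: e => i e eps e0; set l := len _ _; have l0 : 0 < l := len_gt0 e.
have S0 : 0 < S by apply: lt_le_trans sup_const_ge1.
pose N : R := 2 ^+ q; have N0 : 0 < N by rewrite exprn_gt0.
pose d := eps * l / (8 * S * N * N); have d0 : 0 < d by rewrite !(divr_gt0, mulr_gt0).
apply: filterS (limit_unif i e d0) => n /= H.
suff : dyadic l (w (i, e)) q - dyadic l (v n (i, e)) q <= eps by lra.
rewrite /dyadic -sumrB.
apply: le_trans (_ : \sum_(j < 2 ^ q) eps / N <= _); last first.
  by rewrite sumr_const card_ord -mulr_natr natrX divfK// gt_eqF.
apply: ler_sum => j _; rewrite -mulrBl -mulrBl.
have X1 := node_bnd l0 (ltn_ord j); have X2 := node_bnd l0 (ltnW (ltn_ord j)).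
have := H _ X1; have := H _ X2; have := limit_bounded i X1; have := limit_bounded i X2; have := seq_bounded n i X1; have := seq_bounded n i X2.
set w1 := w _ _; set w2 := w _ _; set v1 := v _ _ _; set v2 := v _ _ _ => b1 b2 b3 b4 b5 b6.
have -> : eps / N = (2 * d) * (4 * S) * N / l.
  rewrite /d; field; by rewrite !gt_eqF.
rewrite ler_pM2r ?invr_gt0// ler_pM2r//; apply: le_trans (ler_norm _) _.
rewrite subr_sqr normrM; apply: ler_pM => //.
  by move: b5 b6; rewrite !ler_norml => /andP[? ?] /andP[? ?]; apply/andP; split; lra.
by move: b1 b2 b3 b4; rewrite !ler_norml => /andP[? ?] /andP[? ?] /andP[? ?] /andP[? ?]; apply/andP; split; lra.
Qed.
Lemma seq_dyadic n q e : dyadic (len G e) (v n e) q <= sq_int (h n) e.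
Proof. by have [ac _ _ _] := sv n; apply: dyadic_le (ac e); exact: len0. Qed.

(** The masses are handled by uniform convergence on finitely many edges.  For the
    derivatives, dyadic energies converge because they involve finitely many
    values, and [riesz] reconstructs a derivative from their supremum. *)
Lemma limit_lsc : exists k, [/\ sobolev w k,
  forall al, U [set n | tot (sq_int (v n)) <= al] -> tot (sq_int w) <= al &
  forall al, U [set n | tot (sq_int (h n)) <= al] -> tot (sq_int k) <= al].
Proof.
have dyb e q : dyadic (len G e) (w e) q <= a0.
  apply: (ule_le (limit_dyadic q e)); apply: filterS filterT => n _ /=.
  apply: le_trans (seq_dyadic n q e) _; apply: le_trans (ha n).
  by have [_ _ _ sh] := sv n; exact: tot_ub1.
have hs e : has_sup (range (dyadic (len G e) (w e))).
  by split; [exists (dyadic (len G e) (w e) 0), 0%N|exists a0 => _ [q _ <-]].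
have X e : exists g : R -> R, abscont (len G e) (w e) g /\ itg 0 (len G e) (fun x => g x ^+ 2) <= sup (range (dyadic (len G e) (w e))).
  apply: riesz; [exact: len0|exact: limit_cts|].
  by move=> q; apply: sup_upper_bound (hs e) _ _; exists q.
have [k hk] := choice X.
have Hk al : U [set n | tot (sq_int (h n)) <= al] -> forall s, uniq s -> \sum_(e <- s) sq_int k e <= al.
  move=> hal s us; apply/ler_addgt0Pr => eps e0.
  have e1 : 0 < eps / (size s).+1%:R by rewrite divr_gt0.
  have Q e : exists q, sq_int k e <= dyadic (len G e) (w e) q + eps / (size s).+1%:R.
    have [_ [q _ <-] hq] := sup_adherent e1 (hs e); exists q.
    by apply: le_trans (hk e).2 _; rewrite -lerBlDr; exact: ltW.
  have [q hq] := choice Q.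
  have B1 : \sum_(e <- s) dyadic (len G e) (w e) (q e) <= al.
    have h1 := ule_sum s (fun e => limit_dyadic (q e) e).
    have h2 : ule (fun n => - \sum_(e <- s) dyadic (len G e) (v n e) (q e)) (- \sum_(e <- s) dyadic (len G e) (w e) (q e)).
      rewrite -sumrN => d d0; apply: filterS (h1 d d0) => n /=; by rewrite sumrN.
    apply: (ule_le h2); apply: filterS hal => n /= hn; apply: le_trans hn.
    have [_ _ _ sh] := sv n; apply: le_trans (tot_ub sh us); apply: ler_sum => e _; exact: seq_dyadic.
  apply: le_trans (_ : \sum_(e <- s) (dyadic (len G e) (w e) (q e) + eps / (size s).+1%:R) <= _).
    by apply: ler_sum.
  rewrite big_split /= big_const_seq count_predT iter_addr_0; apply: lerD => //.
  have -> : (eps / (size s).+1%:R) *+ size s = eps * (size s)%:R / (size s).+1%:R by rewrite -mulr_natr; ring.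
  by rewrite ler_pdivrMr// ler_pM2l// ler_nat leqnSn.
have Hw al : U [set n | tot (sq_int (v n)) <= al] -> forall s, uniq s -> \sum_(e <- s) sq_int w e <= al.
  move=> hal s us.
  have W e : ule (fun n => - sq_int (v n) e) (- sq_int w e).
    move=> eps e0; apply: filterS (limit_itg 1 e e0) => n /=; rewrite -/(sq_int _ _).
    by rewrite distrC => /(le_trans (ler_norm _)); rewrite /sq_int; lra.
  have h1 := ule_sum s W.
  have h2 : ule (fun n => - \sum_(e <- s) sq_int (v n) e) (- \sum_(e <- s) sq_int w e).
    rewrite -sumrN => d d0; apply: filterS (h1 d d0) => n /=; by rewrite sumrN.
  apply: (ule_le h2); apply: filterS hal => n /= hn; apply: le_trans hn.
  by have [_ _ sm _] := sv n; exact: tot_ub.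
exists k; split.
- split=> //.
  + by move=> e; have [] := hk e.
  + exact: limit_glued.
  + apply: (@summI _ _ _ m0); first by move=> e; exact: sq_int_ge0.
    by apply: Hw; apply: filterS filterT => n _ /=.
  + apply: (@summI _ _ _ a0); first by move=> e; exact: sq_int_ge0.
    by apply: Hk; apply: filterS filterT => n _ /=.
- by move=> al hal; apply: tot_lub; exact: Hw.
- by move=> al hal; apply: tot_lub; exact: Hk.
Qed.
End Lsc.

Lemma limit_csum (v h : nat -> graph_fun G) (w : graph_fun G) (m0 a0 c : R) i :
  (forall n, sobolev (v n) (h n)) -> (forall n, tot (sq_int (v n)) <= m0) -> (forall n, tot (sq_int (h n)) <= a0) ->
  (forall i e x, 0 <= x <= len K e -> forall eps, 0 < eps -> U [set n | `|v n (i, e) x - w (i, e) x| <= eps]) ->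
  (forall n, c <= csum (sq_int (v n)) i) -> c <= csum (sq_int w) i.
Proof.
move=> sv hm ha hw hc.
have h1 : ule (fun n => csum (sq_int (v n)) i) (csum (sq_int w) i).
  have W e : ule (fun n => sq_int (v n) e) (sq_int w e).
    move=> eps e0; apply: filterS (limit_itg sv hm ha hw 1 e e0) => n /=.
    by move=> /(le_trans (ler_norm _)); rewrite /sq_int; clear; lra.
  exact: (ule_sum (es P) (fun e => W (i, e))).
apply/ler_addgt0Pr => eps e0; have [n /= hn] := filter_ex (h1 eps e0).
exact: le_trans (hc n) hn.
Qed.
Lemma limit_six (v h : nat -> graph_fun G) (w : graph_fun G) (m0 a0 : R) (s : seq (edge G)) :
  (forall n, sobolev (v n) (h n)) -> (forall n, tot (sq_int (v n)) <= m0) -> (forall n, tot (sq_int (h n)) <= a0) ->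
  (forall i e x, 0 <= x <= len K e -> forall eps, 0 < eps -> U [set n | `|v n (i, e) x - w (i, e) x| <= eps]) ->
  ule (fun n => \sum_(e <- s) six_int (v n) e) (\sum_(e <- s) six_int w e).
Proof.
move=> sv hm ha hw; apply: ule_sum => e eps e0.
apply: filterS (limit_itg sv hm ha hw 5 e e0) => n /= /(le_trans (ler_norm _)).
by rewrite /six_int; clear; lra.
Qed.
Lemma tot_deriv_uniq w g k : sobolev w g -> sobolev w k -> tot (sq_int g) = tot (sq_int k).
Proof.
move=> [ac _ _ _] [ac' _ _ _]; apply: eq_tot => e; apply: abscont_uniq (ac e) (ac' e).
exact/ltW/len0.
Qed.
Lemma gscale1 w : gscale 1 w = w.
Proof. by apply/funext => e; apply/funext => x; rewrite /gscale mul1r. Qed.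
Lemma par1 u g w k : sobolev u g -> sobolev w k ->
  tot (sq_int (gadd u w)) + tot (sq_int (gadd u (gscale (-1) w))) = 2 * (tot (sq_int u) + tot (sq_int w)) /\
  tot (sq_int (gadd g k)) + tot (sq_int (gadd g (gscale (-1) k))) = 2 * (tot (sq_int g) + tot (sq_int k)).
Proof.
move=> su sw; have [] := tot_par (ler01) su sw; rewrite !gscale1.
move: (tot (sq_int (gadd u w))) (tot (sq_int (gadd g k))) (tot (sq_int (gadd u (gscale (-1) w)))) (tot (sq_int (gadd g (gscale (-1) k)))).
move: (tot (sq_int u)) (tot (sq_int g)) (tot (sq_int w)) (tot (sq_int k)); clear=> a b c d x y z t; lra.
Qed.
Lemma sobolev_tot_ge0 u g : sobolev u g -> 0 <= tot (sq_int u) /\ 0 <= tot (sq_int g).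
Proof. by move=> [_ _ s1 s2]; split; exact: tot_ge0. Qed.

(** Let q(-) be the quantity (m or A) of the difference and suppose that
    q(-) > q_n - q + eps.  By the parallelogram identity the quantity of
    v_n + t w would then be too small, for t = (b + 1) / eps, to be compatible with lower
    semicontinuity at (1 + t) w. *)
Lemma split_limit (UU : UltraFilter U) (v h : nat -> graph_fun G) w k (b eps : R) :
  (forall n, sobolev (v n) (h n)) -> (forall n, tot (sq_int (v n)) <= b) -> (forall n, tot (sq_int (h n)) <= b) ->
  (forall i e x, 0 <= x <= len K e -> forall eps, 0 < eps -> U [set n | `|v n (i, e) x - w (i, e) x| <= eps]) ->
  sobolev w k -> 0 < eps ->
  U [set n | tot (sq_int (gadd (v n) (gscale (-1) w))) <= tot (sq_int (v n)) - tot (sq_int w) + eps] /\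
  U [set n | tot (sq_int (gadd (h n) (gscale (-1) k))) <= tot (sq_int (h n)) - tot (sq_int k) + eps].
Proof.
move=> sv hm ha hw sw e0.
have b0 : 0 <= b by have [h0 _] := sobolev_tot_ge0 (sv 0); exact: le_trans (hm 0).
(* t eps = b + 1 exceeds the bound on all the quantities involved *)
pose t := (b + 1) / eps; have t0 : 0 < t by rewrite divr_gt0// ltr_wpDl.
have te : t * eps = b + 1 by rewrite /t divfK// gt_eqF.
have [w0 k0] := sobolev_tot_ge0 sw.
have sV n : sobolev (gadd (v n) (gscale t w)) (gadd (h n) (gscale t k)).
  by apply: sobolevD (sv n) (sobolevZ t sw).1.
have E n : tot (sq_int (gadd (v n) (gscale t w))) = (1 + t) * tot (sq_int (v n)) + (t ^+ 2 + t) * tot (sq_int w) - t * tot (sq_int (gadd (v n) (gscale (-1) w))) /\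
  tot (sq_int (gadd (h n) (gscale t k))) = (1 + t) * tot (sq_int (h n)) + (t ^+ 2 + t) * tot (sq_int k) - t * tot (sq_int (gadd (h n) (gscale (-1) k))).
  have [] := tot_par (ltW t0) (sv n) sw; have [] := par1 (sv n) sw.
  set a1 := tot (sq_int (gadd (v n) w)); set a2 := tot (sq_int (gadd (h n) k)).
  move=> x1 x2 y1 y2; have z1 : a1 = 2 * (tot (sq_int (v n)) + tot (sq_int w)) - tot (sq_int (gadd (v n) (gscale (-1) w))) by rewrite -x1 addrK.
  have z2 : a2 = 2 * (tot (sq_int (h n)) + tot (sq_int k)) - tot (sq_int (gadd (h n) (gscale (-1) k))) by rewrite -x2 addrK.
  rewrite z1 in y1; rewrite z2 in y2.
  move: y1 y2; move: (tot (sq_int (gadd (v n) (gscale (-1) w)))) (tot (sq_int (gadd (h n) (gscale (-1) k)))) (tot (sq_int (gadd (v n) (gscale t w)))) (tot (sq_int (gadd (h n) (gscale t k)))).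
  move: (tot (sq_int (v n))) (tot (sq_int w)) (tot (sq_int (h n))) (tot (sq_int k)); clear=> p1 p2 p3 p4 p5 p6 p7 p8 q1 q2; split; [move: q1|move: q2]; clear; lra.
have D n : 0 <= tot (sq_int (gadd (v n) (gscale (-1) w))) /\ 0 <= tot (sq_int (gadd (h n) (gscale (-1) k))).
  exact: sobolev_tot_ge0 (sobolevB (sv n) sw).
have t1 : 0 <= 1 + t by rewrite addr_ge0// ltW.
have mV n : tot (sq_int (gadd (v n) (gscale t w))) <= (1 + t) * b + (t ^+ 2 + t) * tot (sq_int w).
  exact: quad_bound t0 (E n).1 (D n).1 (hm n).
have aV n : tot (sq_int (gadd (h n) (gscale t k))) <= (1 + t) * b + (t ^+ 2 + t) * tot (sq_int k).
  exact: quad_bound t0 (E n).2 (D n).2 (ha n).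
have wV i e x : 0 <= x <= len K e -> forall d, 0 < d ->
   U [set n | `|gadd (v n) (gscale t w) (i, e) x - gscale (1 + t) w (i, e) x| <= d].
  move=> hx d d0; apply: filterS (hw i e x hx d d0) => n /=; rewrite /gadd /gscale.
  by have -> : v n (i, e) x + t * w (i, e) x - (1 + t) * w (i, e) x = v n (i, e) x - w (i, e) x by ring.
have [k' [sk' H1 H2]] := limit_lsc sV mV aV wV.
have [sW [tW tK]] := sobolevZ (1 + t) sw.
have K2 : tot (sq_int k') = (1 + t) ^+ 2 * tot (sq_int k) by rewrite -tK; exact: tot_deriv_uniq sk' sW.
split.
- have [//|F] := in_ultra_setVsetC [set n | tot (sq_int (gadd (v n) (gscale (-1) w))) <= tot (sq_int (v n)) - tot (sq_int w) + eps] UU.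
  have := H1 ((t ^+ 2 + 2 * t) * tot (sq_int w) - 1); rewrite tW => X.
  suff : (1 + t) ^+ 2 * tot (sq_int w) <= (t ^+ 2 + 2 * t) * tot (sq_int w) - 1 by move: w0; clear; lra.
  apply: X; apply: filterS F => n /= /negP; rewrite -ltNge => hn.
  exact: quad_drop t0 (E n).1 te hn (hm n).
- have [//|F] := in_ultra_setVsetC [set n | tot (sq_int (gadd (h n) (gscale (-1) k))) <= tot (sq_int (h n)) - tot (sq_int k) + eps] UU.
  have := H2 ((t ^+ 2 + 2 * t) * tot (sq_int k) - 1); rewrite K2 => X.
  suff : (1 + t) ^+ 2 * tot (sq_int k) <= (t ^+ 2 + 2 * t) * tot (sq_int k) - 1 by move: k0; clear; lra.
  apply: X; apply: filterS F => n /= /negP; rewrite -ltNge => hn.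
  exact: quad_drop t0 (E n).2 te hn (ha n).
Qed.

Lemma six_split v h w k (d : R) e : sobolev v h -> sobolev w k -> 0 < d <= 1 ->
  six_int v e <= (1 + 63 * d) * six_int (gadd v (gscale (-1) w)) e + (1 + d^-1) ^+ 6 * six_int w e.
Proof.
move=> sv sw hd; have sB := sobolevB sv sw.
have i1 := sobolev_intgX e 6 sv; have i2 := sobolev_intgX e 6 sw; have i3 := sobolev_intgX e 6 sB.
rewrite /six_int -!itgZ// -itgD; try exact: intgZ.
apply: itg_le => //; first by apply: intgD; exact: intgZ.
move=> x _; have := pow6_split (gadd v (gscale (-1) w) e x) (w e x) hd.
have -> // : gadd v (gscale (-1) w) e x + w e x = v e x by rewrite /gadd /gscale; ring.
Qed.

(** Off finitely many edges the limit w contributes little, and [six_split] applies;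
    on these edges convergence is uniform. *)
Lemma brezis_lieb (v h : nat -> graph_fun G) w k (b eps : R) :
  (forall n, sobolev (v n) (h n)) -> (forall n, tot (sq_int (v n)) <= b) -> (forall n, tot (sq_int (h n)) <= b) ->
  (forall i e x, 0 <= x <= len K e -> forall eps, 0 < eps -> U [set n | `|v n (i, e) x - w (i, e) x| <= eps]) ->
  sobolev w k -> 0 < eps ->
  U [set n | tot (six_int (v n)) <= tot (six_int w) + tot (six_int (gadd (v n) (gscale (-1) w))) + eps].
Proof.
move=> sv hm ha hw sw e0.
have b0 : 0 <= b by have [h0 _] := sobolev_tot_ge0 (sv 0); exact: le_trans (hm 0).
have [w0 k0] := sobolev_tot_ge0 sw.
pose Q := 36 * (2 * (b + tot (sq_int w))) ^+ 2 * (2 * (b + tot (sq_int k))).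
have bw : 0 <= 2 * (b + tot (sq_int w)) by rewrite mulr_ge0// addr_ge0.
have bk : 0 <= 2 * (b + tot (sq_int k)) by rewrite mulr_ge0// addr_ge0.
have Q0 : 0 <= Q := mulr_ge0 (mulr_ge0 (ler0n R 36) (sqr_ge0 _)) bk.
have hQ n : tot (six_int (gadd (v n) (gscale (-1) w))) <= Q.
  have sB := sobolevB (sv n) sw; have [B0 B1] := sobolev_tot_ge0 sB.
  have [D0 D1] := sobolev_tot_ge0 (sobolevD (sv n) sw).
  have [p1 p2] := par1 (sv n) sw.
  have q1 : tot (sq_int (gadd (v n) (gscale (-1) w))) <= 2 * (b + tot (sq_int w)) by have := hm n; move: p1 D0; clear; lra.
  have q2 : tot (sq_int (gadd (h n) (gscale (-1) k))) <= 2 * (b + tot (sq_int k)) by have := ha n; move: p2 D1; clear; lra.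
  apply: le_trans (rough_GN sB) _; rewrite /Q; move: q1 q2 B0 B1 bw bk.
  move: (tot (sq_int (gadd (v n) (gscale (-1) w)))) (tot (sq_int (gadd (h n) (gscale (-1) k)))) (2 * (b + tot (sq_int w))) (2 * (b + tot (sq_int k))).
  clear=> x y z t xz yt x0 y0 z0 t0; apply: ler_pM => //; first by rewrite mulr_ge0 ?sqr_ge0.
  by rewrite ler_pM2l// ler_sqr ?nnegrE.
pose d := Num.min 1 (eps / (3 * 63 * (Q + 1))).
have Q1 : 0 < 3 * 63 * (Q + 1) by rewrite !mulr_gt0// ltr_wpDl.
have d0 : 0 < d by rewrite lt_min ltr01 divr_gt0.
have d1 : d <= 1 by rewrite ge_min lexx.
have dQ : d * (3 * 63 * (Q + 1)) <= eps by rewrite -ler_pdivlMr// ge_min lexx orbT.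
have hd : 0 < d <= 1 by rewrite d0.
pose C := (1 + d^-1) ^+ 6.
have C0 : 0 < C by rewrite exprn_gt0// addr_gt0// invr_gt0.
have sw6 := six_summ sw.
have eC : 0 < eps / (3 * C) by rewrite divr_gt0// mulr_gt0.
have [s us hs] := tot_tail sw6 eC.
have e3 : 0 < eps / 3 by rewrite divr_gt0.
have F := limit_six s sv hm ha hw e3.
apply: filterS F => n /= hn.
have sB := sobolevB (sv n) sw; have sB6 := six_summ sB; have sv6 := six_summ (sv n).
have [so to] := tot_off us sv6; rewrite to.
have [so2 to2] := tot_off us sw6.
have k1 : 0 <= 1 + 63 * d by rewrite addr_ge0// mulr_ge0// ltW.
have [z1 f1] := totZ k1 sB6; have [z2 f2] := totZ (ltW C0) so2; have [z3 f3] := totD z1 z2.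
have O e : off s (six_int (v n)) e <= (1 + 63 * d) * six_int (gadd (v n) (gscale (-1) w)) e + C * off s (six_int w) e.
  rewrite /off; case: ifP => _; last exact: (six_split e (sv n) sw hd).
  by rewrite mulr0 addr0 mulr_ge0// six_int_ge0.
have h1 : tot (off s (six_int (v n))) <= (1 + 63 * d) * tot (six_int (gadd (v n) (gscale (-1) w))) + C * tot (off s (six_int w)).
  by rewrite -f1 -f2 -f3; exact: tot_le.
have h2 : C * tot (off s (six_int w)) <= eps / 3.
  have : C * tot (off s (six_int w)) <= C * (eps / (3 * C)) by rewrite ler_pM2l// ltW.
  have -> // : C * (eps / (3 * C)) = eps / 3 by field; rewrite gt_eqF.
have h3 : d * tot (six_int (gadd (v n) (gscale (-1) w))) <= d * Q by rewrite ler_pM2l.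
have h4 : \sum_(e <- s) six_int w e <= tot (six_int w) by exact: tot_ub.
move: hn h1 h2 h3 h4 dQ d0; clear; lra.
Qed.
End Limits.

Section Compactness.
Variables (R : realType) (P : periodicity_data R).
Local Notation K := (cell P).
Local Notation G := (periodic_graph P).

(** The limit is the supremum of the levels that the sequence exceeds on a set of
    the ultrafilter. *)
Lemma ultra_lim (U : set_system nat) (UU : UltraFilter U) (a : nat -> R) (M : R) :
  (forall n, `|a n| <= M) -> exists x, forall eps, 0 < eps -> U [set n | `|a n - x| <= eps].
Proof.
move=> hM; pose T := [set t | U [set n | t <= a n]].
have T0 : T (- M).
  by apply: filterS filterT => n _ /=; have := hM n; rewrite ler_norml => /andP[].
have Tb : ubound T M.
  move=> t /filter_ex [n /= hn]; apply: le_trans hn _.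
  by have := hM n; rewrite ler_norml => /andP[].
have hs : has_sup T by split; [exists (- M)|exists M].
exists (sup T) => eps e0; have [t Tt ht] := sup_adherent e0 hs.
have h2 : ~ T (sup T + eps).
  by move=> /(sup_upper_bound hs); rewrite gerDl leNgt e0.
have [//|h3] := in_ultra_setVsetC [set n | sup T + eps <= a n] UU.
apply: filterS2 Tt h3 => n /= h4 /negP; rewrite -ltNge => h5.
by rewrite ler_norml; apply/andP; split; move: ht h4 h5; clear; lra.
Qed.

(** The hypothesis J >= 0 is applied to the difference of the sequence and its
    limit.  Splitting gives J(w) <= J(u_n) - J(u_n - w) + o(1), so J(w) <= 0; the
    mass kept in the cell 0 makes w nonzero. *)
Lemma compactness (om mu a c : R) (u g : nat -> graph_fun G) : 0 <= om ->
  (forall v h : graph_fun G, sobolev v h -> tot (sq_int v) <= mu -> 0 <= tot (sq_int h) / 2 + om * tot (sq_int v) - tot (six_int v) / 6) ->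
  (forall n, sobolev (u n) (g n)) -> (forall n, tot (sq_int (u n)) <= mu) -> (forall n, tot (sq_int (g n)) <= a) ->
  0 < c -> (forall n, c <= csum (sq_int (u n)) 0) ->
  (forall eps, 0 < eps -> exists N, forall n, (N <= n)%N ->
     tot (sq_int (g n)) / 2 + om * tot (sq_int (u n)) - tot (six_int (u n)) / 6 <= eps) ->
  exists w k : graph_fun G, [/\ sobolev w k, 0 < tot (sq_int w), tot (sq_int w) <= mu &
    tot (sq_int k) / 2 + om * tot (sq_int w) - tot (six_int w) / 6 <= 0].
Proof.
move=> om0 hJ su hm ha c0 hc hl.
have [U [UU FU]] := ultraFilterLemma eventually_filter.
have bd n (p : edge G * R) : `|if 0 <= p.2 <= len K p.1.2 then u n p.1 p.2 else 0| <= 1 + 3 * (mu + a).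
  case: p => [[i e] x] /=; case: ifP => hx; first exact: (seq_bounded su hm ha).
  by rewrite normr0; have := sup_const_ge1 su hm ha; clear; lra.
have [f hf] := choice (fun p => ultra_lim UU (fun n => bd n p)).
pose w : graph_fun G := fun e x => f (e, x).
have hw i e x : 0 <= x <= len K e -> forall eps, 0 < eps -> U [set n | `|u n (i, e) x - w (i, e) x| <= eps].
  by move=> hx eps e0; have := hf ((i, e), x) eps e0; rewrite /= hx.
have [k [sw Hm Ha]] := limit_lsc su hm ha hw.
have w1 : tot (sq_int w) <= mu by apply: Hm; apply: filterS filterT => n _ /=.
have w0 : 0 < tot (sq_int w).
  have [_ _ sm _] := sw; apply: lt_le_trans c0 _; apply: le_trans (limit_csum su hm ha hw hc) _.
  by have [sC tC] := csum_summ sm; rewrite -tC; exact: tot_ub1.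
exists w, k; split=> //.
apply/ler_addgt0Pr => eps e0; rewrite add0r.
pose d := Num.min (tot (sq_int w)) (eps / (2 + om)).
have o2 : 0 < 2 + om by rewrite ltr_wpDr.
have d0 : 0 < d by rewrite lt_min w0 divr_gt0.
have dw : d <= tot (sq_int w) by rewrite ge_min lexx.
have de : d * (2 + om) <= eps by rewrite -ler_pdivlMr// ge_min lexx orbT.
have hm' n : tot (sq_int (u n)) <= Num.max mu a by rewrite le_max hm.
have ha' n : tot (sq_int (g n)) <= Num.max mu a by rewrite le_max ha orbT.
have [F1 F2] := split_limit UU su hm' ha' hw sw d0.
have PU : ProperFilter U := @ultra_proper _ _ UU.
have F3 := @brezis_lieb _ _ _ PU _ _ _ _ _ _ su hm' ha' hw sw d0.
have [N hN] := hl d d0.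
have F4 : U [set n | (N <= n)%N] by apply: FU; exists N.
have [n [/= [h1 h2] [h3 h4]]] := filter_ex (@filterI _ U _ _ _ (@filterI _ U _ _ _ F1 F2) (@filterI _ U _ _ _ F3 F4)).
have sB := sobolevB (su n) sw.
have hB : tot (sq_int (gadd (u n) (gscale (-1) w))) <= mu by have := hm n; move: h1 dw; clear; lra.
have h5 := hJ _ _ sB hB; have h6 := hN n h4.
have h7 : om * tot (sq_int (gadd (u n) (gscale (-1) w))) <= om * (tot (sq_int (u n)) - tot (sq_int w) + d) by rewrite ler_wpM2l.
move: h2 h3 h5 h6 h7 de d0; clear.
move: (tot (sq_int (gadd (u n) (gscale (-1) w)))) (tot (sq_int (gadd (g n) (gscale (-1) k)))) (tot (six_int (gadd (u n) (gscale (-1) w)))).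
move: (tot (sq_int (u n))) (tot (sq_int (g n))) (tot (six_int (u n))) (tot (sq_int w)) (tot (sq_int k)) (tot (six_int w)).
clear=> *; lra.
Qed.
End Compactness.

(** * The soliton of the line *)

Section Profile.
Variable R : realType.
Implicit Types x z l : R.
Local Notation mu := (@lebesgue_measure R).

(** Hyperbolic cosine and sine, and powers of the hyperbolic secant: the soliton is
    Pw (1/2), up to scaling. *)
Definition Ch z : R := (expR z + expR (- z)) / 2.
Definition Sh z : R := (expR z - expR (- z)) / 2.
Definition Pw (p z : R) : R := expR (- p * ln (Ch z)).
Lemma Ch_gt0 z : 0 < Ch z. Proof. by rewrite divr_gt0// addr_gt0// expR_gt0. Qed.
Lemma expRNK z : expR z * expR (- z) = 1. Proof. by rewrite -expRD subrr expR0. Qed.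
Lemma Ch_Sh z : Ch z ^+ 2 = 1 + Sh z ^+ 2.
Proof.
rewrite -(expRNK z) /Ch /Sh; by field.
Qed.
Lemma Ch_ge1 z : 1 <= Ch z.
Proof.
have : 1 <= Ch z ^+ 2 by rewrite Ch_Sh lerDl sqr_ge0.
by rewrite -[X in X <= _ -> _](expr1n _ 2) ler_sqr ?nnegrE// ltW// Ch_gt0.
Qed.
Lemma ChN z : Ch (- z) = Ch z. Proof. by rewrite /Ch opprK addrC. Qed.
Lemma ShN z : Sh (- z) = - Sh z. Proof. by rewrite /Sh opprK -mulNr opprB. Qed.
Lemma is_derive_opp_exp z : is_derive z 1 (fun x => expR (- x)) (- expR (- z)).
Proof.
have h : is_derive z 1 (fun x : R => - x) (-1) by apply: is_deriveN.
by have := is_derive_fcomp (is_derive_expR (- z)) h; rewrite mulN1r.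
Qed.
Lemma is_derive_Ch z : is_derive z 1 Ch (Sh z).
Proof.
have h := is_derive_fscale 2^-1 (is_derive_fadd (is_derive_expR z) (is_derive_opp_exp z)).
have e : Ch = (fun x => 2^-1 * (expR x + expR (- x))) by apply/funext => x; rewrite /Ch mulrC.
by rewrite e; apply: (is_derive_eq h); rewrite /Sh mulrC.
Qed.
Lemma is_derive_Sh z : is_derive z 1 Sh (Ch z).
Proof.
have h := is_derive_fscale 2^-1 (is_derive_fadd (is_derive_expR z) (is_derive_fscale (-1) (is_derive_opp_exp z))).
have e : Sh = (fun x => 2^-1 * (expR x + -1 * expR (- x))) by apply/funext => x; rewrite /Sh mulrC mulN1r.
by rewrite e; apply: (is_derive_eq h); rewrite /Ch mulN1r opprK mulrC.
Qed.
Lemma is_derive_Pw p z : is_derive z 1 (Pw p) (- p * (Sh z / Ch z) * Pw p z).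
Proof.
have h1 := is_derive_fcomp (is_derive1_ln (Ch_gt0 z)) (is_derive_Ch z).
have h2 := @is_derive_fcomp _ expR (fun x => - p * ln (Ch x)) z _ _ (is_derive_expR _) (is_derive_fscale (- p) h1).
exact: h2.
Qed.
Lemma Pw_gt0 p z : 0 < Pw p z. Proof. exact: expR_gt0. Qed.
Lemma PwD p q z : Pw p z * Pw q z = Pw (p + q) z.
Proof. by rewrite -expRD; congr expR; ring. Qed.
Lemma Pw1 z : Pw 1 z = (Ch z)^-1.
Proof. by rewrite /Pw mulN1r expRN lnK// posrE Ch_gt0. Qed.
Lemma Pwn (n : nat) z : Pw n%:R z = (Ch z) ^- n.
Proof.
elim: n => [|n IH]; first by rewrite /Pw oppr0 mul0r expR0 expr0 invr1.
by rewrite -natr1 -PwD IH Pw1 exprSr (invfM (Ch z ^+ n)).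
Qed.
Lemma Pw_le1 p z : 0 <= p -> Pw p z <= 1.
Proof.
move=> p0; rewrite -expR0 ler_expR mulNr oppr_le0 mulr_ge0//.
by rewrite ln_ge0// Ch_ge1.
Qed.
Lemma Pw_half z : Pw (1 / 2) z ^+ 2 = (Ch z)^-1.
Proof. by rewrite expr2 PwD -splitr Pw1. Qed.
Lemma Ch_le x z : `|x| <= z -> Ch x <= Ch z.
Proof.
wlog x0 : x / 0 <= x.
  move=> W h; have [?|/ltW ?] := leP 0 x; first exact: W.
  by rewrite -ChN; apply: W; rewrite ?oppr_ge0// normrN.
rewrite ger0_norm// => xz; have z0 := le_trans x0 xz.
have s (y : R) : 0 <= y -> 0 <= Sh y.
  by move=> y0; rewrite divr_ge0// subr_ge0 ler_expR; rewrite -subr_ge0 opprK addr_ge0.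
rewrite ler_pM2r ?invr_gt0//.
have ex := expR_gt0 x; have ez := expR_gt0 z.
have e1 : expR x <= expR z by rewrite ler_expR.
have e2 : 1 <= expR x by rewrite -expR0 ler_expR.
have e3 : 1 <= expR z by rewrite -expR0 ler_expR.
rewrite !expRN -subr_ge0.
have -> : expR z + (expR z)^-1 - (expR x + (expR x)^-1) = (expR z - expR x) * (expR x * expR z - 1) / (expR x * expR z).
  by field; rewrite !gt_eqF.
rewrite divr_ge0 ?mulr_ge0 ?(ltW ex) ?(ltW ez)// ?subr_ge0//.
by rewrite -[1]mulr1 ler_pM.
Qed.
Lemma Pw_ge x z p : 0 <= p -> `|x| <= z -> Pw p z <= Pw p x.
Proof.
move=> p0 h; rewrite ler_expR !mulNr lerN2 ler_wpM2l// ler_ln ?posrE ?Ch_gt0//.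
exact: Ch_le.
Qed.
Lemma is_derive_cts (F f : R -> R) a b : (forall x, is_derive x 1 F (f x)) -> cts a b F.
Proof.
move=> h; apply/ctsP; apply: continuous_subspaceT => x; apply: differentiable_continuous.
by apply/derivable1_diffP; have := h x; case.
Qed.

(** Primitives of sech and of sech - 2 sech tanh^2.  They give the integrals of
    sech tanh^2 and of sech^3 as half their difference and half their sum. *)
Definition Fg z : R := 2 * atan (expR z).
Definition Hg z : R := Sh z * Pw 2 z.
Lemma is_derive_Fg z : is_derive z 1 Fg (Pw 1 z).
Proof.
have h := is_derive_fscale 2 (is_derive_fcomp (is_derive1_atan (expR z)) (is_derive_expR z)).
apply: (is_derive_eq h); rewrite Pw1 /Ch.
have e0 := expR_gt0 z; rewrite expRN; field.
have e1 : 0 < expR z * expR z + 1 by rewrite ltr_wpDl// mulr_ge0// ltW.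
by rewrite (gt_eqF e0) (gt_eqF e1).
Qed.
Lemma is_derive_Hg z : is_derive z 1 Hg (Pw 1 z - 2 * (Sh z ^+ 2 * Pw 3 z)).
Proof.
have h := is_derive_fmul (is_derive_Sh z) (is_derive_Pw 2 z).
apply: (is_derive_eq h); rewrite Pw1 !Pwn.
have c0 := Ch_gt0 z; field; by rewrite gt_eqF.
Qed.
Lemma HgN z : Hg (- z) = - Hg z.
Proof. by rewrite /Hg ShN /Pw ChN mulNr. Qed.
Lemma Hg_ge0 z : 0 <= z -> 0 <= Hg z.
Proof.
move=> z0; rewrite /Hg mulr_ge0 ?(ltW (Pw_gt0 _ _))//.
by rewrite divr_ge0// subr_ge0 ler_expR -subr_ge0 opprK addr_ge0.
Qed.
Lemma Fg_spread (eta : R) : 0 < eta -> exists z0, forall z, z0 <= z -> pi - eta <= Fg z - Fg (- z) <= pi.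
Proof.
move=> e0; have p0 := @pi_gt0 R.
pose d := Num.min (eta / 4) (pi / 8).
have d0 : 0 < d by rewrite lt_min !divr_gt0.
have d1 : d <= eta / 4 by rewrite ge_min lexx.
have d2 : d <= pi / 8 by rewrite ge_min lexx orbT.
have tA : atan (tan (pi / 2 - d)) = pi / 2 - d by apply: tanK; rewrite in_itv /=; apply/andP; split; lra.
have tB : atan (tan d) = d by apply: tanK; rewrite in_itv /=; apply/andP; split; lra.
have td : 0 < tan d by rewrite -(tan0 R) ; have := @lt_atan R; rewrite ltNge => _; apply/negP => /(@le_atan R); rewrite tB tan0 atan0; lra.
exists (Num.max (tan (pi / 2 - d)) (tan d)^-1) => z; rewrite ge_max => /andP[h1 h2].
have z0 : 0 < z by apply: lt_le_trans h2; rewrite invr_gt0.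
have ez : z <= expR z by apply: le_trans (expR_ge1Dx z); rewrite lerDr.
have a1 : pi / 2 - d <= atan (expR z) by rewrite -tA; apply: le_atan; exact: le_trans ez.
have a2 : atan (expR (- z)) <= d.
  rewrite -[X in _ <= X]tB; apply: le_atan; rewrite expRN -[X in _ <= X]invrK lef_pV2 ?posrE ?invr_gt0 ?expR_gt0//.
  exact: le_trans ez.
have a3 := @atan_ltpi2 R (expR z).
have a4 : 0 <= atan (expR (- z)) by rewrite -(@atan0 R); apply: le_atan; exact/ltW/expR_gt0.
by rewrite /Fg; apply/andP; split; lra.
Qed.
Lemma Pw_half_small (eta : R) : 0 < eta -> exists z0, forall z, z0 <= z -> Pw (1 / 2) z <= eta.
Proof.
move=> e0; exists (2 / eta ^+ 2) => z hz.
have z0 : 0 < z by apply: lt_le_trans hz; rewrite divr_gt0// exprn_gt0.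
rewrite -ler_sqr ?nnegrE ?(ltW e0) ?(ltW (Pw_gt0 _ _))// Pw_half.
rewrite -[X in _ <= X]invrK lef_pV2 ?posrE ?invr_gt0 ?exprn_gt0 ?Ch_gt0//.
rewrite /Ch ler_pdivlMr//; apply: le_trans (_ : expR z <= _); last by rewrite lerDl ltW// expR_gt0.
apply: le_trans (expR_ge1Dx z); rewrite ler_wpDl//; apply: le_trans hz; by rewrite mulrC.
Qed.

Lemma PwN p z : Pw p (- z) = Pw p z. Proof. by rewrite /Pw ChN. Qed.

(** Subtracting eps makes the profile vanish at the ends at a cost of order eps. *)
Lemma pow6_cut (s eps : R) : 0 < eps -> eps <= s -> s <= 1 -> s ^+ 6 - 6 * eps * s ^+ 2 <= (s - eps) ^+ 6.
Proof.
move=> e0 es s1; have s0 : 0 <= s by exact: le_trans (ltW e0) es.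
have a1 : `|s - eps| <= s by rewrite ger0_norm ?subr_ge0// gerBl ltW.
have a2 : `|s| <= s by rewrite ger0_norm.
have a3 : `|(s - eps) - s| <= eps by rewrite addrAC subrr sub0r normrN ger0_norm// ltW.
have := pow_near 5 a1 a2 a3; rewrite ler_norml => /andP[n1 _].
have s5 : s ^+ 5 * eps <= s ^+ 2 * eps.
  by rewrite ler_pM2r// (exprD s 3 2) ler_piMl ?exprn_ge0// exprn_ile1.
move: n1 s5; clear; lra.
Qed.
Opaque Pw Ch Sh Fg Hg.

(** The soliton at scale lam, centred at the middle of [0, l] and lowered by its
    value at the ends.  For the full soliton the three integrals would be pi,
    pi / 8 and pi / 2, the last two up to the factor lam^2. *)
Lemma soliton_profile l (eta : R) : 0 < l -> 0 < eta -> exists lam0, forall lam, lam0 <= lam ->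
  exists f g : R -> R, [/\ abscont l f g, f 0 = 0, f l = 0 &
  [/\ 0 < itg 0 l (fun x => f x ^+ 2), itg 0 l (fun x => f x ^+ 2) <= pi,
     itg 0 l (fun x => g x ^+ 2) <= lam ^+ 2 * (pi / 8) &
     lam ^+ 2 * (pi / 2 - eta) <= itg 0 l (fun x => f x ^+ 6)]].
Proof.
move=> l0 e0; have p0 := @pi_gt0 R.
pose et := Num.min eta (pi / 4).
have ee0 : 0 < et by rewrite lt_min e0 divr_gt0.
have [z1 hz1] := Fg_spread ee0.
have ke : 0 < et / (12 * pi) by rewrite divr_gt0// mulr_gt0.
have [z2 hz2] := Pw_half_small ke.
have et1 : et <= eta by rewrite ge_min lexx.
have et2 : et <= pi / 4 by rewrite ge_min lexx orbT.
exists (2 / l * Num.max 1 (Num.max z1 z2)) => lam hlam.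
pose X := lam * l / 2.
have hX : Num.max 1 (Num.max z1 z2) <= X.
  have : 2 / l * Num.max 1 (Num.max z1 z2) * (l / 2) <= lam * (l / 2) by rewrite ler_pM2r// divr_gt0.
  have -> : 2 / l * Num.max 1 (Num.max z1 z2) * (l / 2) = Num.max 1 (Num.max z1 z2) by field; rewrite gt_eqF.
  by rewrite mulrA.
move: hX; rewrite !ge_max => /and3P[X1 /hz1 /andP[F1 F2] /hz2 P1].
have X0 : 0 < X by apply: lt_le_trans X1.
have lam0 : 0 < lam by move: X0; rewrite /X; rewrite -mulrA pmulr_lgt0// divr_gt0.
pose Z x := lam * (x - l / 2).
have Z0 : Z 0 = - X by rewrite /Z /X; field.
have Zl : Z l = X by rewrite /Z /X; field.
have dZ x : is_derive x 1 Z lam.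
  have h := is_derive_fscale lam (is_derive_fadd (@is_derive_id _ _ x 1) (is_derive_fcst (- (l / 2)) x)).
  by apply: (is_derive_eq h); rewrite addr0 mulr1.
pose eps := Pw (1 / 2) X; have eps0 : 0 < eps by exact: Pw_gt0.
pose f x := Num.sqrt lam * (Pw (1 / 2) (Z x) - eps).
pose g x := Num.sqrt lam * (lam * (- (1 / 2) * (Sh (Z x) / Ch (Z x)) * Pw (1 / 2) (Z x))).
have sl : Num.sqrt lam ^+ 2 = lam by rewrite sqr_sqrtr// ltW.
have half0 : 0 <= 1 / 2 :> R by rewrite divr_ge0.
have cZ a b : cts a b Z by exact: is_derive_cts dZ.
have cCh : continuous Ch by move=> x; apply: differentiable_continuous; apply/derivable1_diffP; have := is_derive_Ch x; case.
have cSh : continuous Sh by move=> x; apply: differentiable_continuous; apply/derivable1_diffP; have := is_derive_Sh x; case.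
have cPw p : continuous (Pw p) by move=> x; apply: differentiable_continuous; apply/derivable1_diffP; have := is_derive_Pw p x; case.
have df x : is_derive x 1 f (g x).
  have h1 := @is_derive_fcomp _ (Pw (1 / 2)) Z x _ _ (is_derive_Pw (1 / 2) (Z x)) (dZ x).
  have h2 := is_derive_fscale (Num.sqrt lam) (is_derive_fadd h1 (is_derive_fcst (- eps) x)).
  by apply: (is_derive_eq h2); rewrite addr0.
have c1 p a b : cts a b (fun x => Pw p (Z x)) by apply: (cts_compl (cPw p)).
have c2 a b : cts a b (fun x => Sh (Z x)) by apply: (cts_compl cSh).
have cg a b : cts a b g.
  have : cts a b (fun x => Num.sqrt lam * (lam * (- (1 / 2) * (Sh (Z x) * Pw 1 (Z x)) * Pw (1 / 2) (Z x)))).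
    by apply: ctsM; [exact: cts_cst|apply: ctsM; [exact: cts_cst|apply: ctsM => //; apply: ctsM; [exact: cts_cst|exact: ctsM]]].
  by apply: cts_eq => x _; rewrite Pw1.
have cf a b : cts a b f by exact: is_derive_cts df.
have pf : prim 0 l f g by apply: prim_C1.
have P3 x : Ch x ^+ 2 * Pw 3 x = Pw 1 x by rewrite Pw1 Pwn; field; rewrite gt_eqF// Ch_gt0.
have dF x : is_derive x 1 (fun x => Fg (Z x)) (lam * Pw 1 (Z x)).
  exact: is_derive_fcomp (is_derive_Fg (Z x)) (dZ x).
have dH x : is_derive x 1 (fun x => Hg (Z x)) (lam * (Pw 1 (Z x) - 2 * (Sh (Z x) ^+ 2 * Pw 3 (Z x)))).
  exact: is_derive_fcomp (is_derive_Hg (Z x)) (dZ x).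
have pF : prim 0 l (fun x => Fg (Z x)) (fun x => lam * Pw 1 (Z x)).
  apply: prim_C1 => // ; first exact: is_derive_cts dF.
  by apply: ctsM => //; exact: cts_cst.
have pH : prim 0 l (fun x => Hg (Z x)) (fun x => lam * (Pw 1 (Z x) - 2 * (Sh (Z x) ^+ 2 * Pw 3 (Z x)))).
  apply: prim_C1 => //; first exact: is_derive_cts dH.
  apply: ctsM; first exact: cts_cst.
  have : cts 0 l (fun x => Pw 1 (Z x) + -2 * (Sh (Z x) ^+ 2 * Pw 3 (Z x))).
    by apply: ctsD => //; apply: ctsM; [exact: cts_cst|apply: ctsM => //; exact: ctsX].
  by apply: cts_eq => x _; rewrite mulNr.
have iF : itg 0 l (fun x => lam * Pw 1 (Z x)) = Fg X - Fg (- X).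
  by have [_ /(_ 0 l (lexx _) (ltW l0) (lexx _)) <-] := pF; rewrite Z0 Zl.
have iH : itg 0 l (fun x => lam * (Pw 1 (Z x) - 2 * (Sh (Z x) ^+ 2 * Pw 3 (Z x)))) = 2 * Hg X.
  have [_ /(_ 0 l (lexx _) (ltW l0) (lexx _)) <-] := pH; rewrite Z0 Zl HgN; ring.
have Hg0 : 0 <= Hg X by apply: Hg_ge0; exact: ltW.
have gF := pF.1; have gH := pH.1.
have Zb x : 0 <= x <= l -> `|Z x| <= X.
  move=> /andP[x0 xl]; rewrite normrM (ger0_norm (ltW lam0)) /X -mulrA ler_pM2l// ler_norml.
  by apply/andP; split; lra.
have sge x : 0 <= x <= l -> eps <= Pw (1 / 2) (Z x) by move=> /Zb h; exact: Pw_ge.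
have cf2 : intg 0 l (fun x => f x ^+ 2) by apply: cts_intg; exact: ctsX.
have cf6 : intg 0 l (fun x => f x ^+ 6) by apply: cts_intg; exact: ctsX.
have cg2 : intg 0 l (fun x => g x ^+ 2) by apply: cts_intg; exact: ctsX.
have f2 x : 0 <= x <= l -> f x ^+ 2 <= lam * Pw 1 (Z x).
  move=> hx; have -> : f x ^+ 2 = lam * (Pw (1 / 2) (Z x) - eps) ^+ 2 by rewrite /f exprMn sl.
  rewrite (ler_pM2l lam0) Pw1 -Pw_half; have := sge x hx.
  move: (Pw (1 / 2) (Z x)) => s es; have e0' := eps0; rewrite -subr_ge0.
  have -> : s ^+ 2 - (s - eps) ^+ 2 = eps * (s + (s - eps)) by ring.
  by rewrite mulr_ge0 ?(ltW eps0)// addr_ge0 ?subr_ge0// (le_trans (ltW eps0)).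
have M1 : itg 0 l (fun x => f x ^+ 2) <= pi.
  by apply: le_trans F2; rewrite -iF; exact: itg_le.
have B1 : lam ^+ 2 * (pi / 2 - et) <= itg 0 l (fun x => f x ^+ 6).
  have e1 : lam ^+ 2 / 2 * (Fg X - Fg (- X) + 2 * Hg X) - lam ^+ 2 * 6 * eps * (Fg X - Fg (- X)) <= itg 0 l (fun x => f x ^+ 6).
    rewrite -iF -iH -itgD// -!itgZ//; last exact: intgD.
    rewrite -itgB; [|exact: intgZ (intgD gF gH)|exact: intgZ].
    apply: itg_le => //; first by apply: intgB; [exact: intgZ (intgD gF gH)|exact: intgZ].
    move=> x hx; set s := Pw (1 / 2) (Z x).
    have s0 : 0 < s by exact: Pw_gt0.
    have s1 : s <= 1 by exact: Pw_le1.
    have es : eps <= s by exact: sge.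
    have sq : s ^+ 2 = Pw 1 (Z x) by rewrite Pw1 Pw_half.
    have s6 : Pw 1 (Z x) - Sh (Z x) ^+ 2 * Pw 3 (Z x) = s ^+ 6.
      have -> : s ^+ 6 = (s ^+ 2) ^+ 3 by ring.
      by rewrite sq -[X in X - _](P3 (Z x)) Ch_Sh mulrDl mul1r addrK Pwn Pw1 exprVn.
    have nr := pow6_cut eps0 es s1.
    have -> : f x ^+ 6 = lam ^+ 3 * (s - eps) ^+ 6.
      by rewrite /f -/s exprMn; congr (_ * _); rewrite -[in RHS]sl; ring.
    have lam3 : 0 < lam ^+ 3 by rewrite exprn_gt0.
    have -> : lam ^+ 2 / 2 * (lam * Pw 1 (Z x) + lam * (Pw 1 (Z x) - 2 * (Sh (Z x) ^+ 2 * Pw 3 (Z x)))) - lam ^+ 2 * 6 * eps * (lam * Pw 1 (Z x)) =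
      lam ^+ 3 * ((Pw 1 (Z x) - Sh (Z x) ^+ 2 * Pw 3 (Z x)) - 6 * eps * Pw 1 (Z x)) by field.
    by rewrite s6 -sq (ler_pM2l lam3).
  apply: le_trans e1; have l20 : 0 < lam ^+ 2 by rewrite exprn_gt0.
  have -> : lam ^+ 2 / 2 * (Fg X - Fg (- X) + 2 * Hg X) - lam ^+ 2 * 6 * eps * (Fg X - Fg (- X)) =
    lam ^+ 2 * ((Fg X - Fg (- X)) / 2 + Hg X - 6 * (eps * (Fg X - Fg (- X)))) by field.
  rewrite ler_pM2l//.
  have h3 : eps * (Fg X - Fg (- X)) <= et / (12 * pi) * pi.
    apply: ler_pM => //; first exact: ltW.
    by move: F1 et2 p0; clear; lra.
  have aux (y : R) : 0 < y -> et / (12 * y) * y = et / 12 by move=> y0; field; rewrite gt_eqF.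
  have h4 := aux pi p0.
  rewrite h4 in h3; move: h3 F1 Hg0; clear; lra.
have A1 : itg 0 l (fun x => g x ^+ 2) <= lam ^+ 2 * (pi / 8).
  have e1 : itg 0 l (fun x => g x ^+ 2) = lam ^+ 2 / 8 * (Fg X - Fg (- X) - 2 * Hg X).
    rewrite -iF -iH -itgB// -itgZ; last exact: intgB.
    apply: itg_eq => x _.
    have -> : g x ^+ 2 = lam * (lam * (- (1 / 2) * (Sh (Z x) / Ch (Z x)) * Pw (1 / 2) (Z x))) ^+ 2 by rewrite /g exprMn sl.
    have -> : (lam * (- (1 / 2) * (Sh (Z x) / Ch (Z x)) * Pw (1 / 2) (Z x))) ^+ 2 = lam ^+ 2 / 4 * Sh (Z x) ^+ 2 * ((Ch (Z x))^-1 ^+ 2 * Pw (1 / 2) (Z x) ^+ 2) by field; rewrite (gt_eqF (Ch_gt0 _)).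
    rewrite Pw_half Pw1 Pwn; field; by rewrite (gt_eqF (Ch_gt0 _)).
  rewrite e1; have -> : lam ^+ 2 * (pi / 8) = lam ^+ 2 / 8 * pi by field.
  rewrite ler_wpM2l ?divr_ge0 ?sqr_ge0//; move: F2 Hg0; clear; lra.
have l20 : 0 < lam ^+ 2 by rewrite exprn_gt0.
exists f, g; split.
- by split.
- by rewrite /f Z0 /eps PwN subrr mulr0.
- by rewrite /f Zl subrr mulr0.
split=> //.
- rewrite lt_def itg_ge0 ?andbT; last by move=> x _; exact: sqr_ge0.
  apply/eqP => M0; have : itg 0 l (fun x => f x ^+ 6) <= lam ^+ 2 * itg 0 l (fun x => f x ^+ 2).
    rewrite -itgZ//; apply: itg_le => //; first exact: intgZ.
    move=> x hx; have -> : f x ^+ 6 = (f x ^+ 2) ^+ 2 * f x ^+ 2 by ring.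
    have h : f x ^+ 2 <= lam.
      by apply: le_trans (f2 x hx) _; rewrite ler_piMr ?(ltW lam0)//; exact: Pw_le1.
    by rewrite ler_wpM2r ?sqr_ge0// ler_sqr ?nnegrE ?sqr_ge0// ltW.
  rewrite M0 mulr0 leNgt => /negP; apply; apply: lt_le_trans B1.
  by rewrite mulr_gt0//; move: et2 p0; clear; lra.
- by apply: le_trans B1; rewrite ler_pM2l//; move: et1; clear; lra.
Qed.
End Profile.

(** * Test functions *)

Section TestFunctions.
Local Notation mR := (critical_mass_line _).
Variables (R : realType) (P : periodicity_data R).
Local Notation K := (cell P).
Local Notation G := (periodic_graph P).
Implicit Types (u v g h : graph_fun G).

Lemma itg0 (l : R) : itg 0 l (fun=> 0) = 0.
Proof.
have [l0|l0] := leP 0 l; first by rewrite itg_cst// mul0r.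
by rewrite -(@itg_eq _ 0 l (fun=> 0 * 0) (fun=> 0)) ?itgZ ?intg_cst ?mul0r// => x _; rewrite mul0r.
Qed.
Lemma abscont0 (l : R) : abscont l (fun=> 0) (fun=> 0).
Proof. by split; [exact: prim_cst|exact: intg_cst]. Qed.
Definition on_edge (e0 : edge G) (f : R -> R) : graph_fun G := fun e => if e == e0 then f else fun=> 0.
Lemma on_edge_sobolev e0 (f g : R -> R) : abscont (len G e0) f g -> f 0 = 0 -> f (len G e0) = 0 ->
  [/\ sobolev (on_edge e0 f) (on_edge e0 g), tot (sq_int (on_edge e0 f)) = itg 0 (len G e0) (fun x => f x ^+ 2),
     tot (sq_int (on_edge e0 g)) = itg 0 (len G e0) (fun x => g x ^+ 2) &
     tot (six_int (on_edge e0 f)) = itg 0 (len G e0) (fun x => f x ^+ 6)].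
Proof.
move=> ac f0 fl.
have M (k : R -> R) : summ (sq_int (on_edge e0 k)) /\ tot (sq_int (on_edge e0 k)) = itg 0 (len G e0) (fun x => k x ^+ 2).
  have [] := @tot_fin _ _ (sq_int (on_edge e0 k)) [:: e0] isT (@sq_int_ge0 _ _ _).
    move=> e; rewrite inE /sq_int /on_edge => /negbTE ->; rewrite -[RHS](itg0 (len G e)).
    by apply: itg_eq => x _; rewrite expr0n.
  by rewrite big_seq1 {3}/sq_int /on_edge eqxx.
have [_ S6] := @tot_fin _ _ (six_int (on_edge e0 f)) [:: e0] isT (@six_int_ge0 _ _ _)
  (fun e => ltac:(rewrite inE /six_int /on_edge => /negbTE ->; rewrite -[RHS](itg0 (len G e));
     by apply: itg_eq => x _; rewrite expr0n)).
split; [|exact: (M f).2|exact: (M g).2|by rewrite S6 big_seq1 /six_int /on_edge eqxx].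
split; [|..|exact: (M f).1|exact: (M g).1].
- by move=> e; rewrite /on_edge; case: eqP => [->|_]; [exact: ac|exact: abscont0].
- apply: (@glue_intro _ _ (fun _ _ => 0)) => // i e b; rewrite /end_value /on_edge /=.
  by case: eqP => // <- in f0 fl *; case: b.
Qed.

(** Normalize the mass of the profile on an edge.  The energy is lam^2 times a
    quantity whose limit is negative as soon as m > mu_R. *)
Lemma supercritical (m C : R) : mR < m -> exists u g, [/\ sobolev u g, tot (sq_int u) = m &
  tot (sq_int g) / 2 - tot (six_int u) / 6 <= - C].
Proof.
move=> hm; have p0 := @pi_gt0 R; have mm0 := critical_mass_line_gt0 R; have m0 := lt_trans mm0 hm.
pose e0 : edge G := (0%R : int, (vend (dv P)).1).
have l0 : 0 < len G e0 := len_gt0 _.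
(* sg > 0 measures how far m exceeds the critical mass *)
pose sg := m ^+ 2 / mR ^+ 2 - 1.
have sg0 : 0 < sg by rewrite /sg subr_gt0 ltr_pdivlMr ?exprn_gt0// mul1r ltr_sqr ?nnegrE// ltW.
have msg : m ^+ 2 = (1 + sg) * (3 / 4 * pi ^+ 2).
  by rewrite -critical_mass_line_sq /sg addrC subrK divfK// gt_eqF// exprn_gt0.
pose eta := sg / (1 + sg) * pi / 4.
have s1 : 0 < 1 + sg by rewrite addr_gt0.
have eta0 : 0 < eta by rewrite divr_gt0// mulr_gt0// divr_gt0.
have [lam0 hl] := soliton_profile l0 eta0.
pose q := m / pi * (pi * sg / 32).
have q0 : 0 < q by rewrite mulr_gt0 ?divr_gt0// mulr_gt0.
pose lam := Num.max lam0 (Num.max 1 (`|C| / q)).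
have lam1 : 1 <= lam by rewrite !le_max lexx orbT.
have lamC : `|C| <= lam * q by rewrite -ler_pdivrMr// !le_max lexx !orbT.
have lamlam : lam0 <= lam by rewrite le_max lexx.
have [f [g [ac f0 fl [M0 M1 A1 B1]]]] := hl lam lamlam.
have [su tu tg ts] := on_edge_sobolev ac f0 fl.
move: tu tg ts M0 M1 A1 B1; set u := on_edge e0 f; set h := on_edge e0 g => tu tg ts.
rewrite -tu -tg -ts => M0 M1 A1 B1.
pose kap := m / tot (sq_int u); have kap0 : 0 < kap by rewrite divr_gt0.
pose k := Num.sqrt kap; have kk : k ^+ 2 = kap by rewrite sqr_sqrtr// ltW.
have [sk [tk tkg]] := sobolevZ k su; have [_ tk6] := six_intZ k su (six_summ su).
exists (gscale k u), (gscale k h); split=> //.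
  by rewrite tk kk /kap divfK// gt_eqF.
rewrite tkg tk6 (_ : k ^+ 6 = kap ^+ 3); last by rewrite -kk; ring.
rewrite kk; have kp : m / pi <= kap by rewrite ler_pM2l// lef_pV2 ?posrE.
have mp0 : 0 < m / pi by rewrite divr_gt0.
have k2 : (1 + sg) * (3 / 4) <= kap ^+ 2.
  have : (m / pi) ^+ 2 <= kap ^+ 2 by rewrite ler_sqr ?nnegrE// ltW.
  by rewrite expr_div_n msg mulrA mulfK// gt_eqF// exprn_gt0.
have e1 : (1 + sg) * eta = sg * pi / 4.
  by rewrite /eta; field; rewrite gt_eqF.
have l20 : 0 < lam ^+ 2 by rewrite exprn_gt0// (lt_le_trans ltr01).
have be : 0 <= pi / 2 - eta.
  rewrite subr_ge0 -(ler_pM2l s1) e1; have : 0 < sg * pi by rewrite mulr_gt0.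
  by move: p0; clear; lra.
have B2 : (1 + sg) * (3 / 4) * (lam ^+ 2 * (pi / 2 - eta)) <= kap ^+ 2 * tot (six_int u).
  by apply: ler_pM => //; rewrite mulr_ge0// ltW.
have E1 : tot (sq_int h) / 2 - kap ^+ 2 * tot (six_int u) / 6 <= - (lam ^+ 2 * (pi * sg / 32)).
  have e2 : (1 + sg) * (3 / 4) * (lam ^+ 2 * (pi / 2 - eta)) = lam ^+ 2 * (3 / 8 * pi + 3 / 8 * (sg * pi) - 3 / 4 * ((1 + sg) * eta)) by field.
  rewrite e2 e1 in B2; move: A1 B2; clear; lra.
have -> : kap * tot (sq_int h) / 2 - kap ^+ 3 * tot (six_int u) / 6 = kap * (tot (sq_int h) / 2 - kap ^+ 2 * tot (six_int u) / 6) by ring.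
apply: le_trans (_ : kap * - (lam ^+ 2 * (pi * sg / 32)) <= _); first by rewrite ler_pM2l.
rewrite mulrN lerN2; apply: le_trans (ler_norm C) _; apply: le_trans lamC _.
apply: le_trans (_ : lam ^+ 2 * q <= _).
  by rewrite ler_pM2r// expr2 ler_peMl// (le_trans ler01).
have z : 0 <= lam ^+ 2 * (pi * sg / 32) := mulr_ge0 (ltW l20) (divr_ge0 (mulr_ge0 (ltW p0) (ltW sg0)) (ler0n R 32)).
by rewrite /q mulrCA ler_wpM2r.
Qed.

(** The function equal to 1 on the cells 1 to n and interpolated linearly to 0 on
    the two neighbouring cells: its squared derivative does not depend on n, and its mass
    grows linearly. *)
Lemma spreading (m eps : R) : 0 < m -> 0 < eps -> exists u g, [/\ sobolev u g, tot (sq_int u) = m & tot (sq_int g) <= eps].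
Proof.
move=> m0 eps0; pose lm := lmin P; have lm0 : 0 < lm by exact: lmin_gt0.
pose es := es P; pose cA : R := (2 * size es)%:R / lm.
have cA0 : 0 <= cA by rewrite divr_ge0// ltW.
pose n := (Num.bound (m * cA / (lm * eps))).+1.
have hn : m * cA / (lm * eps) < n%:R.
  apply: lt_trans (_ : (Num.bound (m * cA / (lm * eps)))%:R < _); last by rewrite ltr_nat.
  apply: archi_boundP; exact: divr_ge0 (mulr_ge0 (ltW m0) cA0) (ltW (mulr_gt0 lm0 eps0)).
pose phi (i : int) : R := if (0 <= i) && (i <= n%:Z) then 1 else 0.
pose W (i : int) (v : vtx K) : R := if v \in @pasteR _ P then phi (i - 1) else phi i.
have hW i d : pasteD d -> W i d = W (i + 1) (paste (p:=P) d).
  move=> hd; rewrite /W addrK.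
  have -> : paste d \in @pasteR _ P by apply/mem_set; exact: pasteR_img.
  have -> // : d \in @pasteR _ P = false.
  apply/negbTE/negP => /set_mem hr.
  have : (@pasteD _ P `&` @pasteR _ P) d by split.
  by rewrite paste_disj.
pose a (e : edge G) : R := W e.1 (endpoint K e.2 false).
pose b (e : edge G) : R := W e.1 (endpoint K e.2 true).
pose u : graph_fun G := fun e => lin (len G e) (a e) (b e).
pose g : graph_fun G := fun e => fun=> (b e - a e) / len G e.
have phi01 i : phi i = 0 \/ phi i = 1 by rewrite /phi; case: ifP; [right|left].
have W01 i (y : vtx K) : W i y = 0 \/ W i y = 1 by rewrite /W; case: ifP.
have gE e : sq_int g e = (b e - a e) ^+ 2 / len G e.
  have l0 := len0 e; have := @itg_cst _ 0 (len G e) (((b e - a e) / len G e) ^+ 2) (ltW l0).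
  by rewrite /sq_int /g => ->; rewrite subr0; field; rewrite gt_eqF.
have d1 e : (b e - a e) ^+ 2 <= 1.
  by rewrite /a /b; case: (W01 e.1 (endpoint K e.2 true)) => ->; case: (W01 e.1 (endpoint K e.2 false)) => ->; lra.
have g1 e : sq_int g e <= lm^-1.
  rewrite gE -[X in _ <= X]mul1r; apply: ler_pM => //; first exact: sqr_ge0.
    by rewrite invr_ge0 ltW// len0.
  by rewrite lef_pV2 ?posrE ?len0//; exact: lmin_le.
have Wc i (y : vtx K) : phi i = phi (i - 1) -> W i y = phi i by rewrite /W => ->; case: ifP.
have gz (e : edge G) : e \notin [seq (i, f) | i <- [:: 0%R : int; n.+1%:Z], f <- es] -> sq_int g e = 0.
  case: e => i f h; have hi : phi i = phi (i - 1).
    have h0 : i <> 0 /\ i <> n.+1%:Z.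
      split=> hi; move/negP: h; apply; apply/allpairsP; exists (i, f); split=> //; rewrite ?es_all//= !inE hi eqxx ?orbT//.
    rewrite /phi; case: h0 => h1 h2; congr (if _ then _ else _); lia.
  by rewrite gE /a /b /= !Wc// subrr expr0n mul0r.
have uq (t : seq int) : uniq t -> uniq [seq (i, f) | i <- t, f <- es].
  by move=> ut; apply: allpairs_uniq => //; [exact: es_uniq|move=> [? ?] [? ?]].
have [sg tg] := tot_fin (uq [:: 0%R : int; n.+1%:Z] isT) (@sq_int_ge0 _ _ g) gz.
have tgA : tot (sq_int g) <= cA.
  rewrite tg; apply: le_trans (_ : \sum_(e <- [seq (i, f) | i <- [:: 0%R : int; n.+1%:Z], f <- es]) lm^-1 <= _).
    by apply: ler_sum.
  by rewrite big_const_seq count_predT iter_addr_0 size_allpairs /= -mulr_natl.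
have uz (e : edge G) : e \notin [seq (i, f) | i <- map Posz (iota 0 n.+2), f <- es] -> sq_int u e = 0.
  case: e => i f h; have hi : phi i = 0 /\ phi (i - 1) = 0.
    have h0 : ~~ ((0 <= i) && (i <= n.+1%:Z)).
      apply/negP => /andP[i0 i1]; move/negP: h; apply; apply/allpairsP; exists (i, f); split=> //; last exact: es_all.
      apply/mapP; exists `|(i : int)|%N; last by rewrite /= gez0_abs.
      by rewrite mem_iota; move: i0 i1; clear; lia.
    by split; rewrite /phi; case: ifP => // h1; exfalso; move: h0 h1; clear; lia.
  have hW0 (y : vtx K) : W i y = 0 by rewrite /W; case: ifP => _; [exact: hi.2|exact: hi.1].
  rewrite /sq_int -[RHS](itg0 (len G (i, f))); apply: itg_eq => x _.
  by rewrite /u /lin /a /b /= !hW0 subrr mul0r mul0r addr0 expr0n.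
have [su tu] := tot_fin (uq (map Posz (iota 0 n.+2)) ltac:(by rewrite map_inj_uniq ?iota_uniq// => ? ? [])) (@sq_int_ge0 _ _ u) uz.
pose f0 := (vend (dv P)).1.
have mlow : n%:R * lm <= tot (sq_int u).
  apply: le_trans (_ : \sum_(e <- [seq ((i%:Z, f0) : edge G) | i <- iota 1 n]) sq_int u e <= _); last first.
    by apply: tot_ub => //; rewrite map_inj_uniq ?iota_uniq// => ? ? [].
  apply: le_trans (_ : \sum_(e <- [seq ((i%:Z, f0) : edge G) | i <- iota 1 n]) lm <= _).
    by rewrite big_const_seq count_predT iter_addr_0 size_map size_iota -[X in _ <= X]mulr_natl.
  rewrite big_seq [X in _ <= X]big_seq; apply: ler_sum => e /mapP[i]; rewrite mem_iota => /andP[i1 i2] ->.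
  have hi : phi i%:Z = 1 /\ phi (i%:Z - 1) = 1.
    by split; rewrite /phi; case: ifP => // h1; exfalso; move: i1 i2 h1; clear; lia.
  have hW0 (y : vtx K) : W i%:Z y = 1 by rewrite /W; case: ifP => _; [exact: hi.2|exact: hi.1].
  rewrite /sq_int (@itg_eq _ 0 _ _ (fun=> 1)); last first.
    by move=> x _; rewrite /u /lin /a /b /= !hW0 subrr mul0r mul0r addr0 expr1n.
  by rewrite itg_cst ?subr0 ?mul1r ?(ltW (len0 _))//; exact: lmin_le.
have sob_u : sobolev u g.
  split=> //.
  - by move=> e; split; [exact: lin_prim|exact: (intg_cst _ _ (((b e - a e) / len G e) ^+ 2))].
  - apply: (glue_intro hW) => i e c; rewrite /end_value /u /lin /a /b /=.
    have l0 : 0 < len K e := len_gt0 e.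
    case: c; last by rewrite mulr0 addr0.
    by rewrite divfK ?gt_eqF// addrC subrK.
have n0 : 0 < n%:R :> R by rewrite ltr0n.
have M0 : 0 < tot (sq_int u) by apply: lt_le_trans mlow; rewrite mulr_gt0.
pose kap := m / tot (sq_int u); have kap0 : 0 < kap by rewrite divr_gt0.
pose k := Num.sqrt kap; have kk : k ^+ 2 = kap by rewrite sqr_sqrtr// ltW.
have [sk [tk tkg]] := sobolevZ k sob_u.
exists (gscale k u), (gscale k g); split=> //; first by rewrite tk kk divfK// gt_eqF.
rewrite tkg kk; apply: le_trans (_ : kap * cA <= _); first by rewrite ler_pM2l.
rewrite /kap mulrAC ler_pdivrMr//.
apply: le_trans (_ : eps * (n%:R * lm) <= _); last by rewrite ler_pM2l.
have -> : eps * (n%:R * lm) = n%:R * (lm * eps) by ring.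
by rewrite -ler_pdivrMr ?mulr_gt0// ltW.
Qed.
End TestFunctions.

(** * Minimizers from minimizing sequences *)

Section Existence.
Variables (R : realType) (P : periodicity_data R).
Local Notation K := (cell P).
Local Notation G := (periodic_graph P).
Implicit Types (u v g h : graph_fun G).

(** y <= t + y^3 / t^2 for all t > 0 bounds the mass of an edge by t times its
    length if the sixth powers vanish. *)
Lemma six_pos u g : sobolev u g -> 0 < tot (sq_int u) -> 0 < tot (six_int u).
Proof.
move=> su m0; have [_ _ sm _] := su; have s6 := six_summ su.
rewrite lt_def tot_ge0// andbT; apply/eqP => B0.
have H e : six_int u e = 0.
  by apply/eqP; rewrite eq_le six_int_ge0 andbT -B0; exact: tot_ub1.
have M e : sq_int u e <= 0.
  apply/ler_addgt0Pr => d d0; rewrite add0r; have l0 := len0 e.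
  pose t := d / len G e; have t0 : 0 < t by rewrite divr_gt0.
  have i2 := sobolev_intgX e 2 su; have i6 := sobolev_intgX e 6 su.
  have -> : d = itg 0 (len G e) (fun x => t + t^-2 * u e x ^+ 6).
    rewrite itgD ?intg_cst//; last exact: intgZ.
    by rewrite itg_cst ?ltW// subr0 itgZ// -/(six_int u e) H mulr0 addr0 divfK// gt_eqF.
  apply: itg_le => //; first by apply: intgD; [exact: intg_cst|exact: intgZ].
  move=> x _; have y0 := sqr_ge0 (u e x); set y := u e x ^+ 2 in y0 *.
  have -> : u e x ^+ 6 = y ^+ 3 by rewrite /y; ring.
  have t2 : 0 <= t^-2 by rewrite invr_ge0 exprn_ge0// ltW.
  have [h|h] := leP y t; first by apply: le_trans h _; rewrite lerDl mulr_ge0// exprn_ge0.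
  apply: le_trans (_ : t^-2 * y ^+ 3 <= _); last by rewrite lerDr ltW.
  rewrite ler_pdivlMl ?exprn_gt0// mulrC [y ^+ 3]exprS ler_wpM2l//.
  by rewrite ler_sqr ?nnegrE// ltW.
have : tot (sq_int u) <= 0.
  by apply: tot_lub => s us; apply: sumr_le0 => e _; exact: M.
by rewrite leNgt m0.
Qed.

(** Otherwise u^2 would be uniformly small, and B is at most the square of its
    supremum times the mass. *)
Lemma concentration (mu a beta : R) : 0 <= mu -> 0 <= a -> 0 < beta -> exists2 c : R, 0 < c &
  forall u g, sobolev u g -> tot (sq_int u) <= mu -> tot (sq_int g) <= a -> beta <= tot (six_int u) ->
  exists i, c <= csum (sq_int u) i.
Proof.
move=> mu0 a0 b0.
pose M0 := Num.min 1 (beta / (2 * (mu + 1))).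
have mu1 : 0 < mu + 1 by rewrite ltr_wpDl.
have M00 : 0 < M0 by rewrite lt_min ltr01 divr_gt0// mulr_gt0.
have M01 : M0 <= 1 by rewrite ge_min lexx.
have M0b : M0 * (2 * (mu + 1)) <= beta by rewrite -ler_pdivlMr ?mulr_gt0// ge_min lexx orbT.
pose t := 2 * (a + 1) / M0; have t0 : 0 < t by rewrite divr_gt0// mulr_gt0// ltr_wpDl.
have ta : t^-1 * a <= M0 / 2.
  rewrite ler_pdivrMl//; have -> : t * (M0 / 2) = a + 1 by rewrite /t; field; rewrite gt_eqF.
  by rewrite lerDl.
have lm0 := lmin_gt0 P; set lm := lmin P in lm0.
have lt0 : 0 < lm^-1 + t by rewrite addr_gt0 ?invr_gt0.
pose c := M0 / 2 / (lm^-1 + t); have c0 : 0 < c by rewrite !divr_gt0.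
exists c => // u g su hm ha hb; apply: contrapT => hn.
have small i : csum (sq_int u) i < c by rewrite ltNge; apply/negP => h; apply: hn; exists i.
have [ac _ sm sg] := su.
have H i e x : 0 <= x <= len K e -> u (i, e) x ^+ 2 <= M0.
  move=> hx; apply: le_trans (loc_sup (len_gt0 e) (ac (i, e)) hx) _.
  have h1 := cross_le (ac (i, e)) t0.
  have h2 : (len K e)^-1 * sq_int u (i, e) <= lm^-1 * sq_int u (i, e).
    by rewrite ler_wpM2r ?sq_int_ge0// lef_pV2 ?posrE ?len_gt0//; exact: (lmin_le ((i, e) : edge G)).
  have h3 : sq_int u (i, e) <= c by apply: le_trans (ltW (small i)); exact: (csum_ub _ _ (sq_int_ge0 u)).
  have h4 : t^-1 * sq_int g (i, e) <= t^-1 * a.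
    by rewrite ler_wpM2l ?invr_ge0 ?(ltW t0)//; apply: le_trans ha; exact: tot_ub1.
  have h5 : (lm^-1 + t) * sq_int u (i, e) <= (lm^-1 + t) * c by rewrite ler_pM2l.
  have h6 : (lm^-1 + t) * c = M0 / 2 by rewrite /c mulrC divfK// gt_eqF.
  rewrite h6 in h5; rewrite -/(sq_int u (i, e)) -/(sq_int g (i, e)) in h1 *.
  by move: h1 h2 h4 h5 ta; rewrite /=; lra.
have [_ h1] := six_le_sup su H.
have m1 := tot_ge0 sm.
have h2 : M0 ^+ 2 * tot (sq_int u) <= M0 * mu.
  by apply: ler_pM => //; [exact: sqr_ge0|rewrite expr2 ler_piMl// ltW].
move: (le_trans hb (le_trans h1 h2)) M0b M00 mu0; clear; nra.
Qed.

(** Scale v to mass mu: the quadratic terms scale by q and the sixth power by q^3,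
    so that after division by q an excess of q^2 - 1 sixth powers is left. *)
Lemma excess_bound (mu e : R) v h : 0 < mu ->
  (forall v h, sobolev v h -> tot (sq_int v) = mu -> e <= tot (sq_int h) / 2 - tot (six_int v) / 6) ->
  sobolev v h -> 0 < tot (sq_int v) ->
  ((mu / tot (sq_int v)) ^+ 2 - 1) * (tot (six_int v) / 6) <= tot (sq_int h) / 2 + (- e / mu) * tot (sq_int v) - tot (six_int v) / 6.
Proof.
move=> mu0 he sv m0; set q := mu / tot (sq_int v).
have q0 : 0 < q by rewrite divr_gt0.
pose k := Num.sqrt q; have kk : k ^+ 2 = q by rewrite sqr_sqrtr// ltW.
have [sk [tk tkg]] := sobolevZ k sv; have [_ tk6] := six_intZ k sv (six_summ sv).
have := he _ _ sk; rewrite tk kk {1}/q divfK ?gt_eqF// => /(_ erefl).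
rewrite tkg tk6 kk (_ : k ^+ 6 = q ^+ 3); last by rewrite -kk; ring.
move=> h1.
have -> : - e / mu * tot (sq_int v) = - (q^-1 * e) by rewrite /q; field; rewrite !gt_eqF.
have h2 : q^-1 * e <= q^-1 * (q * tot (sq_int h) / 2 - q ^+ 3 * tot (six_int v) / 6) by rewrite ler_wpM2l// invr_ge0 ltW.
have h3 : q^-1 * (q * tot (sq_int h) / 2 - q ^+ 3 * tot (six_int v) / 6) = tot (sq_int h) / 2 - q ^+ 2 * (tot (six_int v) / 6).
  by field; rewrite gt_eqF.
rewrite h3 in h2; move: h2; clear; lra.
Qed.

(** Apply [compactness] with the Lagrange multiplier - e / mu to translates that
    keep mass in the cell 0.  By [excess_bound] the limit has mass mu, since it is
    nonzero and does not lie above the line. *)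
Lemma minimizer (mu e a beta : R) (u g : nat -> graph_fun G) : 0 < mu -> e <= 0 -> 0 < beta ->
  (forall v h : graph_fun G, sobolev v h -> tot (sq_int v) = mu -> e <= tot (sq_int h) / 2 - tot (six_int v) / 6) ->
  (forall n, sobolev (u n) (g n)) -> (forall n, tot (sq_int (u n)) = mu) -> (forall n, tot (sq_int (g n)) <= a) ->
  (forall n, beta <= tot (six_int (u n))) ->
  (forall eps, 0 < eps -> exists N, forall n, (N <= n)%N -> tot (sq_int (g n)) / 2 - tot (six_int (u n)) / 6 <= e + eps) ->
  exists w k : graph_fun G, [/\ sobolev w k, tot (sq_int w) = mu & tot (sq_int k) / 2 - tot (six_int w) / 6 = e].
Proof.
move=> mu0 e0 b0 he su hm ha hb hl.
have a0 : 0 <= a by have [_ h0] := sobolev_tot_ge0 (su 0); exact: le_trans (ha 0).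
have [c c0 hc] := concentration (ltW mu0) a0 b0.
have X n : exists i, c <= csum (sq_int (u n)) i by apply: hc (su n) _ (ha n) (hb n); rewrite hm.
have [i hi] := choice X.
pose om := - e / mu; have om0 : 0 <= om by rewrite divr_ge0 ?oppr_ge0// ltW.
have om1 : om * mu = - e by rewrite /om divfK// gt_eqF.
pose u' n := gshift (i n) (u n); pose g' n := gshift (i n) (g n).
have S n := sobolev_shift (i n) (su n).
have S6 n := (six_shift (i n) (six_summ (su n))).2.
have hJ v h : sobolev v h -> tot (sq_int v) <= mu -> 0 <= tot (sq_int h) / 2 + om * tot (sq_int v) - tot (six_int v) / 6.
  move=> sv vm; have [v0 h0] := sobolev_tot_ge0 sv; have s0 := tot_ge0 (six_summ sv).
  have [z|z] := eqVneq (tot (sq_int v)) 0.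
    have := rough_GN sv; rewrite z expr0n /= !mulr0 mul0r => B0.
    by rewrite addr0 subr_ge0; move: B0 h0; clear; lra.
  have {z} v1 : 0 < tot (sq_int v) by rewrite lt_def z.
  apply: le_trans (excess_bound mu0 he sv v1); rewrite mulr_ge0 ?divr_ge0// subr_ge0.
  have q1 : 1 <= mu / tot (sq_int v) by rewrite ler_pdivlMr// mul1r.
  by rewrite expr2 -[1]mulr1 ler_pM.
have [|||||w [k [sw w0 w1 hw]]] := @compactness R P om mu a c u' g' om0 hJ _ _ _ c0.
- by move=> n; have [] := S n.
- by move=> n; have [_ -> _] := S n; rewrite hm.
- by move=> n; have [_ _ ->] := S n.
- move=> n; have -> : csum (sq_int (u' n)) 0 = csum (sq_int (u n)) (i n); last exact: hi.
  by rewrite -[in RHS](add0r (i n)).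
- move=> eps eps0; have [N hN] := hl eps eps0; exists N => n Nn.
  have [_ -> ->] := S n; rewrite (S6 n) hm om1; have := hN n Nn; clear; lra.
exists w, k; have B0 := six_pos sw w0.
have hx := le_trans (excess_bound mu0 he sw w0) hw.
have q1 : (mu / tot (sq_int w)) ^+ 2 <= 1.
  have B6 : 0 < tot (six_int w) / 6 by rewrite divr_gt0.
  by rewrite -subr_le0 -(pmulr_lle0 _ B6).
have mw : tot (sq_int w) = mu.
  apply/eqP; rewrite eq_le w1 /=.
  have : mu / tot (sq_int w) <= 1 by rewrite -(@ler_sqr _ _ 1) ?nnegrE ?divr_ge0 ?(ltW mu0) ?(ltW w0)// expr1n.
  by rewrite ler_pdivrMr// mul1r.
split=> //; apply/eqP; rewrite eq_le he// andbT.
by move: hw; rewrite mw om1; clear; lra.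
Qed.
End Existence.

(** * Ground states and the critical mass *)

Section Main.
Local Notation mR := (critical_mass_line _).
Variables (R : realType) (P : periodicity_data R).
Local Notation K := (cell P).
Local Notation G := (periodic_graph P).
Implicit Types (u v g h : graph_fun G).

Definition energyR u g : R := tot (sq_int g) / 2 - tot (six_int u) / 6.
Lemma en_scale k u g : sobolev u g -> energyR (gscale k u) (gscale k g) = k ^+ 2 * tot (sq_int g) / 2 - k ^+ 6 * tot (six_int u) / 6.
Proof.
by move=> su; have [_ [_ t]] := sobolevZ k su; have [_ t6] := six_intZ k su (six_summ su); rewrite /energyR t t6.
Qed.
Lemma scale_to (m : R) u g : 0 < m -> sobolev u g -> 0 < tot (sq_int u) -> exists k, [/\ 0 < k ^+ 2,
  k ^+ 2 * tot (sq_int u) = m, sobolev (gscale k u) (gscale k g) & tot (sq_int (gscale k u)) = m].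
Proof.
move=> m0 su u0; have q0 : 0 < m / tot (sq_int u) by rewrite divr_gt0.
exists (Num.sqrt (m / tot (sq_int u))); rewrite sqr_sqrtr ?(ltW q0)//.
have e : m / tot (sq_int u) * tot (sq_int u) = m by rewrite divfK// gt_eqF.
have [sk [tk _]] := sobolevZ (Num.sqrt (m / tot (sq_int u))) su.
by split=> //; rewrite tk sqr_sqrtr ?(ltW q0).
Qed.

Lemma gnP (C : R) : gagliardo_nirenberg G C <->
  forall u g, sobolev u g -> tot (six_int u) <= C * tot (sq_int u) ^+ 2 * tot (sq_int g).
Proof.
split=> H u.
- move=> g su; have [h1 e] := sobolev_deriv su; have := H u h1.
  by rewrite e (Lp2E su) (Lp6E su (six_summ su)) -EFin_expe -!EFinM lee_fin.
- move=> h1; have su := in_H1_sobolev h1; have [_ e] := sobolev_deriv su; have := H _ _ su.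
  by rewrite e (Lp2E su) (Lp6E su (six_summ su)) -EFin_expe -!EFinM lee_fin.
Qed.
Local Notation CG := (GN_constant G).
Local Notation muG := (critical_mass G).
Lemma gn36 : gagliardo_nirenberg G 36.
Proof. by apply/gnP => u g su; exact: rough_GN. Qed.
Lemma gn_witness : exists u g, [/\ sobolev u g, 0 < tot (sq_int u), 0 < tot (six_int u) & 0 < tot (sq_int g)].
Proof.
have [u [g [su mu _]]] := @spreading R P 1 1 ltr01 ltr01.
have m0 : 0 < tot (sq_int u) by rewrite mu.
have s0 := six_pos su m0; exists u, g; split=> //.
rewrite lt_def (sobolev_tot_ge0 su).2 andbT; apply/eqP => A0.
by have := rough_GN su; rewrite A0 mulr0 leNgt s0.
Qed.
Lemma gn_gt0 C : gagliardo_nirenberg G C -> 0 < C.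
Proof.
move=> /gnP H; have [u [g [su m0 s0 A0]]] := gn_witness.
have := lt_le_trans s0 (H _ _ su).
by rewrite -mulrA pmulr_lgt0// mulr_gt0// exprn_gt0.
Qed.
Lemma gn_has_inf : has_inf [set C | gagliardo_nirenberg G C].
Proof. by split; [exists 36; exact: gn36|exists 0 => C /gn_gt0/ltW]. Qed.

(** The infimum is attained, because the inequality is closed in C. *)
Lemma gn_opt : gagliardo_nirenberg G CG.
Proof.
apply/gnP => u g su; have [m0 A0] := sobolev_tot_ge0 su.
set X := tot (sq_int u) ^+ 2 * tot (sq_int g); have X0 : 0 <= X by rewrite mulr_ge0 ?sqr_ge0.
rewrite -mulrA -/X; apply/ler_addgt0Pr => d d0.
have d1 : 0 < d / (X + 1) by rewrite divr_gt0// ltr_wpDl.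
have [C /gnP hC hd] := inf_adherent d1 gn_has_inf.
apply: le_trans (hC _ _ su) _; rewrite -mulrA -/X.
have h1 : C * X <= (CG + d / (X + 1)) * X by rewrite ler_wpM2r// ltW.
have h2 : d / (X + 1) * X <= d by rewrite mulrAC ler_pdivrMr ?ltr_wpDl// ler_pM2l// lerDl.
move: h1 h2; clear; lra.
Qed.
Lemma CG_gt0 : 0 < CG. Proof. exact: gn_gt0 gn_opt. Qed.
Lemma muG_sq : muG ^+ 2 * CG = 3.
Proof.
rewrite /critical_mass sqr_sqrtr; first by rewrite divfK// gt_eqF// CG_gt0.
by rewrite divr_ge0// ltW// CG_gt0.
Qed.
Lemma muG_gt0 : 0 < muG.
Proof. by rewrite sqrtr_gt0 divr_gt0// CG_gt0. Qed.
Lemma gn_sharp (C : R) : C < CG -> exists u g, [/\ sobolev u g, 0 < tot (sq_int u), 0 < tot (sq_int g) &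
  C * tot (sq_int u) ^+ 2 * tot (sq_int g) < tot (six_int u)].
Proof.
move=> hC; apply: contrapT => hn.
suff : gagliardo_nirenberg G C.
  by move=> h; have := inf_lbound gn_has_inf.2 h; rewrite leNgt hC.
apply/gnP => u g su; rewrite leNgt; apply/negP => h; apply: hn; exists u, g.
have [m0 A0] := sobolev_tot_ge0 su; have r := rough_GN su.
have s0 := tot_ge0 (six_summ su).
have [z|z] := eqVneq (tot (sq_int u) ^+ 2 * tot (sq_int g)) 0.
  rewrite -mulrA z mulr0 in r; rewrite -mulrA z mulr0 in h.
  by have := lt_le_trans h r; rewrite ltxx.
move: z; rewrite mulf_eq0 expf_eq0 /= negb_or => /andP[z1 z2].
by split; [exact: su|rewrite lt_def z1 m0|rewrite lt_def z2 A0|exact: h].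
Qed.

(** Ground states in terms of real numbers, with a chosen derivative. *)
Definition ground (m : R) u g := [/\ sobolev u g, tot (sq_int u) = m &
  forall v h, sobolev v h -> tot (sq_int v) = m -> energyR u g <= energyR v h].

Lemma no_subcritical (m : R) u g : 0 < m -> m < muG -> ~ ground m u g.
Proof.
move=> m0 hm [su um hu]; have u0 : 0 < tot (sq_int u) by rewrite um.
have B0 := six_pos su u0; have [_ A0] := sobolev_tot_ge0 su.
have /gnP H := gn_opt; have {}H := H _ _ su.
have k3 : CG * m ^+ 2 < 3.
  by rewrite -muG_sq mulrC ltr_pM2r ?CG_gt0// ltr_sqr ?nnegrE// ltW// muG_gt0.
rewrite um in H.
have A1 : 0 < tot (sq_int g).
  rewrite lt_def A0 andbT; apply/eqP => z; by rewrite z mulr0 leNgt B0 in H.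
have h1 : CG * m ^+ 2 * tot (sq_int g) < 3 * tot (sq_int g) by rewrite ltr_pM2r.
have e0 : 0 < energyR u g by rewrite /energyR; move: H h1; clear; lra.
have [v [h [sv vm vh]]] := spreading P m0 e0.
have e1 : energyR v h <= tot (sq_int h) / 2 by rewrite /energyR gerBl divr_ge0// (tot_ge0 (six_summ sv)).
have := hu _ _ sv vm; move: vh e0 e1; clear; lra.
Qed.
Lemma no_supercritical (m : R) u g : mR < m -> ~ ground m u g.
Proof.
move=> hm [su um hu].
have [v [h [sv vm vh]]] := supercritical P (1 - energyR u g) hm.
by have := hu _ _ sv vm; move: vh; rewrite -/(energyR v h); clear; lra.
Qed.

Hypothesis hterm : forall e : edge G, ~ terminal_edge e.

Lemma inv_small (d : R) : 0 < d -> exists N, forall n, (N <= n)%N -> n.+1%:R^-1 <= d.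
Proof.
move=> d0; exists (Num.bound d^-1) => n hn.
rewrite -[X in _ <= X]invrK lef_pV2 ?posrE ?invr_gt0// ltW//.
apply: lt_le_trans (archi_boundP _) _; first by rewrite invr_ge0 ltW.
by rewrite ler_nat; apply: leq_trans hn _.
Qed.

(** A function that violates the Gagliardo-Nirenberg inequality for 3 / m^2 has
    negative energy once its mass is scaled to m. *)
Lemma ground_interior (m : R) : muG < m -> m <= mR -> exists u g, ground m u g.
Proof.
move=> h1 h2; have m0 := lt_trans muG_gt0 h1.
have [w0 [k0 [sw0 mw0 ew0]]] : exists u g, [/\ sobolev u g, tot (sq_int u) = m & energyR u g < 0].
  have C3 : 3 / m ^+ 2 < CG.
    by rewrite ltr_pdivrMr ?exprn_gt0// mulrC -muG_sq ltr_pM2r ?CG_gt0// ltr_sqr ?nnegrE// ltW// muG_gt0.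
  have [v [h [sv v0 A0 hv]]] := gn_sharp C3.
  have [k [k0 km sk tk]] := scale_to m0 sv v0.
  exists (gscale k v), (gscale k h); split=> //; rewrite en_scale//.
  have -> : k ^+ 6 = k ^+ 2 * (k ^+ 2) ^+ 2 by ring.
  have h3 : (k ^+ 2) ^+ 2 * (3 / m ^+ 2 * tot (sq_int v) ^+ 2 * tot (sq_int h)) < (k ^+ 2) ^+ 2 * tot (six_int v).
    by rewrite ltr_pM2l// exprn_gt0.
  have h4 : (k ^+ 2) ^+ 2 * (3 / m ^+ 2 * tot (sq_int v) ^+ 2 * tot (sq_int h)) = 3 * tot (sq_int h).
    move: km k0; move: (k ^+ 2) => kk km kk0.
    by rewrite -km; field; rewrite (gt_eqF kk0) (gt_eqF v0).
  rewrite h4 in h3; have : k ^+ 2 * (3 * tot (sq_int h)) < k ^+ 2 * ((k ^+ 2) ^+ 2 * tot (six_int v)) by rewrite ltr_pM2l.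
  clear; lra.
pose c0 := - energyR w0 k0; have c00 : 0 < c0 by rewrite oppr_gt0.
have c02 : 0 < c0 / 2 by rewrite divr_gt0.
have [a ha] := bound_critical (lmin_gt0 P) (@lmin_le R P) hterm c02.
have bd v h : sobolev v h -> tot (sq_int v) = m -> energyR v h <= - (c0 / 2) -> tot (sq_int h) <= a.
  by move=> sv vm; apply: ha => //; [exact: six_summ sv|rewrite vm].
pose T := [set x | exists v h, [/\ sobolev v h, tot (sq_int v) = m & x = energyR v h]].
have Tlb : lbound T (Num.min (- c0) (- (6 * m ^+ 2 * Num.max a 0))).
  move=> _ [v [h [sv vm ->]]]; rewrite ge_min.
  have [e1|e1] := leP (energyR v h) (- c0); last by rewrite ltW.
  apply/orP; right; have [_ A0] := sobolev_tot_ge0 sv; have := rough_GN sv; rewrite vm.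
  have e2 : energyR v h <= - (c0 / 2) by move: e1 c00; clear; lra.
  have A1 : tot (sq_int h) <= Num.max a 0 by rewrite le_max (bd _ _ sv vm e2).
  have : 6 * m ^+ 2 * tot (sq_int h) <= 6 * m ^+ 2 * Num.max a 0 by rewrite ler_wpM2l// mulr_ge0 ?sqr_ge0.
  rewrite /energyR; move: A0; clear; lra.
have Tinf : has_inf T by split; [exists (energyR w0 k0), w0, k0|exists (Num.min (- c0) (- (6 * m ^+ 2 * Num.max a 0)))].
pose e := inf T.
have he v h : sobolev v h -> tot (sq_int v) = m -> e <= energyR v h.
  by move=> sv vm; apply: inf_lbound Tinf.2 _ _; exists v, h.
have ec : e <= - c0 by rewrite /c0 opprK; exact: he.
have X (n : nat) : exists p : graph_fun G * graph_fun G, [/\ sobolev p.1 p.2, tot (sq_int p.1) = m & energyR p.1 p.2 <= e + Num.min (c0 / 2) n.+1%:R^-1].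
  have d0 : 0 < Num.min (c0 / 2) n.+1%:R^-1 by rewrite lt_min c02 /= invr_gt0 ltr0n.
  have [_ [v [h [sv vm ->]]] hv] := inf_adherent d0 Tinf.
  by exists (v, h); split=> //; exact: ltW.
have [p hp] := choice X.
have low n : energyR (p n).1 (p n).2 <= - (c0 / 2).
  have [_ _ h3] := hp n; have : Num.min (c0 / 2) n.+1%:R^-1 <= c0 / 2 by rewrite ge_min lexx.
  move: h3 ec; clear; lra.
have c03 : 0 < 3 * c0 by rewrite mulr_gt0.
have e0 : e <= 0 by move: ec c00; clear; lra.
have [|||||w [k [sw mw ew]]] := @minimizer R P m e a (3 * c0) (fun n => (p n).1) (fun n => (p n).2) m0 e0 c03 he.
- by move=> n; have [] := hp n.
- by move=> n; have [] := hp n.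
- by move=> n; have [h3 h4 _] := hp n; exact: bd (low n).
- move=> n; have := low n; have [sp _ _] := hp n; have [_ A0] := sobolev_tot_ge0 sp.
  rewrite /energyR; move: A0; clear; lra.
- move=> d d0; have [N hN] := inv_small d0; exists N => n /hN hn.
  have [_ _ h3] := hp n; apply: le_trans h3 _; rewrite lerD2l ge_min hn orbT//.
by exists w, k; split=> // v h sv vm; rewrite /energyR ew; exact: he.
Qed.

(** Take functions that are optimal for the Gagliardo-Nirenberg inequality up to a
    factor 1 - d_n, scaled to mass mu_G.  Then B is at least 3 (1 - d_n) A:
    [bound_strict], for a multiple of mass m1, bounds A from above, and
    [vanishing] excludes small A. *)
Lemma ground_endpoint : muG < mR -> exists u g, ground muG u g.
Proof.
move=> hmu; have m0 := muG_gt0; set m := muG in hmu m0 *.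
have mC : m ^+ 2 * CG = 3 := muG_sq.
have he v h : sobolev v h -> tot (sq_int v) = m -> 0 <= energyR v h.
  move=> sv vm; have /gnP /(_ _ _ sv) := gn_opt; rewrite vm [CG * _]mulrC mC /energyR; clear; lra.
pose m1 := (m + mR) / 2.
have m1R : m1 < mR by rewrite /m1; move: hmu; clear; lra.
have mm1 : m < m1 by rewrite /m1; move: hmu; clear; lra.
have [C C0 hC] := bound_strict (lmin_gt0 P) (@lmin_le R P) hterm m1R.
have [kap kap1 [a1 a10 hV]] := @vanishing R P m1 m1R.
pose q := m1 / m; have q1 : 1 < q by rewrite ltr_pdivlMr// mul1r.
have q0 : 0 < q by exact: lt_trans q1.
have qm : q * m = m1 by rewrite /q divfK// gt_eqF.
(* small enough for both uses: below 1 - kap for [vanishing], and such that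
   q^2 (1 - d0) > 1 for the bound on A *)
pose d0 := Num.min (1 / 2) (Num.min (1 - kap) ((1 - q ^- 2) / 2)).
have qi : q ^- 2 < 1 by rewrite invf_lt1 ?exprn_gt0// expr2 -[1]mulr1 ltr_pM.
have d00 : 0 < d0 by rewrite !lt_min; apply/and3P; split; move: kap1 qi; clear; lra.
have d01 : d0 <= 1 / 2 by rewrite ge_min lexx.
have d02 : d0 <= 1 - kap by rewrite !ge_min lexx !orbT.
have d03 : d0 <= (1 - q ^- 2) / 2 by rewrite !ge_min lexx !orbT.
have X (n : nat) : exists p : graph_fun G * graph_fun G, [/\ sobolev p.1 p.2, tot (sq_int p.1) = m, 0 < tot (sq_int p.2) &
   3 * (1 - d0 * n.+1%:R^-1) * tot (sq_int p.2) < tot (six_int p.1)].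
  have hC' : CG * (1 - d0 * n.+1%:R^-1) < CG.
    by rewrite gtr_pMr ?CG_gt0// gtrBl mulr_gt0// invr_gt0.
  have [v [h [sv v0 A0 hv]]] := gn_sharp hC'.
  have [k [k0 km sk tk]] := scale_to m0 sv v0.
  have [_ [_ tg]] := sobolevZ k sv; have [_ t6] := six_intZ k sv (six_summ sv).
  exists (gscale k v, gscale k h); split; [exact: sk|exact: tk|by rewrite /= tg; exact: mulr_gt0|].
  rewrite /= tg t6; have -> : k ^+ 6 * tot (six_int v) = (k ^+ 2) ^+ 3 * tot (six_int v) by ring.
  have h3 : (k ^+ 2) ^+ 3 * (CG * (1 - d0 * n.+1%:R^-1) * tot (sq_int v) ^+ 2 * tot (sq_int h)) < (k ^+ 2) ^+ 3 * tot (six_int v).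
    by rewrite ltr_pM2l// exprn_gt0.
  apply: le_lt_trans h3; rewrite le_eqVlt; apply/orP; left; apply/eqP.
  by rewrite -mC -km; ring.
have [p hp] := choice X.
have dn n : d0 * n.+1%:R^-1 <= d0 by rewrite ler_piMr ?(ltW d00)// invf_le1// ler1n.
pose a := 4 * C / (q * (q ^+ 2 - 1)).
have q21 : 0 < q ^+ 2 - 1 by rewrite subr_gt0 expr2 -[X in X < _]mulr1 ltr_pM.
have hB n : 3 * (1 - d0) * tot (sq_int (p n).2) <= tot (six_int (p n).1).
  have [_ _ A0 h3] := hp n; apply: le_trans (ltW h3); rewrite ler_pM2r// ler_pM2l// lerD2l lerN2//.
have hA n : tot (sq_int (p n).2) <= a.
  have [sp pm A0 _] := hp n; have h3 := hB n.
  pose k := Num.sqrt q; have kk : k ^+ 2 = q by rewrite sqr_sqrtr// ltW.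
  have [sk [tk tkg]] := sobolevZ k sp; have [sk6 tk6] := six_intZ k sp (six_summ sp).
  have := hC _ _ sk sk6; rewrite tk kk pm qm lexx => /(_ isT); rewrite tkg tk6 kk.
  have -> : k ^+ 6 = q ^+ 3 by rewrite -kk; ring.
  move=> h4; rewrite (ler_pdivlMr _ _ (mulr_gt0 q0 q21)).
  have h5 : q ^+ 3 * (3 * (1 - d0) * tot (sq_int (p n).2)) <= q ^+ 3 * tot (six_int (p n).1) by rewrite ler_pM2l// exprn_gt0.
  have h6 : q ^+ 2 * d0 <= (q ^+ 2 - 1) / 2.
    have : q ^+ 2 * d0 <= q ^+ 2 * ((1 - q ^- 2) / 2) by rewrite ler_pM2l// exprn_gt0.
    by have -> : q ^+ 2 * ((1 - q ^- 2) / 2) = (q ^+ 2 - 1) / 2 by field; rewrite gt_eqF.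
  have h7 : (q * tot (sq_int (p n).2)) * (q ^+ 2 * d0) <= (q * tot (sq_int (p n).2)) * ((q ^+ 2 - 1) / 2) by rewrite ler_pM2l// mulr_gt0.
  move: h4 h5 h7; clear; lra.
have hA1 n : a1 <= tot (sq_int (p n).2).
  have [sp pm A0 h3] := hp n; rewrite leNgt; apply/negP => h4.
  have h5 : tot (six_int (p n).1) <= 3 * kap * tot (sq_int (p n).2).
    by apply: hV sp _ (ltW h4); rewrite pm ltW.
  have h6 : 3 * kap * tot (sq_int (p n).2) <= 3 * (1 - d0 * n.+1%:R^-1) * tot (sq_int (p n).2).
    have h7 : kap <= 1 - d0 * n.+1%:R^-1 by rewrite lerBrDl -lerBrDr (le_trans (dn n)).
    by rewrite ler_pM2r// ler_pM2l.
  by have := lt_le_trans h3 (le_trans h5 h6); rewrite ltxx.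
pose beta := 3 * (1 - d0) * a1.
have b0 : 0 < beta by rewrite mulr_gt0// mulr_gt0// subr_gt0; move: d01; clear; lra.
have [|||||w [k [sw mw ew]]] := @minimizer R P m 0 a beta (fun n => (p n).1) (fun n => (p n).2) m0 (lexx 0) b0 he.
- by move=> n; have [] := hp n.
- by move=> n; have [] := hp n.
- exact: hA.
- move=> n; apply: le_trans (hB n); rewrite ler_wpM2l// mulr_ge0// subr_ge0; move: d01; clear; lra.
- move=> d dd; have aa : 0 <= a.
    by have [_ _ A0 _] := hp 0; exact: le_trans (ltW A0) (hA 0).
  have d1 : 0 < d / (a + 1) by rewrite divr_gt0// ltr_wpDl.
  have [N hN] := inv_small d1; exists N => n /hN hn.
  have [_ _ A0 h3] := hp n; rewrite add0r.
  have h4 : (d0 * n.+1%:R^-1) * tot (sq_int (p n).2) <= 1 * (n.+1%:R^-1 * a).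
    have i0 : 0 <= n.+1%:R^-1 :> R by rewrite invr_ge0 ler0n.
    have x1 : d0 * n.+1%:R^-1 <= n.+1%:R^-1 by rewrite ler_piMl//; move: d01; clear; lra.
    by rewrite mul1r; exact: (ler_pM (mulr_ge0 (ltW d00) i0) (ltW A0) x1 (hA n)).
  have h5 : n.+1%:R^-1 * a <= d / (a + 1) * a by rewrite ler_wpM2r.
  have h6 : d / (a + 1) * a <= d by rewrite mulrAC ler_pdivrMr ?ltr_wpDl// ler_pM2l// lerDl.
  rewrite mul1r in h4; have h7 := le_trans h4 (le_trans h5 h6).
  move: h3 h7 dd; move: (d0 * n.+1%:R^-1) => i; clear; lra.
by exists w, k; split=> // v h sv vm; rewrite /energyR ew; exact: he.
Qed.

Lemma energyE u g : sobolev u g -> energy u = (energyR u g)%:E.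
Proof.
move=> su; have [_ e] := sobolev_deriv su.
rewrite /energy e (Lp6E su (six_summ su)) -!EFinM -EFinB; congr (_%:E); rewrite /energyR; by field.
Qed.
Lemma massE u g (m : R) : sobolev u g -> (Lp_normX 2 u = m%:E) <-> tot (sq_int u) = m.
Proof. by move=> su; rewrite (Lp2E su); split=> [[]|->]. Qed.
Lemma ground_stateP (m : R) : (exists u : graph_fun G, ground_state m u) <-> exists u g, ground m u g.
Proof.
split=> [[u [[h1 hm] he]]|[u [g [su um hu]]]].
- have su := in_H1_sobolev h1; exists u, (graph_deriv u); split=> //; first exact: (massE m su).1.
  move=> v h sv vm; rewrite -lee_fin -(energyE su) -(energyE sv) he.
  apply: ereal_inf_lbound; exists v; last exact: erefl.
  by split; [exact: (sobolev_deriv sv).1|exact: (massE m sv).2].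
- exists u; split; first by split; [exact: (sobolev_deriv su).1|exact: (massE m su).2].
  apply/eqP; rewrite eq_le; apply/andP; split; last first.
    apply: ereal_inf_lbound; exists u; last exact: erefl.
    by split; [exact: (sobolev_deriv su).1|exact: (massE m su).2].
  apply: le_ereal_inf_tmp => _ [v [h1 hm] <-]; have sv := in_H1_sobolev h1.
  by rewrite (energyE su) (energyE sv) lee_fin; apply: hu => //; exact/(massE m sv).
Qed.
End Main.

Theorem theorem1p3 (R : realType) (P : periodicity_data R)
  (hdeg3 : exists v : vtx (periodic_graph P), degree_ge3 v)
  (hterm : forall e : edge (periodic_graph P), ~ terminal_edge e)
  (hper : ~ H_per (periodic_graph P))
  (hmass : critical_mass (periodic_graph P) < critical_mass_line R)
  (m : R) (hm : 0 < m) :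
  (exists u : graph_fun (periodic_graph P), ground_state m u) <->
  critical_mass (periodic_graph P) <= m <= critical_mass_line R.
Proof.
split=> [/ground_stateP [u [g hg]]|/andP[h1 h2]].
  apply/andP; split; rewrite leNgt; apply/negP => h.
    exact: no_subcritical hm h hg.
  exact: no_supercritical h hg.
apply/ground_stateP; move: h1; rewrite le_eqVlt => /predU1P[<-|h1].
  exact: ground_endpoint.
exact: ground_interior.
Qed.
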